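(* Let $0\le s\le1-N^{-1+\delta}$ for some fixed $\delta>0$. Fix an integer $u=O(1)$ and signs $\sigma_1,\dots,\sigma_u\in\{+,-\}$, and consider a function of $b\in\mathbb Z_L^2$ of the form $$Y_{s,b}=\sum_{\mathbf x,\mathbf y\in(\mathbb Z_{WL}^2)^u}C_{b,\mathbf x,\mathbf y}\prod_{i=1}^uG_s(\sigma_i)_{x_iy_i},$$ where the coefficients $C_{b,\mathbf x,\mathbf y}$ are deterministic and satisfy: (i) $\max|C_{b,\mathbf x,\mathbf y}|\le N^{C'}$ for some $C'=O(1)$; (ii) there is a fixed $\tau>0$ such that $\max_i\big(|[x_i]-b|_L+|[y_i]-b|_L\big)\ge W^\tau\ell_s$ implies $C_{b,\mathbf x,\mathbf y}=0$; (iii) there is a deterministic $\Lambda>0$ (possibly $N$-dependent) such that $\max_b|Y_{s,b}|\prec\Lambda$. Suppose moreover that at time $s$ the following two estimates hold: $$\|G_s-m\|_{\max}\prec M_s^{-1/2},$$ and, for some $s_0\in[0,s]$ and every $D>0$, $$\big|(\mathcal L-\mathcal K)_{s,(+,-),(a_1,a_2)}\big|\prec(\eta_{s_0}/\eta_s)^4M_s^{-2}\exp\Big(-\frac{|a_1-a_2|_L^{1/2}}{\ell_s^{1/2}}\Big)+W^{-D}$$ for $a_1,a_2\in\mathbb Z_L^2$. Let $Z=(Z_{ab})_{a,b\in\mathbb Z_L^2}$ be a deterministic matrix. Case 1. Let $s\le t<1$ and suppose that $|a-b|_L\ge W^\tau\ell_t$ implies $Z_{ab}=0$. Then for any $D>0$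 and for some constant $C=O(1)$, $$\sum_bZ_{ab}(Y_{s,b}-\mathbb EY_{s,b})\prec W^{C\tau}\,\ell_t\,\ell_s\cdot\max_b|Z_{ab}|\cdot\Lambda+W^{-D}\max_b|Z_{ab}|.$$ Case 2. Suppose that $Z_{ab}\prec(1+|a-b|_L)^{-1}$ for $a,b\in\mathbb Z_L^2$. Then for any $D>0$ and some constant $C=O(1)$, $$\sum_bZ_{ab}(Y_{s,b}-\mathbb EY_{s,b})\prec W^{C\tau}\,\ell_s\cdot\Lambda+W^{-D}.$$
   Context: Setting. $W\ge1$, $L\ge3$ are integers, $N=W^2L^2$, $W\ge N^{\mathfrak c}$ for a fixed $\mathfrak c>0$; asymptotics are as $N\to\infty$, and $O(1)$ denotes constants independent of $N$. $|\cdot|_L$ is the periodic $L^1$ distance on $\mathbb Z_L^2$, $\mathbb Z_n=\mathbb Z/n\mathbb Z$. $\mathbb Z_{WL}^2$ is partitioned into blocks $\mathcal I_a^{(2)}=\mathcal I_{a(1)}\times\mathcal I_{a(2)}$, $a\in\mathbb Z_L^2$, with $\mathcal I_j=\{(j-1)W+1,\dots,jW\}$; $[x]$ is the label of the block containing $x$. $S^{(B)}_{ab}=\frac15\mathbf 1(|a-b|_L\le1)$, $S_{xy}=W^{-2}S^{(B)}_{[x][y]}$, $(E_a)_{xy}=\delta_{xy}W^{-2}\mathbf 1(x\in\mathcal I_a^{(2)})$. $H_t$ is the Hermitian matrix Brownian motion $dH_{t,xy}=\sqrt{S_{xy}}\,dB_{t,xy}$, $H_0=0$, with $B_{xy}$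 independent standard complex Brownian motions up to $B_{yx}=\overline{B_{xy}}$. Fix $\kappa>0$ and $|E|\le2-\kappa$; $m=\frac{-E+\mathrm i\sqrt{4-E^2}}2$, $z_t=E+(1-t)m$, $\eta_t=\operatorname{Im}z_t=(1-t)\operatorname{Im}m$, $\ell_t=\min((1-t)^{-1/2},L)$, $M_t=W^2\ell_t^2\eta_t$. $G_t=G_t(+)=(H_t-z_t)^{-1}$, $G_t(-)=G_t^\dagger$. $\|A\|_{\max}=\max_{x,y}|A_{xy}|$, and $G_t-m$ means $G_t-mI$. $\mathcal L_{t,(+,-),(a,b)}=\operatorname{Tr}\big(G_tE_aG_t^\dagger E_b\big)$ and $\mathcal K_{t,(+,-),(a,b)}=W^{-2}\big((I-tS^{(B)})^{-1}\big)_{ab}$ (note $|m|=1$). Stochastic domination: $\xi\prec\zeta$ (uniformly in the indices) means that for all $\varepsilon,D>0$, $\mathbb P(\bigcup_v\{|\xi(v)|>N^\varepsilon\zeta(v)\})\le N^{-D}$ for $N\ge N_0(\varepsilon,D)$; for deterministic quantities, $|\xi|\le N^\varepsilon\zeta$ for every $\varepsilon>0$ and large $N$. *)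

(* Defs.v *)
From HB Require Import structures.
From mathcomp Require Import all_boot all_order all_algebra.
From mathcomp Require Import all_classical all_reals all_analysis.
From mathcomp Require Export complex.

Set Implicit Arguments.
Unset Strict Implicit.
Unset Printing Implicit Defensive.

Import Order.TTheory GRing.Theory Num.Theory.
Import numFieldNormedType.Exports.
Local Open Scope classical_set_scope.
Local Open Scope ring_scope.
Local Open Scope complex_scope.

(** ** Lattice and blocks *)

(* Z_n is represented by 'I_n.  Residues are taken in {0, .., n-1}, so that the
   block with label j is {jW, .., (j+1)W - 1}; this is the translate by one of
   the labelling by {1, .., n}. *)
Definition site (W L : nat) := ('I_(W * L) * 'I_(W * L))%type.
Definition block (L : nat) := ('I_L * 'I_L)%type.

Lemma blockidx_subproof (W L : nat) (x : 'I_(W * L)) : (x %/ W < L)%N.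
Proof.
have hx := ltn_ord x.
have W0 : (0 < W)%N by case: W x hx => // x; rewrite mul0n.
by rewrite ltn_divLR // [(L * W)%N]mulnC.
Qed.

Definition blockidx (W L : nat) (x : 'I_(W * L)) : 'I_L :=
  Ordinal (blockidx_subproof x).

Definition blockof (W L : nat) (x : site W L) : block L :=
  (blockidx x.1, blockidx x.2).

Definition circ_dist (L i j : nat) : nat :=
  minn ((i - j) + (j - i)) (L - ((i - j) + (j - i))).

Definition bdist (L : nat) (a b : block L) : nat :=
  circ_dist L a.1 b.1 + circ_dist L a.2 b.2.

Definition Nsize (W L : nat) : nat := (W ^ 2 * L ^ 2)%N.

(** ** Matrices indexed by a finite type *)

Definition fmx (K : Type) (I : finType) (f : I -> I -> K) : 'M[K]_#|I| :=
  \matrix_(i, j) f (enum_val i) (enum_val j).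

Definition fentry (K : Type) (I : finType) (A : 'M[K]_#|I|) (x y : I) : K :=
  A (enum_rank x) (enum_rank y).

Definition adjmx (R : rcfType) (n : nat) (A : 'M[R[i]]_n) : 'M[R[i]]_n :=
  \matrix_(i, j) (A j i)^*.

Definition maxnorm (R : rcfType) (n : nat) (A : 'M[R[i]]_n) : R :=
  \big[Num.max/0]_i \big[Num.max/0]_j Normc.normc (A i j).

(** ** Brownian motion *)

(* Only the values of [B] at nonnegative times are constrained. *)
Definition standard_BM (R : realType) (d : measure_display)
    (T : measurableType d) (P : probability T R) (B : R -> T -> R) : Prop :=
  [/\ forall t, 0 <= t -> measurable_fun setT (B t),
      {ae P, forall w, B 0 w = 0},
      {ae P, forall w, {within [set t : R | 0 <= t], continuous (B ^~ w)}},
      (forall (s t : R) (A : set R), 0 <= s -> s < t -> measurable A ->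
         P [set w | A (B t w - B s w)] = normal_prob 0 (Num.sqrt (t - s)) A)
    & forall (k : nat) (t : nat -> R) (A : nat -> set R),
        0 <= t 0%N -> (forall j, t j <= t j.+1) ->
        (forall j, measurable (A j)) ->
        P [set w | forall j, (j < k)%N -> A j (B (t j.+1) w - B (t j) w)] =
        (\prod_(j < k) P [set w | A j (B (t j.+1) w - B (t j) w)%R])%E ].

(* Mutual independence of the sigma-algebras generated by the processes
   (X i t)_{t >= 0}, tested on the pi-systems of finite-dimensional cylinders. *)
Definition indep_processes (R : realType) (d : measure_display)
    (T : measurableType d) (P : probability T R) (I : finType)
    (X : I -> R -> T -> R) : Prop :=
  forall (k : nat) (t : I -> 'I_k -> R) (A : I -> 'I_k -> set R),
    (forall i j, 0 <= t i j) -> (forall i j, measurable (A i j)) ->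
    P [set w | forall i j, A i j (X i (t i j) w)] =
    (\prod_(i : I) P [set w | forall j, A i j (X i (t i j) w)])%E.

(* The real coordinates of a Hermitian family: for x != y, listed as
   sqrt 2 Re B_xy for x before y in a fixed enumeration, and sqrt 2 Im B_xy
   for x after y. *)
Definition bm_coord (R : realType) (T : Type) (I : finType)
    (B : I -> I -> R -> T -> R[i]) (p : I * I) (t : R) (w : T) : R :=
  if p.1 == p.2 then complex.Re (B p.1 p.2 t w)
  else if (enum_rank p.1 < enum_rank p.2)%N
  then Num.sqrt 2 * complex.Re (B p.1 p.2 t w)
  else Num.sqrt 2 * complex.Im (B p.1 p.2 t w).

(* Standard complex Brownian motions, E|B_xy(t)|^2 = t, independent up to the
   symmetry B_yx = conj B_xy; in particular B_xx is a standard real one. *)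
Definition hermitian_BM (R : realType) (d : measure_display)
    (T : measurableType d) (P : probability T R) (I : finType)
    (B : I -> I -> R -> T -> R[i]) : Prop :=
  [/\ forall x y t w, 0 <= t -> B y x t w = (B x y t w)^*,
      forall p, standard_BM P (bm_coord B p)
    & indep_processes P (bm_coord B)].

(** ** The random band matrix and its resolvent *)

Definition SB (R : realType) (L : nat) (a b : block L) : R :=
  if (bdist a b <= 1)%N then 5^-1 else 0.

Definition Svar (R : realType) (W L : nat) (x y : site W L) : R :=
  W%:R ^- 2 * SB R (blockof x) (blockof y).

Definition Hmx (R : realType) (T : Type) (W L : nat)
    (B : site W L -> site W L -> R -> T -> R[i]) (t : R) (w : T) :
    'M[R[i]]_#|{: site W L}| :=
  fmx (fun x y => (Num.sqrt (Svar R x y))%:C * B x y t w).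

Definition msc (R : realType) (E : R) : R[i] :=
  (- E / 2) +i* (Num.sqrt (4 - E ^+ 2) / 2).

Definition zt (R : realType) (E t : R) : R[i] := E%:C + (1 - t)%:C * msc E.

Definition eta (R : realType) (E t : R) : R := complex.Im (zt E t).

Definition ell (R : realType) (L : nat) (t : R) : R :=
  Num.min (Num.sqrt (1 - t))^-1 L%:R.

Definition Mt (R : realType) (W L : nat) (E t : R) : R :=
  W%:R ^+ 2 * ell L t ^+ 2 * eta E t.

(* [true] stands for the sign +, [false] for the sign -. *)
Definition green (R : realType) (T : Type) (W L : nat)
    (B : site W L -> site W L -> R -> T -> R[i]) (E t : R) (sg : bool) (w : T) :
    'M[R[i]]_#|{: site W L}| :=
  let G := invmx (Hmx B t w - (zt E t)%:M) in
  if sg then G else adjmx G.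

Definition Eblk (R : realType) (W L : nat) (a : block L) :
    'M[R[i]]_#|{: site W L}| :=
  fmx (fun x y => if (x == y) && (blockof x == a) then W%:R ^- 2 else 0).

Definition Lloop (R : realType) (T : Type) (W L : nat)
    (B : site W L -> site W L -> R -> T -> R[i]) (E t : R) (a b : block L)
    (w : T) : R[i] :=
  \tr (green B E t true w *m Eblk R W a *m green B E t false w *m Eblk R W b).

Definition Kloop (R : realType) (W L : nat) (t : R) (a b : block L) : R :=
  W%:R ^- 2 *
  fentry (invmx (1%:M - t *: fmx (@SB R L)) : 'M[R]_#|{: block L}|) a b.

Definition Ysum (R : realType) (T : Type) (W L u : nat) (sg : 'I_u -> bool)
    (B : site W L -> site W L -> R -> T -> R[i]) (E s : R)
    (C : block L -> {ffun 'I_u -> site W L} -> {ffun 'I_u -> site W L} -> R[i])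
    (b : block L) (w : T) : R[i] :=
  \sum_(x : {ffun 'I_u -> site W L}) \sum_(y : {ffun 'I_u -> site W L})
    C b x y * \prod_(i < u) fentry (green B E s (sg i) w) (x i) (y i).

Definition cexpect (R : realType) (d : measure_display)
    (T : measurableType d) (P : probability T R) (Y : T -> R[i]) : R[i] :=
  fine ('E_P[fun w => complex.Re (Y w)])%E
  +i* fine ('E_P[fun w => complex.Im (Y w)])%E.

(** ** Stochastic domination *)

(* All N-dependent objects are sequences indexed by n; [N n] is the size of the
   n-th model, which lives on its own probability space.  The domination is
   uniform in the index v. *)
Definition stoch_dom (R : realType) (N : nat -> nat)
    (d : nat -> measure_display) (T : forall n, measurableType (d n))
    (P : forall n, probability (T n) R) (V : nat -> Type)
    (xi : forall n, V n -> T n -> R) (zeta : forall n, V n -> R) : Prop :=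
  forall eps D : R, 0 < eps -> 0 < D ->
  exists N0 : nat, forall n, (N0 <= N n)%N ->
    (P n [set w | exists v : V n,
            ((N n)%:R `^ eps * zeta n v < `|xi n v w|)%R] <=
     ((N n)%:R `^ (- D))%:E)%E.

Definition det_dom (R : realType) (N : nat -> nat) (V : nat -> Type)
    (xi zeta : forall n, V n -> R) : Prop :=
  forall eps : R, 0 < eps ->
  exists N0 : nat, forall n, (N0 <= N n)%N ->
    forall v : V n, `|xi n v| <= (N n)%:R `^ eps * zeta n v.

(* Main.v *)
From HB Require Import structures.
From mathcomp Require Import measurable_realfun ring lra zify.
Require Import Defs.
From mathcomp Require Import all_boot all_order all_algebra.
From mathcomp Require Import all_classical all_reals all_analysis.
Set Implicit Arguments.
Unset Strict Implicit.
Unset Printing Implicit Defensive.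
Import Order.TTheory GRing.Theory Num.Theory.
Import numFieldNormedType.Exports.
Local Open Scope classical_set_scope.
Local Open Scope ring_scope.
Local Open Scope complex_scope.

(** Why the estimate holds.  At block distance r0 = W^tau ell_s the resolvent
    is smaller than any power of N, outside an event of negligible probability:
    |G_xy|^2 is at most W^4 times the (+,-) loop at the blocks of x and y
    ([green_sqr_le_Lloop]), the deterministic part K of the loop decays
    exponentially on the scale ell_s by a Combes-Thomas argument
    ([Kloop_decay]), and the difference L - K decays by assumption
    ([green_far_prob]).  By the resolvent identity, Y_b then hardly changes when
    the entries of H are set to zero except between sites of the ball of radius
    2 r0 around b ([resolvent_local], [Ysum_local]).

    The localised observable, truncated at its typical size Lambda, is a function
    of the matrix entries inside that ball only.  The torus is coloured with
    (2q)^2 colours, q of order r0, so that blocks of the same colour have disjoint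
    balls ([colour_sep]); within one colour the localised observables are
    therefore independent, and a Chernoff bound controls their weighted sum by
    Lambda times the l2 norm of the weights ([concentration]).  Summation over the
    colours costs, by Cauchy-Schwarz, the square root of their number, that is a
    factor of order r0 ([coloured_concentration]).  Up to N^eps the sum in the
    theorem is thus at most W^tau ell_s Lambda (sum_b |Z_ab|^2)^(1/2), plus an
    error smaller than any power of N times max_b |Z_ab| ([uniform_concentration]).
    A bound Lambda for Y_b with high probability suffices, because the trivial
    bound |G_xy| <= 1 / eta_s makes the contribution of the exceptional event to
    the expectations negligible ([expectation_close]).

    The two cases differ only in the l2 norm of a row of Z.  If
    |Z_ab| <= h / (1 + |a - b|), this norm is at most h times a logarithm, because
    the torus is two-dimensional ([sum_inv_sqr_bdist]); this is Case 2.  A row with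
    entries at most v that vanish at distance W^tau ell_t satisfies such a bound
    with h = 2 W^tau ell_t v, which is Case 1.  Both cases hold with C = 2. *)

(** * Independence of disjoint groups of coordinates *)

Section IndepSigma.
Context (R : realType) (d : measure_display) (T : measurableType d)
  (P : probability T R).
Implicit Types (G : set (set T)).
Local Open Scope ereal_scope.

(** Both sides are finite measures in A, one a restriction of P and the other a
    multiple of P; they agree on a pi-system, hence on what it generates. *)
Lemma indep_pi_half G (B : set T) :
  G `<=` measurable -> G setT -> setI_closed G -> measurable B ->
  (forall A, G A -> P (A `&` B) = P A * P B) ->
  forall A, <<s G >> A -> P (A `&` B) = P A * P B.
Proof.
move=> Gm GT GI mB hG A sA.
have PBfin : P B \is a fin_num by rewrite fin_num_measure.
pose b : {nonneg R} := NngNum (fine_ge0 (measure_ge0 P B)).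
have hb X : P X * P B = mscale b P X.
  by rewrite /mscale /= fineK// muleC.
rewrite hb -/(mrestr P mB A).
apply: (@g_sigma_algebra_measure_unique _ R T G Gm (fun=> setT) _ _ (mrestr P mB) (mscale b P)) sA => //.
- by rewrite bigcup_const.
- by move=> X GX; rewrite -[LHS]/(P (X `&` B)) hG// hb.
- move=> _; rewrite -[X in X < _]/(P (setT `&` B)) setTI.
  by rewrite (le_lt_trans (probability_le1 _ _)) ?ltry.
Qed.

Lemma sub_gsigma_measurable G : G `<=` measurable -> <<s G >> `<=` measurable.
Proof.
by move=> Gm; apply: smallest_sub => //; exact: sigma_algebra_measurable.
Qed.

Lemma indep_pi G1 G2 :
  G1 `<=` measurable -> G1 setT -> setI_closed G1 ->
  G2 `<=` measurable -> G2 setT -> setI_closed G2 ->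
  (forall A B, G1 A -> G2 B -> P (A `&` B) = P A * P B) ->
  forall A B, <<s G1 >> A -> <<s G2 >> B -> P (A `&` B) = P A * P B.
Proof.
move=> G1m G1T G1I G2m G2T G2I h A B sA sB.
rewrite setIC muleC; apply: (indep_pi_half G2m) sB => //.
  exact: sub_gsigma_measurable sA.
move=> C GC; rewrite setIC muleC.
apply: (indep_pi_half G1m) sA => //; first exact: G2m.
by move=> D GD; exact: h.
Qed.

End IndepSigma.

(** The joint law of X and Y is the product of their laws, by uniqueness of the
    product measure; the rest is Tonelli. *)
Lemma indep_integral_mul_RV (R : realType) (d d1 d2 : measure_display)
    (T : measurableType d) (P : probability T R)
    (T1 : measurableType d1) (T2 : measurableType d2)
    (X : {mfun T >-> T1}) (Y : {mfun T >-> T2}) (f : T1 -> R) (g : T2 -> R) :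
  (forall A B, measurable A -> measurable B ->
     P (X @^-1` A `&` Y @^-1` B) = P (X @^-1` A) * P (Y @^-1` B))%E ->
  measurable_fun setT f -> measurable_fun setT g ->
  (forall x, 0 <= f x) -> (forall y, 0 <= g y) ->
  (\int[P]_w (f (X w) * g (Y w))%:E =
   (\int[P]_w (f (X w))%:E) * (\int[P]_w (g (Y w))%:E))%E.
Proof.
move=> ind mf mg f0 g0.
pose P1 := distribution P X; pose P2 := distribution P Y.
pose h : T -> T1 * T2 := fun w => (X w, Y w).
have mh : measurable_fun setT h by exact: measurable_fun_pair.
pose mh' := isMeasurableFun.Build _ _ _ _ h mh.
pose hh : {mfun T >-> (T1 * T2)%type} := HB.pack h mh'.
pose F : T1 * T2 -> \bar R := fun p => (f p.1 * g p.2)%:E.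
have mF : measurable_fun setT F.
  apply/measurable_EFinP; apply: measurable_funM.
    exact: (measurableT_comp mf measurable_fst).
  exact: (measurableT_comp mg measurable_snd).
have F0 p : (0 <= F p)%E by rewrite lee_fin mulr_ge0.
have -> : (\int[P]_w (f (X w) * g (Y w))%:E = \int[distribution P hh]_p F p)%E.
  by rewrite ge0_integral_distribution.
have -> : (\int[distribution P hh]_p F p = \int[P1 \x P2]_p F p)%E.
  apply: eq_measure_integral => A mA _; apply/esym.
  apply: (@product_measure_unique _ _ T1 T2 R P1 P2 (distribution P hh)) => //.
rewrite (fubini_tonelli1 F)//= /fubini_F.
have -> : (\int[P1]_x \int[P2]_y F (x, y) =
    \int[P1]_x ((f x)%:E * \int[P2]_y (g y)%:E))%E.
  apply: eq_integral => x _; rewrite /F /=.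
  under eq_integral do rewrite EFinM.
  rewrite ge0_integralZl//.
  - exact/measurable_EFinP.
  - by move=> y _; rewrite lee_fin.
  - by rewrite lee_fin.
rewrite ge0_integralZr//; last 3 first.
- exact/measurable_EFinP.
- by move=> y _; rewrite lee_fin.
- by apply: integral_ge0 => y _; rewrite lee_fin.
congr (_ * _)%E.
- rewrite ge0_integral_distribution//.
  exact/measurable_EFinP.
- rewrite ge0_integral_distribution//.
  exact/measurable_EFinP.
Qed.

(** The random variables of the previous lemma are here the identity map, read
    as a measurable map into T with one of the two smaller sigma-algebras. *)
Lemma indep_integral_mul (R : realType) (d : measure_display)
    (T : measurableType d) (P : probability T R) (G1 G2 : set (set T))
    (f g : T -> R) :
  G1 `<=` measurable -> G2 `<=` measurable ->
  (forall A B, <<s G1 >> A -> <<s G2 >> B -> P (A `&` B) = P A * P B)%E ->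
  measurable_fun setT (f : g_sigma_algebraType G1 -> R) ->
  measurable_fun setT (g : g_sigma_algebraType G2 -> R) ->
  (forall w, 0 <= f w) -> (forall w, 0 <= g w) ->
  (\int[P]_w (f w * g w)%:E = (\int[P]_w (f w)%:E) * (\int[P]_w (g w)%:E))%E.
Proof.
move=> G1m G2m ind mf mg f0 g0.
pose id1 : T -> g_sigma_algebraType G1 := fun w => w.
pose id2 : T -> g_sigma_algebraType G2 := fun w => w.
have mid1 : measurable_fun setT id1.
  by move=> _ A mA; rewrite setTI; exact: sub_gsigma_measurable mA.
have mid2 : measurable_fun setT id2.
  by move=> _ A mA; rewrite setTI; exact: sub_gsigma_measurable mA.
pose X : {mfun T >-> g_sigma_algebraType G1} :=
  HB.pack id1 (isMeasurableFun.Build _ _ _ _ id1 mid1).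
pose Y : {mfun T >-> g_sigma_algebraType G2} :=
  HB.pack id2 (isMeasurableFun.Build _ _ _ _ id2 mid2).
exact: (@indep_integral_mul_RV _ _ _ _ _ P _ _ X Y f g).
Qed.

Section Cylinders.
Context (R : realType) (d : measure_display) (T : measurableType d)
  (P : probability T R) (J : finType) (xi : J -> T -> R).

(** The cylinders over G form a pi-system that generates the sigma-algebra of
    the coordinates in G. *)
Definition cyl (G : {set J}) : set (set T) :=
  [set C | exists2 A : J -> set R, (forall j, measurable (A j)) &
     C = [set w | forall j, j \in G -> A j (xi j w)]].

Lemma cyl_setT G : cyl G setT.
Proof. by exists (fun=> setT) => //; rewrite predeqE. Qed.

Lemma cyl_setI G : setI_closed (cyl G).
Proof.
move=> _ _ [A mA ->] [B mB ->]; exists (fun j => A j `&` B j).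
  by move=> j; exact: measurableI.
rewrite predeqE => w; split=> [[hA hB] j jG|h]; first by split; [exact: hA|exact: hB].
by split=> j jG; case: (h j jG).
Qed.

Lemma cyl_sub (G H : {set J}) : G \subset H -> cyl G `<=` cyl H.
Proof.
move=> /fintype.subsetP GH _ [A mA ->].
exists (fun j => if j \in G then A j else setT).
  by move=> j; case: ifP.
rewrite predeqE => w; split=> [h j jH|h j jG]; first by case: ifPn => // /h.
by have := h j (GH _ jG); rewrite jG.
Qed.

Lemma measurable_cyl_coord (G : {set J}) j : j \in G ->
  measurable_fun setT (xi j : g_sigma_algebraType (cyl G) -> R).
Proof.
move=> jG _ A mA; rewrite setTI; apply: sub_sigma_algebra.
exists (fun i => if i == j then A else setT); first by move=> i; case: ifP.
rewrite predeqE => w; split=> [h i iG|/(_ j jG)]; last by rewrite eqxx.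
by case: eqP => // ->.
Qed.

Hypothesis mxi : forall j, measurable_fun setT (xi j).

Lemma cyl_measurable G : cyl G `<=` measurable.
Proof.
move=> _ [A mA ->].
have -> : [set w | forall j, j \in G -> A j (xi j w)] =
   \big[setI/setT]_(j in G) (xi j @^-1` (A j)).
  rewrite predeqE => w; split.
    by move=> h; elim/big_ind: _ => // j jG; exact: h.
  by move=> + j jG; rewrite (bigD1 j)//= => -[].
elim/big_ind: _ => //; first by move=> *; exact: measurableI.
by move=> j _; rewrite -[X in measurable X]setTI; exact: mxi.
Qed.

Hypothesis indep : forall A : J -> set R, (forall j, measurable (A j)) ->
  P [set w | forall j, A j (xi j w)] = (\prod_j P [set w | A j (xi j w)])%E.

(** A cylinder over G and a cylinder over H intersect in a cylinder over the
    disjoint union of G and H, whose probability factorises coordinatewise. *)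
Lemma cyl_indep (G H : {set J}) A B : [disjoint G & H]%bool ->
  <<s cyl G >> A -> <<s cyl H >> B -> (P (A `&` B) = P A * P B)%E.
Proof.
move=> dGH; apply: indep_pi; [exact: cyl_measurable|exact: cyl_setT|
  exact: cyl_setI|exact: cyl_measurable|exact: cyl_setT|exact: cyl_setI|].
move=> _ _ [C mC ->] [D mD ->].
have prodG (K : {set J}) (E : J -> set R) : (forall j, measurable (E j)) ->
    P [set w | forall j, j \in K -> E j (xi j w)] =
    (\prod_(j in K) P [set w | E j (xi j w)])%E.
  move=> mE; have := @indep (fun j => if j \in K then E j else setT).
  rewrite (_ : [set w | _] = [set w | forall j, j \in K -> E j (xi j w)]); last first.
    rewrite predeqE => w; split=> [h j jK|h j]; first by have := h j; rewrite jK.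
    by case: ifPn => // /h.
  move=> ->; last by move=> j; case: ifP.
  rewrite [RHS]big_mkcond; apply: eq_bigr => j _; case: ifP => // _.
  by rewrite (_ : [set w | _] = setT) ?probability_setT// predeqE.
have -> : [set w | forall j, j \in G -> C j (xi j w)] `&`
          [set w | forall j, j \in H -> D j (xi j w)] =
  [set w | forall j, j \in G :|: H ->
     (if j \in G then C j else D j) (xi j w)].
  rewrite predeqE => w; split=> [[hC hD] j|h].
    rewrite inE; case: ifP => [jG _|_ /= jH]; [exact: hC|exact: hD].
  split=> j jK; have := h j; rewrite inE jK ?orbT => /(_ isT); first by [].
  by case: ifP => // jG; have := disjointFr dGH jG; rewrite jK.
have mCD j : measurable (if j \in G then C j else D j) by case: ifP.
rewrite (prodG (G :|: H) (fun j => if j \in G then C j else D j))// !prodG//.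
rewrite [LHS](eq_bigl [in [predU G & H]]); last first.
  by move=> j; rewrite !inE.
rewrite bigU//=; congr (_ * _)%E; apply: eq_bigr => j jK; first by rewrite jK.
by case: ifP => // jG; have := disjointFr dGH jG; rewrite jK.
Qed.
End Cylinders.

(** * A Chernoff bound for independent bounded variables *)

(** From exp x (1 - x) <= 1 and 1 <= (1 + x + 2 x^2) (1 - x) for x <= 1/2. *)
Lemma expR_le_quadratic (R : realType) (x : R) :
  x <= 2^-1 -> expR x <= 1 + x + 2 * x ^+ 2.
Proof.
move=> x2.
have h : expR x * (1 - x) <= 1.
  rewrite -[leRHS](expRxMexpNx_1 x) ler_pM2l ?expR_gt0//.
  by have := expR_ge1Dx (- x).
have : expR x <= (1 - x)^-1.
  by rewrite -(ler_pM2r (_ : 0 < 1 - x)) ?mulVf; lra.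
move/le_trans; apply.
rewrite -(ler_pM2r (_ : 0 < 1 - x)) ?mulVf; [|lra..].
have -> : (1 + x + 2 * x ^+ 2) * (1 - x) = 1 + x ^+ 2 * (1 - 2 * x) by ring.
by rewrite lerDl mulr_ge0 ?sqr_ge0//; lra.
Qed.

Section Concentration.
Context (R : realType) (d : measure_display) (T : measurableType d)
  (P : probability T R).

Lemma bounded_integrable (f : T -> R) (M : R) :
  measurable_fun setT f -> (forall w, `|f w| <= M) ->
  P.-integrable setT (EFin \o f).
Proof.
move=> mf hM; apply: measurable_bounded_integrable => //.
  by rewrite (le_lt_trans (probability_le1 _ _)) ?ltry.
by exists M; split=> [|y My w _ /=]; rewrite ?num_real// (le_trans (hM w))// ltW.
Qed.

Lemma integral_prob_cst (a : R) : (\int[P]_w a%:E = a%:E)%E.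
Proof.
rewrite integral_cst//.
rewrite -[RHS]mule1; congr (_ * _)%E; exact: probability_setT.
Qed.

Lemma expectation_bounded (f : T -> R) (M : R) :
  measurable_fun setT f -> (forall w, `|f w| <= M) ->
  ('E_P[f] = (fine 'E_P[f])%:E)%E /\ `|fine ('E_P[f])%E| <= M.
Proof.
move=> mf hM; have fi := bounded_integrable mf hM.
have fn : ('E_P[f] \is a fin_num)%E by rewrite unlock; exact: integrable_fin_num.
split; first by rewrite fineK.
rewrite -lee_fin -[leLHS]/(`|(fine 'E_P[f])%:E|)%E fineK// unlock.
rewrite (le_trans (le_abse_integral _ _ _))//; first exact: measurable_int fi.
rewrite -integral_prob_cst.
apply: ge0_le_integral => //=.
- exact/measurable_EFinP/measurableT_comp.
- by move=> w _; rewrite lee_fin.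
Qed.

Context (J : finType) (xi : J -> T -> R).
Hypothesis mxi : forall j, measurable_fun setT (xi j).
Hypothesis indep : forall A : J -> set R, (forall j, measurable (A j)) ->
  P [set w | forall j, A j (xi j w)] = (\prod_j P [set w | A j (xi j w)])%E.

Let cmeas (G : {set J}) (f : T -> R) :=
  measurable_fun setT (f : g_sigma_algebraType (cyl xi G) -> R).

Lemma cyl_fun_measurable (G : {set J}) (f : T -> R) :
  cmeas G f -> measurable_fun setT f.
Proof.
move=> mf _ A mA; apply: (sub_gsigma_measurable (cyl_measurable mxi (G := G))).
exact: mf.
Qed.

Lemma cyl_fun_sub (G H : {set J}) (f : T -> R) :
  G \subset H -> cmeas G f -> cmeas H f.
Proof.
by move=> GH mf _ A mA; apply: (sub_sigma_algebra2 (cyl_sub GH)); exact: mf.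
Qed.

(** By independence the exponential moment is a product; each factor is at most
    1 + 2 lam^2 c_k^2 since the linear term of the expansion has mean zero. *)
Lemma exp_moment_centered (K : eqType) (r : seq K) (G : K -> {set J})
    (V : K -> T -> R) (c : K -> R) (lam : R) :
  (forall k, k \in r -> cmeas (G k) (V k)) ->
  pairwise (fun k l => [disjoint G k & G l]%bool) r ->
  (forall k, k \in r -> forall w, `|V k w| <= c k) ->
  (forall k, k \in r -> \int[P]_w (V k w)%:E = 0)%E ->
  0 <= lam -> (forall k, k \in r -> lam * c k <= 2^-1) ->
  (\int[P]_w (\prod_(k <- r) expR (lam * V k w))%:E <=
   (expR (2 * lam ^+ 2 * \sum_(k <- r) c k ^+ 2))%:E)%E.
Proof.
move=> mV + cV V0 lam0; elim: r => [|k r IH] in mV cV V0 *.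
  move=> _ _; under eq_integral do rewrite big_nil.
  by rewrite big_nil mulr0 expR0 integral_prob_cst.
move=> /= /andP[dk dr] lc.
under eq_integral do rewrite big_cons.
have kr : k \in k :: r by rewrite mem_head.
have mexp (l : K) (H : {set J}) : l \in k :: r -> G l \subset H ->
    cmeas H (fun w => expR (lam * V l w)).
  move=> lr GH; apply: (@cyl_fun_sub (G l)) => //.
  apply: measurableT_comp => //; apply: measurable_funM => //; exact: mV.
rewrite (@indep_integral_mul _ _ _ P (cyl xi (G k)) (cyl xi (~: G k))
  (fun w => expR (lam * V k w)) (fun w => \prod_(l <- r) expR (lam * V l w))).
- rewrite big_cons mulrDr expRD EFinM lee_pmul//.
  + by apply: integral_ge0 => w _; rewrite lee_fin expR_ge0.
  + by apply: integral_ge0 => w _; rewrite lee_fin prodr_ge0// => l _; rewrite expR_ge0.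
  + have mVk := cyl_fun_measurable (mV _ kr).
    have iV := bounded_integrable mVk (cV _ kr).
    apply: (@le_trans _ _ (\int[P]_w
       ((1 + 2 * lam ^+ 2 * c k ^+ 2)%:E + lam%:E * (V k w)%:E))%E); last first.
      rewrite integralD//; last 2 first.
      * by apply: (bounded_integrable (M := `|1 + 2 * lam ^+ 2 * c k ^+ 2|)).
      * exact: integrableZl.
      rewrite integralZl// V0// mule0 adde0 integral_prob_cst.
      by rewrite lee_fin expR_ge1Dx.
    have hpos w : `|lam * V k w| <= 2^-1.
      by rewrite normrM ger0_norm// (le_trans _ (lc _ kr))// ler_wpM2l// cV.
    have hle w : expR (lam * V k w) <= 1 + 2 * lam ^+ 2 * c k ^+ 2 + lam * V k w.
      apply: (le_trans (expR_le_quadratic _)).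
        exact: le_trans (ler_norm _) (hpos w).
      rewrite addrAC lerD2r lerD2l exprMn mulrA ler_wpM2l ?mulr_ge0 ?sqr_ge0//.
      rewrite -(real_normK (num_real (V k w))) lerXn2r ?nnegrE ?cV//.
      exact: le_trans (cV _ kr w).
    apply: ge0_le_integral => //=.
    * by apply/measurable_EFinP; apply: (@cyl_fun_measurable (G k)); exact: mexp.
    * by apply/measurable_EFinP => /=; apply: measurable_funD => //; apply: measurable_funM.
    * by move=> w _; rewrite -EFinM -EFinD lee_fin.
  + apply: IH => //.
    * by move=> l lr; apply: mV; rewrite in_cons lr orbT.
    * by move=> l lr; apply: cV; rewrite in_cons lr orbT.
    * by move=> l lr; apply: V0; rewrite in_cons lr orbT.
    * by move=> l lr; apply: lc; rewrite in_cons lr orbT.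
- exact: cyl_measurable.
- exact: cyl_measurable.
- by move=> A B; apply: cyl_indep => //; rewrite -setI_eq0 finset.setICr.
- exact: mexp.
- suff hs (s : seq K) : all (fun l => [disjoint G k & G l]%B) s ->
      {subset s <= k :: r} ->
      cmeas (~: G k) (fun w => \prod_(l <- s) expR (lam * V l w)).
    by apply: hs => // l lr; rewrite in_cons lr orbT.
  elim: s => [|l s IHs] /=.
    by move=> _ _; rewrite (_ : (fun w => \prod_(i <- [::]) expR (lam * V i w)) = cst 1);
      [exact: measurable_cst|apply/funext => w; rewrite big_nil].
  move=> /andP[dl ds] sr.
  have -> : (fun w => \prod_(i <- l :: s) expR (lam * V i w)) =
      (fun w => expR (lam * V l w)) \* (fun w => \prod_(i <- s) expR (lam * V i w)).
    by apply/funext => w /=; rewrite big_cons.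
  apply: measurable_funM.
    apply: mexp; first by apply: sr; rewrite mem_head.
    by rewrite -finset.disjoints_subset disjoint_sym.
  by apply: IHs => // i iS; apply: sr; rewrite in_cons iS orbT.
- by move=> w; rewrite expR_ge0.
- by move=> w; rewrite prodr_ge0// => l _; rewrite expR_ge0.
Qed.

(** The Chernoff bound at the exponent 1 / (2b).  This choice keeps all
    exponents lam c_k below 1/2 and makes the exponential moment at most exp (1/2);
    the resulting tail is only exponential in x, which is enough for x = N^eps. *)
Lemma tail_centered (K : eqType) (r : seq K) (G : K -> {set J})
    (V : K -> T -> R) (c : K -> R) (b x : R) :
  (forall k, k \in r -> cmeas (G k) (V k)) ->
  pairwise (fun k l => [disjoint G k & G l]%bool) r ->
  (forall k, k \in r -> forall w, `|V k w| <= c k) ->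
  (forall k, k \in r -> \int[P]_w (V k w)%:E = 0)%E ->
  0 < b -> \sum_(k <- r) c k ^+ 2 <= b ^+ 2 ->
  (P [set w | (x * b <= \sum_(k <- r) V k w)%R] <= (expR (2^-1 - x / 2))%:E)%E.
Proof.
move=> mV dr cV V0 b0 cb.
have mS : measurable_fun setT (fun w => \sum_(k <- r) V k w).
  rewrite (_ : (fun w => _) = (fun w => \sum_(k <- r)
      (if k \in r then V k w else 0))); last first.
    by apply/funext => w; apply: eq_big_seq => k ->.
  apply: measurable_sum => k; case: (boolP (k \in r)) => // kr.
  exact: cyl_fun_measurable (mV _ kr).
pose S : {RV P >-> R} := HB.pack (fun w => \sum_(k <- r) V k w)
  (isMeasurableFun.Build _ _ _ _ _ mS).
pose lam := (2 * b)^-1.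
have lam0 : 0 < lam by rewrite invr_gt0 mulr_gt0.
have cb1 k : k \in r -> c k <= b.
  move=> kr; have [ck|ck] := lerP 0 (c k); last exact: ltW (lt_trans ck b0).
  rewrite -(@ler_pXn2r _ 2) ?nnegrE ?(ltW b0)//; apply: le_trans cb.
  by rewrite (big_rem k)//= lerDl sumr_ge0// => i _; rewrite sqr_ge0.
apply: (le_trans (chernoff S (x * b) lam0)).
have -> : ('M_P S lam = \int[P]_w (\prod_(k <- r) expR (lam * V k w))%:E)%E.
  rewrite /mmt_gen_fun unlock; apply: eq_integral => w _ /=; congr (_%:E).
  rewrite -expR_sum; congr expR; rewrite mulr_suml.
  by apply: eq_bigr => k _; rewrite mulrC.
apply: (@le_trans _ _ ((expR (2 * lam ^+ 2 * \sum_(k <- r) c k ^+ 2))%:E *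
    (expR (- (lam * (x * b))))%:E)%E).
  apply: lee_wpmul2r; first by rewrite lee_fin expR_ge0.
  apply: (exp_moment_centered mV) => // [|k kr]; first exact: ltW.
  rewrite /lam invfM -mulrA ler_piMr// mulrC ler_pdivrMr// mul1r; exact: cb1.
rewrite -EFinM lee_fin -expRD ler_expR.
have -> : lam * (x * b) = x / 2 by rewrite /lam; field; rewrite gt_eqF.
rewrite lerD2r.
apply: (@le_trans _ _ (2 * lam ^+ 2 * b ^+ 2)).
  by rewrite ler_wpM2l// mulr_ge0// sqr_ge0.
have -> : 2 * lam ^+ 2 * b ^+ 2 = 2^-1 by rewrite /lam; field; rewrite gt_eqF.
by [].
Qed.

(** Centring doubles the bounds c_k, and the two signs of the sum are treated
    separately. *)
Lemma concentration (K : eqType) (r : seq K) (G : K -> {set J})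
    (X : K -> T -> R) (c : K -> R) (a x : R) :
  (forall k, k \in r -> cmeas (G k) (X k)) ->
  pairwise (fun k l => [disjoint G k & G l]%bool) r ->
  (forall k, k \in r -> forall w, `|X k w| <= c k) ->
  0 < a -> \sum_(k <- r) c k ^+ 2 <= a ^+ 2 ->
  (P [set w | (x * (2 * a) <= `|\sum_(k <- r) (X k w - fine 'E_P[X k])|)%R] <=
     (2 * expR (2^-1 - x / 2))%:E)%E.
Proof.
move=> mX dr cX a0 ca.
pose V (e : R) k w := e * (X k w - fine ('E_P[X k])%E).
have mXk k : k \in r -> measurable_fun setT (X k).
  by move=> kr; exact: cyl_fun_measurable (mX _ kr).
have one e : `|e| = 1 -> (P [set w | (x * (2 * a) <= \sum_(k <- r) V e k w)%R] <=
    (expR (2^-1 - x / 2))%:E)%E.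
  move=> e1; apply: (@tail_centered _ r G (V e) (fun k => 2 * c k)) => //.
  - move=> k kr; apply: measurable_funM => //; apply: measurable_funB => //.
    exact: mX.
  - move=> k kr w; rewrite normrM e1 mul1r (le_trans (ler_normB _ _))//.
    have [_ h] := expectation_bounded (mXk _ kr) (cX _ kr).
    by rewrite mulr_natl mulr2n lerD// cX.
  - move=> k kr; have [h1 h] := expectation_bounded (mXk _ kr) (cX _ kr).
    have iX := bounded_integrable (mXk _ kr) (cX _ kr).
    rewrite /V; under eq_integral do rewrite EFinM EFinB.
    rewrite integralZl//; last first.
      apply: integrableB => //.
      exact: (bounded_integrable (M := `|fine ('E_P[X k])%E|)).
    rewrite integralB//; last exact: (bounded_integrable (M := `|fine ('E_P[X k])%E|)).
    have -> : (\int[P]_w (X k w)%:E = (fine 'E_P[X k])%:E)%E.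
      by rewrite -h1 [in RHS]unlock.
    by rewrite integral_prob_cst subee// mule0.
  - by rewrite mulr_gt0.
  - under eq_bigr do rewrite exprMn.
    by rewrite -mulr_sumr exprMn ler_wpM2l// sqr_ge0.
have mV e : measurable [set w | x * (2 * a) <= \sum_(k <- r) V e k w].
  rewrite (_ : [set w | _] = setT `&` (fun w => \sum_(k <- r)
     (if k \in r then V e k w else 0)) @^-1` `[x * (2 * a), +oo[); last first.
    rewrite setTI predeqE => w /=; rewrite in_itv /= andbT.
    by rewrite (_ : \sum_(k <- r) V e k w =
      \sum_(k <- r) (if k \in r then V e k w else 0))//; apply: eq_big_seq => k ->.
  apply: measurable_sum => // k; case: (boolP (k \in r)) => // kr.
  by apply: measurable_funM => //; apply: measurable_funB => //; exact: mXk.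
have hsum e w : \sum_(k <- r) V e k w =
    e * \sum_(k <- r) (X k w - fine ('E_P[X k])%E) by rewrite mulr_sumr.
rewrite (_ : [set w | _] = [set w | x * (2 * a) <= \sum_(k <- r) V 1 k w] `|`
    [set w | x * (2 * a) <= \sum_(k <- r) V (-1) k w]); last first.
  rewrite predeqE => w /=; rewrite !hsum mul1r mulN1r.
  set s := \sum_(_ <- _) _; rewrite ler_normr.
  by split=> [/orP|h]; last exact/orP.
apply: (le_trans (measureU2 _ _ _)) => //.
rewrite [2 * expR _]mulr_natl [expR _ *+ 2]mulr2n EFinD; apply: leeD; apply: one.
  by rewrite normr1.
by rewrite normrN1.
Qed.
End Concentration.

(** * Concentration of sums that are independent within colours *)

Section FiniteUnions.
Context (d : measure_display) (T : measurableType d) (I : finType).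

Lemma exists_bigsetU (F : I -> set T) :
  [set w | exists i, F i w] = \big[setU/set0]_(i : I) F i.
Proof.
rewrite predeqE => w; split=> [[i Fi]|]; first by rewrite (bigD1 i)//; left.
by elim/big_ind: _ => // [A B hA hB [/hA|/hB]|i _ Fi] //; exists i.
Qed.

Lemma measurable_exists (F : I -> set T) : (forall i, measurable (F i)) ->
  measurable [set w | exists i, F i w].
Proof. by move=> mF; rewrite exists_bigsetU; exact: bigsetU_measurable. Qed.

Lemma prob_exists_le (R : realType) (P : probability T R) (F : I -> set T) (M : R) :
  (forall i, measurable (F i)) -> (forall i, (P (F i) <= M%:E)%E) ->
  (P [set w | exists i, F i w] <= (#|I|%:R * M)%:E)%E.
Proof.
move=> mF hF; rewrite exists_bigsetU.
have -> : #|I|%:R * M = \sum_(i : I) M by rewrite sumr_const mulr_natl.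
have h (r : seq I) : measurable (\big[setU/set0]_(i <- r) F i) /\
    (P (\big[setU/set0]_(i <- r) F i) <= (\sum_(i <- r) M)%:E)%E.
  elim: r => [|i r [IH1 IH2]]; first by rewrite !big_nil measure0.
  rewrite !big_cons; split; first exact: measurableU.
  apply: (le_trans (measureU2 _ _ _)) => //.
  by rewrite EFinD; exact: leeD (hF i) IH2.
by have [] := h (index_enum I).
Qed.
End FiniteUnions.

Section ColouredConcentration.
Context (R : realType) (d : measure_display) (T : measurableType d)
  (P : probability T R) (J : finType) (xi : J -> T -> R).
Hypothesis mxi : forall j, measurable_fun setT (xi j).
Hypothesis indep : forall A : J -> set R, (forall j, measurable (A j)) ->
  P [set w | forall j, A j (xi j w)] = (\prod_j P [set w | A j (xi j w)])%E.

(** The threshold a_k of the colour k is chosen linear in its weight Z_k = sum of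
    the z_b^2.  The inequality of arithmetic and geometric means gives
    a_k >= beta sqrt(Z_k), as needed in each colour, while the a_k add up to
    beta q v when the q^2 colours share t = v / q; no division by Z_k occurs. *)
Lemma coloured_concentration (I C : finType) (col : I -> C) (G : I -> {set J})
    (X : I -> T -> R) (z : I -> R) (beta v q x : R) :
  (forall b, measurable_fun setT (X b : g_sigma_algebraType (cyl xi (G b)) -> R)) ->
  (forall b c, col b = col c -> b != c -> [disjoint G b & G c]%bool) ->
  (forall b w, `|X b w| <= beta) ->
  0 < beta -> 0 < v -> 0 < q -> 0 <= x -> #|C|%:R = q ^+ 2 ->
  \sum_b z b ^+ 2 <= v ^+ 2 ->
  (P [set w | (2 * x * beta * q * v <
       `|\sum_b z b * (X b w - fine 'E_P[X b])|)%R] <=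
     (q ^+ 2 * (2 * expR (2^-1 - x / 2)))%:E)%E.
Proof.
move=> mX dG Xb b0 v0 q0 x0 hC zv.
have mXT b : measurable_fun setT (X b) := cyl_fun_measurable mxi (mX b).
pose Z k := \sum_(b | col b == k) z b ^+ 2.
pose t := v / q; have t0 : 0 < t by rewrite divr_gt0.
pose a k := beta / 2 * (Z k / t + t).
have Z0 k : 0 <= Z k by rewrite sumr_ge0// => b _; rewrite sqr_ge0.
have a0 k : 0 < a k.
  by rewrite mulr_gt0 ?divr_gt0// ltr_pwDr// divr_ge0 ?Z0// ltW.
pose r k := [seq b <- enum I | col b == k].
pose zX b w := z b * X b w.
have EzX b : fine ('E_P[zX b])%E = z b * fine ('E_P[X b])%E.
  have [h1 h2] := expectation_bounded P (mXT b) (Xb b).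
  rewrite -[RHS]/(fine (z b * fine 'E_P[X b])%:E) EFinM -h1 !unlock.
  rewrite -integralZl//.
  exact: (bounded_integrable P (mXT b) (Xb b)).
pose S k w := \sum_(b <- r k) (zX b w - fine ('E_P[zX b])%E).
pose F k := [set w | x * (2 * a k) <= `|S k w|].
have mF k : measurable (F k).
  rewrite (_ : F k = setT `&` (fun w => `|S k w|) @^-1` `[x * (2 * a k), +oo[); last first.
    by rewrite setTI predeqE => w /=; rewrite in_itv /= andbT.
  apply: measurableT_comp => //.
  by apply: measurable_sum => b; apply: measurable_funB => //; apply: measurable_funM.
have PF k : (P (F k) <= (2 * expR (2^-1 - x / 2))%:E)%E.
  apply: (concentration mxi indep (G := G) (c := fun b => `|z b| * beta)) => //.
  - by move=> b _; apply: measurable_funM => //; exact: mX.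
  - have u : uniq (r k) by rewrite filter_uniq// enum_uniq.
    have hin : all [pred b | col b == k] (r k) by exact: filter_all.
    rewrite uniq_pairwise in u; apply: sub_in_pairwise hin u.
    by move=> b c /eqP hb /eqP hc /= bc; apply: dG => //; rewrite hb hc.
  - by move=> b _ w; rewrite normrM ler_wpM2l.
  - rewrite big_filter big_enum_cond /=.
    have -> : \sum_(i | col i == k) (`|z i| * beta) ^+ 2 = beta ^+ 2 * Z k.
      rewrite mulr_sumr; apply: eq_bigr => b _.
      by rewrite exprMn real_normK ?num_real// mulrC.
    rewrite /a !exprMn -mulrA ler_pM2l ?exprn_gt0//.
    have -> : Z k = (Z k / t) * t by rewrite divfK// gt_eqF.
    rewrite mulfK ?gt_eqF//; set y := Z k / t.
    have := sqr_ge0 (y - t); rewrite exprVn; nra.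
apply: (@le_trans _ _ (P [set w | exists k, F k w])); last first.
  by rewrite -hC; apply: prob_exists_le.
have mS : measurable_fun setT (fun w => \sum_b z b * (X b w - fine ('E_P[X b])%E)).
  by apply: measurable_sum => b; apply: measurable_funM => //; apply: measurable_funB.
apply: le_measure; rewrite ?inE.
- rewrite (_ : [set w | _] = setT `&` (fun w => `|\sum_b z b * (X b w - fine ('E_P[X b])%E)|)
     @^-1` `]2 * x * beta * q * v, +oo[); last first.
    by rewrite setTI predeqE => w /=; rewrite in_itv /= andbT.
  by apply: measurableT_comp.
- exact: measurable_exists.
move=> w /= hw; apply: contrapT => hn.
have hS k : `|S k w| <= x * (2 * a k).
  by rewrite leNgt; apply/negP => h; apply: hn; exists k; rewrite /F /= ltW.
move: hw; apply/negP; rewrite -leNgt.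
rewrite (partition_big col xpredT)//=.
apply: (le_trans (ler_norm_sum _ _ _)).
apply: (@le_trans _ _ (\sum_k x * (2 * a k))).
  apply: ler_sum => k _; apply: le_trans (hS k).
  rewrite /S big_filter big_enum_cond /= le_eqVlt; apply/orP; left; apply/eqP.
  by congr (`|_|); apply: eq_bigr => b _; rewrite EzX mulrBr.
rewrite -mulr_sumr -mulr_sumr -mulr_sumr big_split /= sumr_const -[t *+ _]mulr_natl hC.
have hZ : \sum_k Z k = \sum_b z b ^+ 2 by rewrite [RHS](partition_big col xpredT).
rewrite -mulr_suml hZ.
have h1 : (\sum_i z i ^+ 2) / t <= v * q.
  rewrite ler_pdivrMr// (_ : v * q * t = v ^+ 2)//.
  by rewrite /t; field; rewrite gt_eqF.
have h2 : q ^+ 2 * t = q * v by rewrite /t; field; rewrite gt_eqF.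
rewrite h2.
have -> : 2 * x * beta * q * v = x * (2 * (beta / 2 * (v * q + q * v))) by field.
by rewrite ler_wpM2l// ler_pM2l// ler_pM2l ?divr_gt0// lerD2r.
Qed.
End ColouredConcentration.

(** * Gaussian tails of the matrix entries *)

Lemma measurable_norm_gt (R : realType) (K : R) :
  measurable [set x : R | K < `|x|].
Proof.
rewrite (_ : [set x | _] = setT `&` Num.norm @^-1` `]K, +oo[); last first.
  by rewrite setTI predeqE => x /=; rewrite in_itv /= andbT.
exact: normr_measurable.
Qed.

(** On |x| > K the density is at most 2 exp (-K^2/4) times a Gaussian density with
    twice the variance. *)
Lemma normal_tail (R : realType) (sigma K : R) :
  0 < sigma -> sigma <= 1 -> 0 <= K ->
  (normal_prob 0 sigma [set x | K < `|x|]%R <=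
     (2 * expR (- (K ^+ 2 / 4)))%:E)%E.
Proof.
move=> s0 s1 K0; set A := [set x | _].
have mA : measurable A := measurable_norm_gt K.
pose s' := Num.sqrt 2 * sigma.
have s'0 : 0 < s' by rewrite mulr_gt0// sqrtr_gt0.
have s'2 : s' ^+ 2 = 2 * sigma ^+ 2 by rewrite exprMn sqr_sqrtr.
have peak : normal_peak sigma <= 2 * normal_peak s'.
  rewrite /normal_peak s'2; set Q := sigma ^+ 2 * pi *+ 2.
  rewrite (_ : 2 * sigma ^+ 2 * pi *+ 2 = 2 * Q); last by rewrite /Q; ring.
  rewrite sqrtrM// invfM mulrA.
  rewrite ler_peMl ?invr_ge0// ler_pdivlMr ?sqrtr_gt0// mul1r.
  by rewrite -[leRHS]sqr_sqrtr// expr2 ler_peMl// -{1}[1]sqrtr1 ler_sqrt// ler1n.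
have pdf x : x \in A -> normal_pdf 0 sigma x <=
    2 * expR (- (K ^+ 2 / 4)) * normal_pdf 0 s' x.
  rewrite inE /A /= => Kx.
  rewrite !normal_pdfE ?gt_eqF// mulrACA.
  apply: ler_pM; rewrite ?normal_peak_ge0 ?normal_fun_ge0//.
  rewrite /normal_fun -expRD ler_expR subr0 s'2.
  have -> : - x ^+ 2 / (sigma ^+ 2 *+ 2) =
      - (x ^+ 2 / sigma ^+ 2 / 4) + - x ^+ 2 / ((2 * sigma ^+ 2) *+ 2).
    by field; rewrite gt_eqF.
  rewrite lerD2r lerN2 ler_pM2r ?invr_gt0// ler_pdivlMr ?exprn_gt0//.
  apply: (@le_trans _ _ (K ^+ 2)).
    by rewrite ler_piMr ?sqr_ge0// expr_le1// ltW.
  by rewrite -(real_normK (num_real x)) lerXn2r ?nnegrE// ltW.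
have mpdf t D : measurable_fun D (fun x : R => (normal_pdf 0 t x)%:E).
  by apply/measurable_EFinP; apply: measurable_funTS; exact: measurable_normal_pdf.
rewrite /normal_prob.
apply: (@le_trans _ _ (\int[lebesgue_measure]_(x in A)
    ((2 * expR (- (K ^+ 2 / 4)))%:E * (normal_pdf 0 s' x)%:E))%E).
  apply: ge0_le_integral => //.
  - by move=> x _; rewrite lee_fin normal_pdf_ge0.
  - exact: mpdf.
  - by apply: emeasurable_funM; [exact: measurable_cst|exact: mpdf].
  - by move=> x Ax; rewrite -EFinM lee_fin pdf// inE.
rewrite ge0_integralZl; [|exact: mA|exact: mpdf|..]; last 2 first.
- by move=> x _; rewrite lee_fin normal_pdf_ge0.
- by rewrite lee_fin mulr_ge0 ?expR_ge0.
rewrite -[leRHS]mule1 lee_wpmul2l// ?lee_fin ?mulr_ge0 ?expR_ge0//.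
rewrite -(integral_normal_pdf 0 s').
apply: ge0_subset_integral => //; first exact: mpdf.
by move=> x _; rewrite lee_fin normal_pdf_ge0.
Qed.

Section HermitianBM.
Context (R : realType) (d : measure_display) (T : measurableType d)
  (P : probability T R) (I : finType) (B : I -> I -> R -> T -> R[i]).
Hypothesis hB : hermitian_BM P B.
Variable s : R.
Hypothesis s0 : 0 <= s.

Lemma bm_coord_measurable p : measurable_fun setT (bm_coord B p s).
Proof. by case: hB => _ /(_ p)[+ _ _ _ _] _; exact. Qed.

Lemma bm_coord_indep (A : I * I -> set R) : (forall p, measurable (A p)) ->
  P [set w | forall p, A p (bm_coord B p s w)] =
  (\prod_p P [set w | A p (bm_coord B p s w)])%E.
Proof.
move=> mA; case: hB => _ _ /(_ 1%N (fun _ _ => s) (fun p _ => A p)) h.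
have {}h := h (fun _ _ => s0) (fun p _ => mA p).
rewrite (_ : [set w | _] =
  [set w | forall p (j : 'I_1), A p (bm_coord B p s w)]).
  rewrite h; apply: eq_bigr => p _; congr (P _).
  by rewrite predeqE => w; split=> [/(_ ord0)|h' _].
by rewrite predeqE => w; split=> [h' p _|h' p]; [exact: h'|exact: h' ord0].
Qed.

(** At time zero the process vanishes almost surely; at later times it differs
    from its increment since time zero by a null event. *)
Lemma bm_coord_tail p (K : R) : s <= 1 -> 0 <= K ->
  (P [set w | (K < `|bm_coord B p s w|)%R] <=
     (2 * expR (- (K ^+ 2 / 4)))%:E)%E.
Proof.
move=> s1 K0; case: hB => _ /(_ p)[mb b0 _ bN _] _.
have := s0; rewrite le_eqVlt => /orP[/eqP s00|sp].
  have [N [mN N0 sub]] := b0.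
  apply: (@le_trans _ _ (P N)); last by rewrite N0 lee_fin mulr_ge0 ?expR_ge0.
  apply: le_measure; rewrite ?inE//.
    rewrite -[X in measurable X]setTI.
    apply: (mb s s0 measurableT [set x | K < `|x|]); exact: measurable_norm_gt.
  move=> w /=; rewrite -s00 => Kw; apply: sub => /= bw.
  by move: Kw; rewrite bw normr0 ltNge K0.
have [N [mN N0 sub]] := b0.
have mA : measurable [set w | (K < `|bm_coord B p s w - bm_coord B p 0 w|)%R].
  rewrite -[X in measurable X]setTI.
  have mD : measurable_fun setT (bm_coord B p s \- bm_coord B p 0).
    by apply: measurable_funB; apply: mb.
  exact: (mD measurableT _ (measurable_norm_gt K)).
apply: (@le_trans _ _ (P ([set w | (K < `|bm_coord B p s w - bm_coord B p 0 w|)%R] `|` N))).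
  apply: le_measure; rewrite ?inE//; last 2 first.
  - exact: measurableU.
  - move=> w /= Kw; have [/eqP bw|bw] := boolP (bm_coord B p 0 w == 0).
      by left; rewrite bw subr0.
    by right; apply: sub => /= bw0; rewrite bw0 eqxx in bw.
  rewrite -[X in measurable X]setTI.
  apply: (mb s s0 measurableT [set x | K < `|x|]); exact: measurable_norm_gt.
rewrite (le_trans (measureU2 _ _ _))// [X in (_ + X)%E](_ : _ = 0%E)// adde0.
have := bN 0 s [set x | K < `|x|] (lexx _) sp (measurable_norm_gt K).
rewrite /= subr0 => ->; apply: normal_tail => //; first by rewrite sqrtr_gt0.
by rewrite -sqrtr1 ler_sqrt.
Qed.
End HermitianBM.

(** * Resolvents of Hermitian matrices *)

Local Notation nrm := Normc.normc.

Section ComplexNorm.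
Context (R : realType).
Implicit Types x y : R[i].

Lemma nrmE x : nrm x = Num.sqrt (complex.Re x ^+ 2 + complex.Im x ^+ 2).
Proof. by case: x. Qed.

Lemma sqr_nrm x : nrm x ^+ 2 = complex.Re x ^+ 2 + complex.Im x ^+ 2.
Proof. by rewrite nrmE sqr_sqrtr// addr_ge0 ?sqr_ge0. Qed.

Lemma nrm_ge0 x : 0 <= nrm x. Proof. by rewrite nrmE sqrtr_ge0. Qed.

Lemma nrm0 : nrm (0 : R[i]) = 0. Proof. exact: Normc.normc0. Qed.

Lemma nrmM x y : nrm (x * y) = nrm x * nrm y. Proof. exact: Normc.normcM. Qed.

Lemma nrmD x y : nrm (x + y) <= nrm x + nrm y. Proof. exact: le_normcD. Qed.

Lemma nrmN x : nrm (- x) = nrm x. Proof. exact: normcN. Qed.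

Lemma nrmC x : nrm (x^*) = nrm x.
Proof. by rewrite !nrmE; case: x => a b /=; rewrite sqrrN. Qed.

Lemma nrm_real (a : R) : nrm a%:C = `|a|.
Proof. by rewrite nrmE /= expr0n /= addr0 sqrtr_sqr. Qed.

Lemma normr_Re_le x : `|complex.Re x| <= nrm x.
Proof. by rewrite nrmE -sqrtr_sqr ler_wsqrtr// lerDl sqr_ge0. Qed.

Lemma normr_Im_le x : `|complex.Im x| <= nrm x.
Proof. by rewrite nrmE -sqrtr_sqr ler_wsqrtr// lerDr sqr_ge0. Qed.

Lemma nrm_le_ReIm x : nrm x <= `|complex.Re x| + `|complex.Im x|.
Proof.
rewrite -(@ler_pXn2r _ 2) ?nnegrE ?nrm_ge0 ?addr_ge0// sqr_nrm sqrrD.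
rewrite !real_normK ?num_real// -addrA lerD2l addrC lerDl.
by rewrite mulrn_wge0 ?mulr_ge0.
Qed.

Lemma nrm_sum (I : Type) (r : seq I) (p : pred I) (F : I -> R[i]) :
  nrm (\sum_(i <- r | p i) F i) <= \sum_(i <- r | p i) nrm (F i).
Proof.
elim/big_ind2: _ => [|x1 x2 y1 y2 h1 h2|//]; first by rewrite nrm0.
by rewrite (le_trans (nrmD _ _))// lerD.
Qed.

Lemma nrm_prod (I : Type) (r : seq I) (p : pred I) (F : I -> R[i]) :
  nrm (\prod_(i <- r | p i) F i) = \prod_(i <- r | p i) nrm (F i).
Proof. by apply: big_morph; [exact: nrmM|exact: Normc.normc1]. Qed.

Lemma cReD x y : complex.Re (x + y) = complex.Re x + complex.Re y.
Proof. by case: x; case: y. Qed.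
Lemma cImD x y : complex.Im (x + y) = complex.Im x + complex.Im y.
Proof. by case: x; case: y. Qed.
Lemma cReM x y : complex.Re (x * y) =
  complex.Re x * complex.Re y - complex.Im x * complex.Im y.
Proof. by case: x; case: y. Qed.
Lemma cImM x y : complex.Im (x * y) =
  complex.Re x * complex.Im y + complex.Im x * complex.Re y.
Proof. by case: x => a b; case: y => c d /=; rewrite [b * c]mulrC. Qed.

Lemma cRe_sum (I : Type) (r : seq I) (p : pred I) (F : I -> R[i]) :
  complex.Re (\sum_(i <- r | p i) F i) = \sum_(i <- r | p i) complex.Re (F i).
Proof. by apply: big_morph; first exact: cReD. Qed.
Lemma cIm_sum (I : Type) (r : seq I) (p : pred I) (F : I -> R[i]) :
  complex.Im (\sum_(i <- r | p i) F i) = \sum_(i <- r | p i) complex.Im (F i).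
Proof. by apply: big_morph; first exact: cImD. Qed.

Lemma mulCC x : x * x^* = (nrm x ^+ 2)%:C.
Proof.
apply/eqP; rewrite sqr_nrm eq_complex; case: x => a b /=.
by rewrite mulrN opprK -!expr2 eqxx mulrN addrC [b * a]mulrC subrr eqxx.
Qed.
End ComplexNorm.

Section Resolvent.
Context (R : realType) (n : nat).
Implicit Types (A H : 'M[R[i]]_n) (z : R[i]).

Definition hermmx A := forall i j, A j i = (A i j)^*.

(** The quadratic form of A itself is real. *)
Lemma quad_Im A z (v : 'rV[R[i]]_n) : hermmx A ->
  complex.Im (\sum_j (v *m (A - z%:M)) 0 j * (v 0 j)^*) =
  - complex.Im z * \sum_j nrm (v 0 j) ^+ 2.
Proof.
move=> hA.
have -> : \sum_j (v *m (A - z%:M)) 0 j * (v 0 j)^* =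
    (\sum_j (v *m A) 0 j * (v 0 j)^*) - z * (\sum_j nrm (v 0 j) ^+ 2)%:C.
  rewrite rmorph_sum mulr_sumr -sumrB; apply: eq_bigr => j _.
  by rewrite mulmxBr mul_mx_scalar !mxE mulrBl -mulrA mulCC.
set q := \sum_j _.
have qR : q^* = q.
  rewrite /q rmorph_sum /=.
  under eq_bigr do rewrite rmorphM /= conjcK mxE rmorph_sum mulr_suml.
  rewrite exchange_big /=; apply: eq_bigr => j _.
  rewrite mxE mulr_suml; apply: eq_bigr => i _.
  by rewrite rmorphM /= -hA mulrC mulrA [_ * A i j]mulrC mulrAC [A i j * _]mulrC mulrC.
have Iq : complex.Im q = 0.
  by move: qR; case: (q) => a b [] /= /eqP; rewrite eqNr => /eqP.
rewrite cImD Iq add0r; case: (z) => a b /=.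
by rewrite mulr0 add0r mulNr.
Qed.

Lemma herm_resolvent_unit A z : hermmx A -> 0 < complex.Im z ->
  (A - z%:M) \in unitmx.
Proof.
move=> hA z0; rewrite unitmxE unitfE; apply/negP => /det0P[v v0 vA].
have := quad_Im z v hA; rewrite vA big1 => [|j _]; last by rewrite mxE mul0r.
move=> /esym/eqP; rewrite /= mulf_eq0 oppr_eq0 gt_eqF//= => /eqP h.
move/eqP: v0; apply; apply/rowP => j; rewrite mxE.
apply: Normc.eq0_normc.
move: h => /eqP; rewrite psumr_eq0; last by move=> i _; rewrite exprn_ge0 ?nrm_ge0.
by move=> /allP/(_ j); rewrite mem_index_enum expf_eq0 => /(_ isT)/andP[_ /eqP].
Qed.

(** Take v to be the row i of the resolvent in the identity for the imaginary
    part: Im z times the squared norm of v equals Im G_ii, up to sign, and is thus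
    at most |G_ii|.  This bounds first |G_ii| and then every entry of the row. *)
Lemma herm_resolvent_bound A z : hermmx A -> 0 < complex.Im z ->
  forall i j, nrm (invmx (A - z%:M) i j) <= (complex.Im z)^-1.
Proof.
move=> hA z0 i j; set G := invmx _.
have uM := herm_resolvent_unit hA z0.
pose v := row i G.
have vM : v *m (A - z%:M) = delta_mx 0 i.
  by rewrite /v -row_mul mulVmx// row1.
have := quad_Im z v hA; rewrite vM.
rewrite (bigD1 i)//= big1 => [|k ki]; last first.
  by rewrite !mxE/= (negPf ki) mul0r.
rewrite addr0 !mxE !eqxx mul1r.
have vE k : v 0 k = G i k by rewrite mxE.
rewrite -/G => h.
have hs : complex.Im z * (\sum_k nrm (v 0 k) ^+ 2) <= nrm (G i i).
  rewrite -nrmC; apply: le_trans (normr_Im_le _).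
  by rewrite h mulNr normrN ler_norm.
have hk k : complex.Im z * nrm (G i k) ^+ 2 <= nrm (G i i).
  apply: le_trans hs; rewrite ler_pM2l// (bigD1 k)//= vE lerDl.
  by rewrite sumr_ge0// => l _; rewrite exprn_ge0 ?nrm_ge0.
have hi : nrm (G i i) <= (complex.Im z)^-1.
  have := hk i; have := nrm_ge0 (G i i); rewrite le_eqVlt => /orP[/eqP <- _|Gp].
    by rewrite invr_ge0 ltW.
  rewrite expr2 mulrA ger_pMl// -ler_pdivlMl// mulr1//.
rewrite -(@ler_pXn2r _ 2) ?nnegrE ?nrm_ge0 ?invr_ge0 ?(ltW z0)//.
apply: (@le_trans _ _ ((complex.Im z)^-1 * nrm (G i i))).
  by rewrite ler_pdivlMl// hk.
by rewrite expr2 ler_wpM2l// invr_ge0 ltW.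
Qed.

(** The matrix commutes with the diagonal projection onto q, hence so does its
    inverse. *)
Lemma resolvent_block A z (q : pred 'I_n) : hermmx A -> 0 < complex.Im z ->
  (forall i j, ~~ (q i && q j) -> A i j = 0) ->
  forall i j, q i -> ~~ q j -> invmx (A - z%:M) i j = 0.
Proof.
move=> hA z0 hq i j qi qj.
have uM := herm_resolvent_unit hA z0.
pose p : 'M[R[i]]_n := diag_mx (\row_k (q k)%:R).
have comm : p *m (A - z%:M) = (A - z%:M) *m p.
  rewrite mulmxBl mulmxBr scalar_mxC; congr (_ - _).
  apply/matrixP => k l; rewrite mul_diag_mx mul_mx_diag !mxE.
  have [|/hq ->] := boolP (q k && q l); last by rewrite mulr0 mul0r.
  by move=> /andP[-> ->]; rewrite mulr1 mul1r.
have : p *m invmx (A - z%:M) = invmx (A - z%:M) *m p.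
  rewrite -[LHS]mul1mx -(mulVmx uM) -!mulmxA; congr (_ *m _).
  by rewrite mulmxA -comm -mulmxA mulmxV// mulmx1.
move=> /matrixP/(_ i j); rewrite mul_diag_mx mul_mx_diag !mxE qi (negPf qj).
by rewrite mul1r mulr0.
Qed.

(** In G - G' = G' (A' - A) G, the entry G'_ik vanishes for k outside q, since A' is
    block diagonal; and for k in q, A' and A differ at (k, l) only if l is outside
    q, where G_lj is small. *)
Lemma resolvent_local A A' z (q : pred 'I_n) (g K rho : R) i j :
  hermmx A -> hermmx A' -> 0 < complex.Im z ->
  (forall k l, A' k l = if q k && q l then A k l else 0) ->
  (forall k l, nrm (A k l) <= K) -> (complex.Im z)^-1 <= g ->
  0 <= rho -> q i -> (forall k, ~~ q k -> nrm (invmx (A - z%:M) k j) <= rho) ->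
  nrm (invmx (A - z%:M) i j - invmx (A' - z%:M) i j) <= n%:R ^+ 2 * (g * K * rho).
Proof.
move=> hA hA' z0 A'E AK zg rho0 qi Grho.
have uM := herm_resolvent_unit hA z0; have uM' := herm_resolvent_unit hA' z0.
set G := invmx (A - _); set G' := invmx (A' - _).
have K0 : 0 <= K by exact: le_trans (nrm_ge0 _) (AK i i).
have g0 : 0 <= g by apply: le_trans zg; rewrite invr_ge0 ltW.
have id : G - G' = G' *m ((A' - A) *m G).
  have -> : A' - A = (A' - z%:M) - (A - z%:M) by rewrite opprB addrA subrK.
  by rewrite mulmxBl mulmxBr mulmxA mulVmx// mul1mx mulmxV// mulmx1.
have -> : G i j - G' i j = (G - G') i j by rewrite !mxE.
rewrite id mxE; apply: (le_trans (nrm_sum _ _ _)).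
have bnd u : nrm (G' i u * ((A' - A) *m G) u j) <= n%:R * (g * K * rho).
  have [qu|qu] := boolP (q u); last first.
    rewrite (resolvent_block hA' z0 _ qi qu) ?mul0r ?nrm0; last first.
      by move=> k l; rewrite A'E => /negPf ->.
    by rewrite !mulr_ge0.
  have -> : n%:R * (g * K * rho) = g * (n%:R * (K * rho)) by ring.
  rewrite nrmM; apply: ler_pM; rewrite ?nrm_ge0//.
    exact: le_trans (herm_resolvent_bound hA' z0 _ _) zg.
  rewrite mxE; apply: (le_trans (nrm_sum _ _ _)).
  apply: (@le_trans _ _ (\sum_(l < n) K * rho)); last first.
    by rewrite sumr_const card_ord [leRHS]mulr_natl.
  apply: ler_sum => v _; rewrite nrmM mxE [(- A)  _ _]mxE A'E qu /=.
  have [qv|qv] := boolP (q v).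
    by rewrite subrr nrm0 mul0r mulr_ge0.
  rewrite sub0r nrmN; apply: ler_pM; rewrite ?nrm_ge0//; exact: Grho.
apply: (@le_trans _ _ (\sum_(l < n) n%:R * (g * K * rho))); first exact: ler_sum.
rewrite sumr_const card_ord (_ : _ ^+ 2 * _ = n%:R * (n%:R * (g * K * rho))); last by ring.
by rewrite [leRHS]mulr_natl.
Qed.
End Resolvent.

(** * Exponential decay of the deterministic loop *)

Section Lattice.
Variable L : nat.
Implicit Types a b c : block L.

Lemma circ_distC i j : circ_dist L i j = circ_dist L j i.
Proof. by rewrite /circ_dist addnC. Qed.

Lemma circ_dist_triangle (i j k : 'I_L) :
  (circ_dist L i k <= circ_dist L i j + circ_dist L j k)%N.
Proof.
by move: (ltn_ord i) (ltn_ord j) (ltn_ord k); rewrite /circ_dist; lia.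
Qed.

Lemma bdistC a b : bdist a b = bdist b a.
Proof. by rewrite /bdist circ_distC [in X in (_ + X)%N]circ_distC. Qed.

Lemma bdist_triangle a b c : (bdist a c <= bdist a b + bdist b c)%N.
Proof.
rewrite /bdist addnACA; apply: leq_add; exact: circ_dist_triangle.
Qed.

Lemma bdist_le a b : (bdist a b <= L)%N.
Proof.
have h i j : (circ_dist L i j + circ_dist L i j <= L)%N by rewrite /circ_dist; lia.
by rewrite /bdist; move: (h a.1 b.1) (h a.2 b.2); lia.
Qed.

Lemma bdistxx a : bdist a a = 0%N.
Proof. by rewrite /bdist /circ_dist !subnn !min0n. Qed.

Lemma circ_dist_le1 (i j : 'I_L) : (circ_dist L i j <= 1)%N ->
  j \in [:: i; ordS i; ord_pred i].
Proof.
move=> h; rewrite !inE -!val_eqE /=; move: (ltn_ord i) (ltn_ord j) h.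
rewrite /circ_dist => hi hj h.
have [->|Hij] := eqVneq (j : nat) i; first by [].
have [e|e] := eqVneq (j : nat) (i.+1 %% L)%N; first by rewrite orbT.
rewrite orFb /=; apply/eqP.
have [iL|iL] := ltnP i.+1 L.
  rewrite modn_small// in e.
  have [i0|i0] := posnP i; first by rewrite i0 add0n modn_small; lia.
  have -> : ((i + L).-1 = i.-1 + L)%N by lia.
  by rewrite modnDr modn_small; lia.
have iL' : (i.+1 = L)%N by lia.
rewrite iL' modnn in e.
have [i0|i0] := posnP i; first by lia.
have -> : ((i + L).-1 = i.-1 + L)%N by lia.
by rewrite modnDr modn_small; lia.
Qed.

Lemma card_bdist_le1 a : (#|[pred b : block L | bdist a b <= 1]| <= 5)%N.
Proof.
pose s := [:: a; (ordS a.1, a.2); (ord_pred a.1, a.2); (a.1, ordS a.2);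
  (a.1, ord_pred a.2)].
apply: (@leq_trans #|s|); last exact: card_size.
apply: subset_leq_card; apply/fintype.subsetP => b; rewrite inE /= => ab.
have h1 : b.1 \in [:: a.1; ordS a.1; ord_pred a.1].
  by apply: circ_dist_le1; apply: leq_trans ab; rewrite leq_addr.
have h2 : b.2 \in [:: a.2; ordS a.2; ord_pred a.2].
  by apply: circ_dist_le1; apply: leq_trans ab; rewrite leq_addl.
have h0 : (b.1 == a.1) || (b.2 == a.2).
  move: ab; rewrite /bdist /circ_dist; case: a b {s h1 h2} => [[a1 g1] [a2 g2]] [[b1 k1] [b2 k2]] /= ab.
  have [e1|e1] := eqVneq b1 a1; first by apply/orP; left; apply/eqP/val_inj.
  by apply/orP; right; apply/eqP/val_inj => /=; lia.
move: h0 h1 h2; case: a b @s {ab} => [a1 a2] [b1 b2] /=.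
rewrite !inE !xpair_eqE.
by case/orP => /eqP ->; rewrite eqxx ?andbT/= => h1 h2;
   [case/or3P: h2 => ->|case/or3P: h1 => ->]; rewrite ?orbT.
Qed.

Lemma SB_ge0 (R : realType) a b : 0 <= SB R a b.
Proof. by rewrite /SB; case: ifP => // _; rewrite invr_ge0. Qed.

Lemma SB_le1 (R : realType) a b : SB R a b <= 1.
Proof. by rewrite /SB; case: ifP => // _; rewrite invf_le1// ler1n. Qed.

Lemma SB_rowsum (R : realType) a : \sum_b SB R a b <= 1.
Proof.
rewrite /SB -big_mkcond sumr_const -[_ *+ _]mulr_natl ler_pdivrMr// mul1r ler_nat.
exact: card_bdist_le1.
Qed.
End Lattice.

Section CombesThomas.
Context (R : realType).

(** The hyperbolic cosine. *)
Definition chyp (x : R) : R := (expR x + expR (- x)) / 2.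

(** Factor exp th + exp (-th) - exp x - exp (-x) as
    (exp th - exp x) (1 - exp (-(th + x))). *)
Lemma chyp_mono (x th : R) : `|x| <= th -> chyp x <= chyp th.
Proof.
rewrite ler_norml => /andP[h1 h2]; rewrite /chyp ler_pM2r ?invr_gt0//.
rewrite -subr_ge0.
have -> : expR th + expR (- th) - (expR x + expR (- x)) =
   (expR th - expR x) * (1 - expR (- (th + x))).
  rewrite [- (th + x)]opprD expRD.
  have := expRxMexpNx_1 th; have := expRxMexpNx_1 x.
  set u := expR x; set u' := expR (- x); set t := expR th; set t' := expR (- th).
  move=> hu ht; transitivity (t - u - (t * t') * u' + (u * u') * t'); last by ring.
  by rewrite hu ht; ring.
rewrite mulr_ge0// subr_ge0 ?ler_expR// -[leRHS]expR0 ler_expR; lra.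
Qed.

Lemma chyp_le (th : R) : `|th| <= 2^-1 -> chyp th <= 1 + 2 * th ^+ 2.
Proof.
rewrite ler_norml => /andP[h1 h2]; rewrite /chyp ler_pdivrMr//.
have := @expR_le_quadratic R th h2.
have := @expR_le_quadratic R (- th); rewrite sqrrN => /(_ ltac:(lra)).
lra.
Qed.

Variables (n : nat) (S : 'M[R]_n) (s : R).
Hypotheses (Ssym : forall i j, S i j = S j i) (S0 : forall i j, 0 <= S i j).
Hypothesis (S1 : forall i, \sum_j S i j <= 1).
Hypotheses (s0 : 0 <= s) (s1 : s < 1).

(** Conjugation by the weight exp (th dd) multiplies S_ij by exp (th (dd_i - dd_j)).
    In the quadratic form only the symmetrised factor, a hyperbolic cosine of at
    most chyp th, survives; so the conjugated S still has norm at most chyp th, and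
    1 - s chyp th >= (1 - s) / 2. *)
Lemma weighted_coercivity (dd : 'I_n -> R) (th : R) (v : 'rV[R]_n) :
  (forall i j, S i j != 0 -> `|dd i - dd j| <= 1) ->
  0 <= th -> s * chyp th <= (1 + s) / 2 ->
  (1 - s) / 2 * \sum_i (expR (th * dd i) * v 0 i) ^+ 2 <=
  \sum_i expR (th * dd i) ^+ 2 * v 0 i * (v *m (1%:M - s *: S)) 0 i.
Proof.
move=> Sd th0 hth; pose g i := expR (th * dd i) * v 0 i.
pose r i j := expR (th * (dd j - dd i)).
have -> : \sum_i expR (th * dd i) ^+ 2 * v 0 i * (v *m (1%:M - s *: S)) 0 i =
    \sum_i g i ^+ 2 - s * \sum_i \sum_j S i j * (g i * g j * r j i).
  rewrite mulr_sumr -sumrB; apply: eq_bigr => i _.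
  rewrite mulmxBr mulmx1 -scalemxAr !mxE mulrBr; congr (_ - _).
    by rewrite /g; ring.
  rewrite mulrCA; congr (_ * _); rewrite mulr_sumr; apply: eq_bigr => j _.
  rewrite (Ssym j i) /r /g mulrBr expRD.
  have := expRxMexpNx_1 (th * dd j); set e := expR (- _); set f := expR _ => fe.
  set k := expR _.
  transitivity (k ^+ 2 * v 0 i * v 0 j * S i j * (f * e)); last by ring.
  by rewrite fe; ring.
(* exchanging i and j turns the weight ratio into its average with the inverse *)
have swap : \sum_i \sum_j S i j * (g i * g j * r j i) =
    \sum_i \sum_j S i j * (g i * g j * r i j).
  rewrite exchange_big; apply: eq_bigr => i _; apply: eq_bigr => j _.
  by rewrite Ssym [g j * _]mulrC.
have X : \sum_i \sum_j S i j * (g i * g j * r j i) <= chyp th * \sum_i g i ^+ 2.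
  rewrite -[leLHS]mulr1 -(@divff _ (2 : R))// mulrA mulr_natr mulr2n {2}swap -big_split.
  rewrite ler_pdivrMr//.
  apply: (@le_trans _ _ (\sum_i \sum_j chyp th * (S i j * (g i ^+ 2 + g j ^+ 2)))).
    apply: ler_sum => i _; rewrite -big_split; apply: ler_sum => j _ /=.
    have [->|Sij] := eqVneq (S i j) 0; first by rewrite !mul0r mulr0 addr0.
    rewrite -mulrDr [chyp th * _]mulrCA; apply: ler_wpM2l => //.
    rewrite -mulrDr.
    have -> : r j i + r i j = 2 * chyp (th * (dd i - dd j)).
      by rewrite /chyp /r mulrCA divff// mulr1 -mulrN opprB.
    apply: (@le_trans _ _ (`|2 * (g i * g j)| * chyp (th * (dd i - dd j)))).
      rewrite mulrCA mulrA ler_wpM2r ?ler_norm//.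
      by rewrite /chyp divr_ge0// addr_ge0 ?expR_ge0.
    rewrite mulrC; apply: ler_pM => //.
    - by rewrite /chyp divr_ge0// addr_ge0 ?expR_ge0.
    - apply: chyp_mono; rewrite normrM ger0_norm// -[leRHS]mulr1 ler_wpM2l//.
      exact: Sd.
    - rewrite ler_norml; apply/andP; split.
        have := sqr_ge0 (g i + g j); rewrite sqrrD; lra.
      have := sqr_ge0 (g i - g j); rewrite sqrrB; lra.
  have -> : \sum_i \sum_j chyp th * (S i j * (g i ^+ 2 + g j ^+ 2)) =
      2 * (chyp th * \sum_i g i ^+ 2 * \sum_j S i j).
    have hA : \sum_i \sum_j S i j * g i ^+ 2 = \sum_i g i ^+ 2 * \sum_j S i j.
      by apply: eq_bigr => i _; rewrite mulr_sumr; apply: eq_bigr => j _; rewrite mulrC.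
    have hC : \sum_i \sum_j S i j * g j ^+ 2 = \sum_i g i ^+ 2 * \sum_j S i j.
      rewrite -hA exchange_big; apply: eq_bigr => i _; apply: eq_bigr => j _.
      by rewrite Ssym.
    transitivity (chyp th * (\sum_i \sum_j S i j * g i ^+ 2 +
                  \sum_i \sum_j S i j * g j ^+ 2)); last by rewrite hA hC; ring.
    rewrite -big_split mulr_sumr; apply: eq_bigr => i _.
    rewrite /= -big_split mulr_sumr; apply: eq_bigr => j _ /=.
    by rewrite mulrDr.
  rewrite [leRHS]mulrC ler_pM2l//.
  apply: ler_wpM2l; first by rewrite /chyp divr_ge0// addr_ge0 ?expR_ge0.
  by apply: ler_sum => i _; rewrite -[leRHS]mulr1 ler_wpM2l ?sqr_ge0.
have g2 : 0 <= \sum_i g i ^+ 2 by rewrite sumr_ge0// => i _; rewrite sqr_ge0.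
have := ler_wpM2l s0 X; rewrite mulrA => X'.
have := ler_wpM2r g2 hth => X''.
rewrite lerBrDr; move: X' X''; rewrite -/g; lra.
Qed.

Lemma perturbed_identity_unit : 1%:M - s *: S \in unitmx.
Proof.
rewrite unitmxE unitfE; apply/negP => /det0P[v v0 vM].
have h0 : s * chyp 0 <= (1 + s) / 2.
  have : s <= 1 by exact: ltW.
  by rewrite /chyp oppr0 expR0; lra.
have hd (i j : 'I_n) : S i j != 0 -> `|(0 : R) - 0| <= 1.
  by move=> _; rewrite subrr normr0.
have := @weighted_coercivity (fun=> 0) 0 v hd (lexx _) h0; rewrite vM.
rewrite [leRHS]big1; last by move=> i _; rewrite mxE mulr0.
rewrite pmulr_rle0; last by rewrite divr_gt0// subr_gt0.
move=> h; move/eqP: v0; apply; apply/rowP => i; rewrite mxE.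
have : \sum_i (expR (0 * 0) * v 0 i) ^+ 2 == 0.
  by rewrite eq_le h sumr_ge0// => j _; rewrite sqr_ge0.
rewrite psumr_eq0; last by move=> j _; rewrite sqr_ge0.
move=> /allP/(_ i); rewrite mem_index_enum => /(_ isT).
by rewrite mulr0 expR0 mul1r expf_eq0 /= => /eqP.
Qed.

(** The row a of the inverse solves v (1 - s S) = delta_a, so that coercivity
    bounds the sum of (exp (th dd_i) v_i)^2 by a multiple of v_a; this gives v_a
    first and then the other entries. *)
Lemma combes_thomas (dd : 'I_n -> R) (th : R) (a b : 'I_n) :
  (forall i j, S i j != 0 -> `|dd i - dd j| <= 1) -> dd a = 0 ->
  0 <= th -> s * chyp th <= (1 + s) / 2 ->
  `|invmx (1%:M - s *: S) a b| <= 2 / (1 - s) * expR (- (th * dd b)).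
Proof.
move=> Sd da th0 hth; set G := invmx _.
pose v := row a G.
have vM : v *m (1%:M - s *: S) = delta_mx 0 a.
  by rewrite /v -row_mul mulVmx ?perturbed_identity_unit// row1.
have := weighted_coercivity v Sd th0 hth; rewrite vM.
pose g i := expR (th * dd i) * v 0 i.
have -> : \sum_i expR (th * dd i) ^+ 2 * v 0 i * (delta_mx 0 a : 'rV[R]_n) 0 i = v 0 a.
  rewrite (bigD1 a)//= big1 => [|k ka]; last by rewrite !mxE /= (negPf ka) mulr0.
  by rewrite addr0 da mulr0 expR0 expr1n mul1r [delta_mx _ _ _ _]mxE !eqxx mulr1.
have vE k : v 0 k = G a k by rewrite mxE.
rewrite -[X in (1 - s) / 2 * X]/(\sum_i g i ^+ 2) => h.
have e1 : 0 < 1 - s by rewrite subr_gt0.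
have e0 : 0 < (1 - s) / 2 by rewrite divr_gt0.
have ga : g a = v 0 a by rewrite /g da mulr0 expR0 mul1r.
have hk k : (1 - s) / 2 * g k ^+ 2 <= v 0 a.
  apply: le_trans h; rewrite ler_pM2l// (bigD1 k)//= lerDl.
  by rewrite sumr_ge0// => i _; rewrite sqr_ge0.
have va : v 0 a <= 2 / (1 - s).
  have := hk a; rewrite ga => ha.
  have [va|va] := lerP (v 0 a) 0; first by rewrite (le_trans va)// divr_ge0// ltW.
  rewrite ler_pdivlMr//.
  move: ha; rewrite expr2 mulrA ger_pMl//; lra.
have gb : `|g b| <= 2 / (1 - s).
  rewrite -(@ler_pXn2r _ 2) ?nnegrE//; last by rewrite divr_ge0// ltW.
  rewrite real_normK ?num_real//.
  have := le_trans (hk b) va; rewrite -ler_pdivlMl//.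
  by move/le_trans; apply; rewrite invf_div expr2.
have -> : G a b = g b * expR (- (th * dd b)).
  by rewrite /g mulrAC expRxMexpNx_1 mul1r vE.
by rewrite normrM [X in _ * X]ger0_norm ?expR_ge0// ler_wpM2r ?expR_ge0.
Qed.
End CombesThomas.

(** The rate sqrt (1 - s) / 4 is admissible because the hyperbolic cosine exceeds
    1 only quadratically. *)
Lemma Kloop_decay (R : realType) (W L : nat) (s : R) (a b : block L) :
  0 <= s < 1 ->
  `|Kloop W s a b| <= W%:R ^- 2 *
     (2 / (1 - s) * expR (- (Num.sqrt (1 - s) / 4 * (bdist a b)%:R))).
Proof.
move=> /andP[s0 s1].
rewrite /Kloop normrM ger0_norm ?invr_ge0 ?exprn_ge0// ler_wpM2l ?invr_ge0 ?exprn_ge0//.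
rewrite /fentry.
have := @combes_thomas R #|{: block L}| (fmx (@SB R L)) s _ _ _ s0 s1
  (fun i => (bdist a (enum_val i))%:R) (Num.sqrt (1 - s) / 4) (enum_rank a) (enum_rank b).
rewrite !enum_rankK bdistxx; apply => //.
- by move=> i j; rewrite !mxE /SB bdistC.
- by move=> i j; rewrite mxE SB_ge0.
- move=> i; under eq_bigr do rewrite mxE.
  rewrite -(big_enum_val (SB R (enum_val i))); exact: SB_rowsum.
- move=> i j; rewrite mxE /SB; case: ifP => [h _|]; last by rewrite eqxx.
  set x := enum_val i in h *; set y := enum_val j in h *.
  have h1 := bdist_triangle a x y; have h2 := bdist_triangle a y x.
  rewrite [bdist y x]bdistC in h2.
  have {h1} : (bdist a y <= bdist a x + 1)%N by lia.
  have {h2} : (bdist a x <= bdist a y + 1)%N by lia.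
  rewrite -!(ler_nat R) !natrD => h1 h2.
  by rewrite ler_norml; apply/andP; split; lra.
- have e0 : 0 <= 1 - s by lra.
  have q0 := sqrtr_ge0 (1 - s); have q2 := sqr_sqrtr e0.
  have q1 : Num.sqrt (1 - s) <= 1 by rewrite -[leRHS]sqrtr1 ler_wsqrtr//; lra.
  apply: (@le_trans _ _ (s * (1 + 2 * (Num.sqrt (1 - s) / 4) ^+ 2))).
    rewrite ler_wpM2l// chyp_le// ger0_norm; lra.
  rewrite expr_div_n q2; nra.
Qed.

(** * Colourings and inverse square sums on the torus *)

Section Colouring.
Variables (L q : nat).
Hypothesis q0 : (0 < q)%N.

(** Positions are coloured by their residue mod q.  The last, incomplete period
    takes q fresh colours, since it would otherwise come too close to the first
    one around the circle. *)
Definition colour1 (i : 'I_L) : nat :=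
  (if (i < L %/ q * q)%N then i %% q else q + i %% q)%N.

Lemma colour1_lt i : (colour1 i < 2 * q)%N.
Proof. by rewrite /colour1; have := ltn_pmod i q0; case: ifP; lia. Qed.

Lemma colour1_sep i j : colour1 i = colour1 j -> i != j ->
  (q <= circ_dist L i j)%N.
Proof.
rewrite /colour1 -val_eqE /= => e ij.
have hi := ltn_pmod i q0; have hj := ltn_pmod j q0.
have r : (i %% q = j %% q)%N by move: e; case: ifP; case: ifP; lia.
have {e} : ((i < L %/ q * q) = (j < L %/ q * q))%N by move: e; case: ifP; case: ifP; lia.
have := divn_eq i q; have := divn_eq j q; rewrite -r.
move: (leq_trunc_div L q) (ltn_ord i) (ltn_ord j) (ltn_ceil L q0) => LL iL jL L2.
have key A B : (A < B)%N -> (A * q + q <= B * q)%N.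
  by move=> AB; rewrite addnC -mulSn leq_mul2r AB orbT.
have key2 A B : (A * q < B * q)%N -> (A < B)%N by rewrite ltn_mul2r => /andP[].
move: (key (i %/ q)%N (j %/ q)%N) (key (j %/ q)%N (i %/ q)%N)
  (key (i %/ q)%N (L %/ q)%N) (key (j %/ q)%N (L %/ q)%N)
  (key2 (i %/ q)%N (L %/ q)%N) (key2 (j %/ q)%N (L %/ q)%N)
  (key (L %/ q)%N (i %/ q)%N) (key (L %/ q)%N (j %/ q)%N) L2.
rewrite /circ_dist mulSn; move: ij hi LL.
move: (i %/ q)%N (j %/ q)%N (L %/ q)%N (i %% q)%N => A B C D.
move: (nat_of_ord i) (nat_of_ord j) iL jL => x y iL jL ij hi LL k1 k2 k3 k4 k5 k6 k7 k8 L2 ey ex e.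
have [xC|Cx] := ltnP x (C * q); rewrite ?xC ?[(x < C * q)%N]ltnNge ?Cx /= in e.
  have yC : (y < C * q)%N by rewrite -e.
  have AC : (A < C)%N by apply: k5; lia.
  have BC : (B < C)%N by apply: k6; lia.
  have {}k3 := k3 AC; have {}k4 := k4 BC; clear k5 k6 k7 k8 e xC yC AC BC L2.
  have [AB|AB|AB] := ltngtP A B; last by rewrite AB in ex; lia.
    by have {}k1 := k1 AB; clear k2 AB; lia.
  by have {}k2 := k2 AB; clear k1 AB; lia.
have yC : (C * q <= y)%N by rewrite leqNgt -e.
clear k3 k4 k5 k6 k7 k8 e.
have [AB|AB|AB] := ltngtP A B; last by rewrite AB in ex; lia.
  by have {}k1 := k1 AB; clear k2 AB; lia.
by have {}k2 := k2 AB; clear k1 AB; lia.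
Qed.

Definition colour (b : block L) : 'I_(2 * q) * 'I_(2 * q) :=
  (Ordinal (colour1_lt b.1), Ordinal (colour1_lt b.2)).

Lemma colour_sep (a b : block L) : colour a = colour b -> a != b ->
  (q <= bdist a b)%N.
Proof.
case: a b => [a1 a2] [b1 b2] [e1 e2]; rewrite xpair_eqE negb_and /bdist /=.
case/orP => h; first exact: leq_trans (colour1_sep e1 h) (leq_addr _ _).
exact: leq_trans (colour1_sep e2 h) (leq_addl _ _).
Qed.
End Colouring.

Section InverseSquareSum.
Context (R : realType).

Lemma harmonic_le (n : nat) :
  \sum_(k < n.+1) (1 + k%:R)^-1 <= 1 + ln n.+1%:R :> R.
Proof.
elim: n => [|n IH]; first by rewrite big_ord1 ln1 !addr0 invr1.
rewrite big_ord_recr /=; apply: le_trans (lerD IH (lexx _)) _.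
rewrite -addrA lerD2l -lerBrDl.
have n0 : 0 < n.+2%:R :> R by [].
have -> : (1 + n.+1%:R)^-1 = - (- n.+2%:R^-1) :> R by rewrite opprK -[n.+2]add1n natrD.
rewrite -opprB lerN2 -ln_div ?posrE//.
have -> : n.+1%:R / n.+2%:R = 1 + (- n.+2%:R^-1) :> R.
  have -> : n.+1%:R = n.+2%:R - 1 :> R by rewrite -[n.+2]addn1 natrD addrK.
  by rewrite mulrBl divff ?pnatr_eq0// mul1r.
apply: le_ln1Dx; rewrite ltrN2 invf_lt1// ltr1n //.
Qed.

(** The bound 4 instead of 2 avoids a discussion of the two arcs. *)
Lemma circ_dist_fiber L (i : 'I_L) (k : nat) :
  (#|[pred j : 'I_L | circ_dist L i j == k]| <= 4)%N.
Proof.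
pose s : seq nat := [:: i + k; i - k; i + (L - k); i - (L - k)]%N.
rewrite cardE -(size_map val); apply: (@leq_trans (size s)) => //.
apply: uniq_leq_size; first by rewrite map_inj_uniq ?enum_uniq//; exact: val_inj.
move=> _ /mapP[j + ->]; rewrite mem_enum inE => /eqP; rewrite /circ_dist !inE /=.
move: (ltn_ord i) (ltn_ord j); move: (nat_of_ord i) (nat_of_ord j) => x y hx hy.
by move=> h; apply/or4P; have [h'|h'] := leqP (x - y + (y - x)) (L - (x - y + (y - x)));
  have [xy|xy] := leqP x y; [apply: Or41|apply: Or42|apply: Or43|apply: Or44]; apply/eqP; lia.
Qed.

Lemma sum_inv_circ_dist L (i : 'I_L) :
  \sum_(j < L) (1 + (circ_dist L i j)%:R)^-1 <= 4 * (1 + ln L.+1%:R) :> R.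
Proof.
have dL j : (circ_dist L i j < L.+1)%N by rewrite /circ_dist; lia.
rewrite (partition_big (fun j : 'I_L => Ordinal (dL j)) xpredT)//=.
apply: (@le_trans _ _ (\sum_(k < L.+1) 4 * (1 + k%:R)^-1)); last first.
  by rewrite -mulr_sumr ler_wpM2l// harmonic_le.
apply: ler_sum => k _.
rewrite (eq_bigr (fun=> (1 + k%:R)^-1)); last by move=> j /eqP <-.
rewrite sumr_const -[_ *+ _]mulr_natl ler_wpM2r ?invr_ge0 ?addr_ge0//.
rewrite (ler_nat R _ 4); apply: leq_trans (circ_dist_fiber i k).
by apply: subset_leq_card; apply/fintype.subsetP => j; rewrite !inE => /eqP <-.
Qed.

(** Since (1 + x + y)^2 >= (1 + x) (1 + y), the sum is at most the product of two
    harmonic sums. *)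
Lemma sum_inv_sqr_bdist L (a : block L) :
  \sum_b (1 + (bdist a b)%:R) ^- 2 <= (4 * (1 + ln L.+1%:R)) ^+ 2 :> R.
Proof.
have pos L' (x y : 'I_L') : 0 <= (1 + (circ_dist L' x y)%:R)^-1 :> R.
  by rewrite invr_ge0 addr_ge0.
apply: (@le_trans _ _ (\sum_(b1 < L) \sum_(b2 < L)
   (1 + (circ_dist L a.1 b1)%:R)^-1 * (1 + (circ_dist L a.2 b2)%:R)^-1)); last first.
  under eq_bigr do rewrite -mulr_sumr.
  rewrite -mulr_suml expr2; apply: ler_pM; rewrite ?sumr_ge0 ?sum_inv_circ_dist//.
rewrite pair_bigA /=; apply: ler_sum => b _.
rewrite -invfM lef_pV2 ?posrE ?exprn_gt0 ?mulr_gt0// ?ltr_pwDl//.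
rewrite /bdist natrD; set x := (circ_dist _ _ _)%:R; set y := (circ_dist _ _ _)%:R.
have x0 : 0 <= x by []. have y0 : 0 <= y by [].
nra.
Qed.
End InverseSquareSum.

(** * Measurability of the resolvent *)

Section ComplexMeasurable.
Context (R : realType) (d : measure_display) (T : measurableType d).
Implicit Types f g : T -> R[i].

(** Borel measurability into the complex plane, read coordinatewise. *)
Definition cmeasurable f :=
  measurable_fun setT (fun w => complex.Re (f w)) /\
  measurable_fun setT (fun w => complex.Im (f w)).

Lemma cmeasurable_cst (a : R[i]) : cmeasurable (fun=> a).
Proof. by split; exact: measurable_cst. Qed.

Lemma cmeasurableD f g : cmeasurable f -> cmeasurable g ->
  cmeasurable (fun w => f w + g w).
Proof.
move=> [f1 f2] [g1 g2]; split.
  by under eq_fun do rewrite cReD; exact: measurable_funD.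
by under eq_fun do rewrite cImD; exact: measurable_funD.
Qed.

Lemma cmeasurableM f g : cmeasurable f -> cmeasurable g ->
  cmeasurable (fun w => f w * g w).
Proof.
move=> [f1 f2] [g1 g2]; split.
  under eq_fun do rewrite cReM.
  by apply: measurable_funB; apply: measurable_funM.
under eq_fun do rewrite cImM.
by apply: measurable_funD; apply: measurable_funM.
Qed.

Lemma cmeasurableB f g : cmeasurable f -> cmeasurable g ->
  cmeasurable (fun w => f w - g w).
Proof.
move=> mf mg; apply: cmeasurableD => //.
under eq_fun do rewrite -mulN1r.
by apply: cmeasurableM => //; exact: cmeasurable_cst.
Qed.

Lemma cmeasurable_conj f : cmeasurable f -> cmeasurable (fun w => (f w)^*).
Proof.
move=> [f1 f2]; split.
  by rewrite (_ : (fun w => _) = (fun w => complex.Re (f w)))//; apply/funext => w; case: (f w).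
rewrite (_ : (fun w => _) = (fun w => - complex.Im (f w))).
  exact: measurableT_comp.
by apply/funext => w; case: (f w).
Qed.

Lemma cmeasurableV f : cmeasurable f -> cmeasurable (fun w => (f w)^-1).
Proof.
move=> [f1 f2].
pose n2 w := complex.Re (f w) ^+ 2 + complex.Im (f w) ^+ 2.
have n20 w : 0 <= n2 w by rewrite addr_ge0 ?sqr_ge0.
have mi : measurable_fun setT (fun w => (n2 w)^-1).
  rewrite (_ : (fun w => _) = (fun w => n2 w `^ (-1))); last first.
    by apply/funext => w; rewrite powR_inv1.
  apply: (measurableT_comp (measurable_powR _)).
  by apply: measurable_funD; apply: measurable_funX.
split.
  rewrite (_ : (fun w => _) = (fun w => complex.Re (f w) * (n2 w)^-1)).
    exact: measurable_funM.
  by apply/funext => w; rewrite /n2; case: (f w).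
rewrite (_ : (fun w => _) = (fun w => - (complex.Im (f w) * (n2 w)^-1))).
  by apply: measurableT_comp => //; exact: measurable_funM.
by apply/funext => w; rewrite /n2; case: (f w).
Qed.

Lemma cmeasurable_sum (I : Type) (r : seq I) (p : pred I) (F : I -> T -> R[i]) :
  (forall i, p i -> cmeasurable (F i)) ->
  cmeasurable (fun w => \sum_(i <- r | p i) F i w).
Proof.
move=> mF; elim: r => [|i r IH].
  rewrite (_ : (fun w => _) = (fun=> 0)); first exact: cmeasurable_cst.
  by apply/funext => w; rewrite big_nil.
have [pi|pi] := boolP (p i); last first.
  rewrite (_ : (fun w => _) = (fun w => \sum_(j <- r | p j) F j w))//.
  by apply/funext => w; rewrite big_cons (negPf pi).
rewrite (_ : (fun w => _) = (fun w => F i w + \sum_(j <- r | p j) F j w)).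
  by apply: cmeasurableD => //; exact: mF.
by apply/funext => w; rewrite big_cons pi.
Qed.

Lemma cmeasurable_prod (I : Type) (r : seq I) (p : pred I) (F : I -> T -> R[i]) :
  (forall i, p i -> cmeasurable (F i)) ->
  cmeasurable (fun w => \prod_(i <- r | p i) F i w).
Proof.
move=> mF; elim: r => [|i r IH].
  rewrite (_ : (fun w => _) = (fun=> 1)); first exact: cmeasurable_cst.
  by apply/funext => w; rewrite big_nil.
have [pi|pi] := boolP (p i); last first.
  rewrite (_ : (fun w => _) = (fun w => \prod_(j <- r | p j) F j w))//.
  by apply/funext => w; rewrite big_cons (negPf pi).
rewrite (_ : (fun w => _) = (fun w => F i w * \prod_(j <- r | p j) F j w)).
  by apply: cmeasurableM => //; exact: mF.
by apply/funext => w; rewrite big_cons pi.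
Qed.

Lemma measurable_nrm f : cmeasurable f -> measurable_fun setT (fun w => nrm (f w)).
Proof.
move=> [f1 f2]; under eq_fun do rewrite nrmE.
apply: (measurableT_comp (continuous_measurable_fun (@sqrt_continuous R))).
by apply: measurable_funD; apply: measurable_funX.
Qed.

Lemma cmeasurable_mulmx m n p (F : T -> 'M[R[i]]_(m, n)) (G : T -> 'M[R[i]]_(n, p)) :
  (forall i j, cmeasurable (fun w => F w i j)) ->
  (forall i j, cmeasurable (fun w => G w i j)) ->
  forall i j, cmeasurable (fun w => (F w *m G w) i j).
Proof.
move=> mF mG i j; under eq_fun do rewrite mxE.
by apply: cmeasurable_sum => k _; exact: cmeasurableM.
Qed.

Lemma cmeasurable_det n (F : T -> 'M[R[i]]_n) :
  (forall i j, cmeasurable (fun w => F w i j)) -> cmeasurable (fun w => \det (F w)).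
Proof.
move=> mF; apply: cmeasurable_sum => s _; apply: cmeasurableM.
  exact: cmeasurable_cst.
by apply: cmeasurable_prod => i _; exact: mF.
Qed.

(** By Cramer's rule, since determinants are polynomial in the entries. *)
Lemma cmeasurable_invmx n (F : T -> 'M[R[i]]_n) :
  (forall w, F w \in unitmx) ->
  (forall i j, cmeasurable (fun w => F w i j)) ->
  forall i j, cmeasurable (fun w => invmx (F w) i j).
Proof.
move=> uF mF i j; under eq_fun do rewrite /invmx uF mxE.
apply: cmeasurableM; first by apply: cmeasurableV; exact: cmeasurable_det.
under eq_fun do rewrite mxE.
apply: cmeasurableM; first exact: cmeasurable_cst.
apply: cmeasurable_det => k l; under eq_fun do rewrite !mxE.
exact: mF.
Qed.
End ComplexMeasurable.

Section Green.
Context (R : realType) (T : Type) (W L : nat).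
Variables (B : site W L -> site W L -> R -> T -> R[i]) (E t : R).
Hypothesis Bherm : forall x y w, B y x t w = (B x y t w)^*.
Hypothesis eta0 : 0 < eta E t.

Lemma Hmx_herm w : hermmx (Hmx B t w).
Proof.
move=> i j; rewrite !mxE Bherm rmorphM /=; congr (_ * _).
rewrite /Svar /SB bdistC; case: ifP => _ //; by rewrite oppr0.
Qed.

Lemma green_bound sg w x y : nrm (fentry (green B E t sg w) x y) <= (eta E t)^-1.
Proof.
rewrite /fentry /green; case: sg; last rewrite mxE nrmC.
  exact: (herm_resolvent_bound (Hmx_herm w)).
exact: (herm_resolvent_bound (Hmx_herm w)).
Qed.

End Green.

Section GreenMeasurable.
Context (R : realType) (d : measure_display) (T : measurableType d) (W L : nat).
Variables (B : site W L -> site W L -> R -> T -> R[i]) (E t : R).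
Hypothesis Bherm : forall x y w, B y x t w = (B x y t w)^*.
Hypothesis eta0 : 0 < eta E t.
Hypothesis mB : forall x y, cmeasurable (B x y t).

Lemma green_measurable sg i j : cmeasurable (fun w => green B E t sg w i j).
Proof.
have mG k l : cmeasurable (fun w => invmx (Hmx B t w - (zt E t)%:M) k l).
  apply: cmeasurable_invmx => [w|k' l'].
    exact: (herm_resolvent_unit (Hmx_herm Bherm w)).
  under eq_fun do rewrite !mxE.
  apply: cmeasurableB; last exact: cmeasurable_cst.
  by apply: cmeasurableM => //; exact: cmeasurable_cst.
rewrite /green; case: sg => //.
by under eq_fun do rewrite mxE; exact: cmeasurable_conj.
Qed.

Lemma Ysum_measurable u (sg : 'I_u -> bool) coef b :
  cmeasurable (Ysum sg B E t coef b).
Proof.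
rewrite /Ysum; apply: cmeasurable_sum => x _; apply: cmeasurable_sum => y _.
apply: cmeasurableM; first exact: cmeasurable_cst.
by apply: cmeasurable_prod => i _; exact: green_measurable.
Qed.

Lemma Lloop_measurable a b : cmeasurable (Lloop B E t a b).
Proof.
rewrite /Lloop /mxtrace; apply: cmeasurable_sum => i _.
apply: (@cmeasurable_mulmx _ _ T _ _ _ (fun w => _) (fun w => _)) => [k l|k l].
  apply: (@cmeasurable_mulmx _ _ T _ _ _ (fun w => _) (fun w => _)) => [k' l'|k' l'].
    apply: (@cmeasurable_mulmx _ _ T _ _ _ (fun w => _) (fun w => _)) => [k2 l2|k2 l2].
      exact: green_measurable.
    exact: cmeasurable_cst.
  exact: green_measurable.
exact: cmeasurable_cst.
Qed.
End GreenMeasurable.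

(** * Localisation of the observables *)

Section Entries.
Context (R : realType) (d : measure_display) (T : measurableType d)
  (I : finType) (B : I -> I -> R -> T -> R[i]) (s : R).
Hypothesis Bherm : forall x y w, B y x s w = (B x y s w)^*.

Lemma entry_Re x y w : complex.Re (B x y s w) =
  if x == y then bm_coord B (x, y) s w
  else if (enum_rank x < enum_rank y)%N then (Num.sqrt 2)^-1 * bm_coord B (x, y) s w
  else (Num.sqrt 2)^-1 * bm_coord B (y, x) s w.
Proof.
have q2 : Num.sqrt 2 != 0 :> R by rewrite sqrtr_eq0 -ltNge.
rewrite /bm_coord /=; have [//|xy] := eqVneq x y.
case: ltnP => rxy; first by rewrite mulKf.
rewrite ifT ?mulKf//; first by rewrite (Bherm x y); case: (B x y s w).
by rewrite ltn_neqAle rxy andbT val_eqE (inj_eq enum_rank_inj) eq_sym.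
Qed.

Lemma entry_Im x y w : complex.Im (B x y s w) =
  if x == y then 0
  else if (enum_rank x < enum_rank y)%N then - ((Num.sqrt 2)^-1 * bm_coord B (y, x) s w)
  else (Num.sqrt 2)^-1 * bm_coord B (x, y) s w.
Proof.
have q2 : Num.sqrt 2 != 0 :> R by rewrite sqrtr_eq0 -ltNge.
rewrite /bm_coord /=; have [->|xy] := eqVneq x y.
  have := Bherm y y w; case: (B y y s w) => a b [] /eqP.
  by rewrite -subr_eq0 opprK -mulr2n mulrn_eq0 /= => /eqP.
case: ltnP => rxy; last by rewrite mulKf.
rewrite ltnNge (ltnW rxy) /= mulKf//.
by rewrite (Bherm x y); case: (B x y s w) => a b /=; rewrite opprK.
Qed.

Lemma entry_measurable x y : measurable_fun setT (bm_coord B (x, y) s) ->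
  measurable_fun setT (bm_coord B (y, x) s) -> cmeasurable (B x y s).
Proof.
move=> m1 m2; split.
  rewrite (funext (entry_Re x y)).
  by case: (x == y) => //; case: (_ < _)%N; apply: measurable_funM.
rewrite (funext (entry_Im x y)).
case: (x == y) => //; case: (_ < _)%N; last by apply: measurable_funM.
by apply: measurableT_comp => //; apply: measurable_funM.
Qed.

Lemma entry_bound (K : R) x y w : 0 <= K ->
  (forall p, `|bm_coord B p s w| <= K) -> nrm (B x y s w) <= 2 * K.
Proof.
move=> K0 hK; have q1 : (Num.sqrt 2)^-1 <= 1 :> R.
  by rewrite invf_le1 ?sqrtr_gt0// -{1}[1]sqrtr1 ler_sqrt// ler1n.
have h p : `|(Num.sqrt 2)^-1 * bm_coord B p s w| <= K.
  rewrite normrM ger0_norm ?invr_ge0 ?sqrtr_ge0// -[leRHS]mul1r.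
  by rewrite ler_pM// invr_ge0.
rewrite (le_trans (nrm_le_ReIm _))// mulr_natl mulr2n; apply: lerD.
  by rewrite entry_Re; case: eqP => // _; case: ifP.
rewrite entry_Im; case: eqP => [_|_]; first by rewrite normr0.
by case: ifP => _ //; rewrite normrN.
Qed.
End Entries.

Section Localisation.
Context (R : realType) (T : Type) (W L : nat)
  (B : site W L -> site W L -> R -> T -> R[i]).

(** Zeroing Brownian motions rather than matrix entries makes the localised
    objects instances of the original definitions. *)
Definition locB (Q : {set block L}) (x y : site W L) (t : R) (w : T) : R[i] :=
  if (blockof x \in Q) && (blockof y \in Q) then B x y t w else 0.

(** The real coordinates on which the localised matrix depends. *)
Definition coords (Q : {set block L}) : {set site W L * site W L} :=
  [set p : site W L * site W L | (blockof p.1 \in Q) && (blockof p.2 \in Q)]%SET.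

Lemma coords_disjoint (Q Q' : {set block L}) : [disjoint Q & Q']%bool ->
  [disjoint coords Q & coords Q']%bool.
Proof.
move=> dQ; rewrite -finset.setI_eq0; apply/eqP/setP => p; rewrite !inE.
by have [h|//] := boolP (blockof p.1 \in Q); rewrite (disjointFr dQ h)/= andbF.
Qed.

Lemma locB_herm Q s : (forall x y w, B y x s w = (B x y s w)^*) ->
  forall x y w, locB Q y x s w = (locB Q x y s w)^*.
Proof.
by move=> h x y w; rewrite /locB andbC; case: ifP => // _; rewrite conjc0.
Qed.
End Localisation.

(** The general measurability of the observable, applied to the smaller
    sigma-algebra of the coordinates in Q. *)
Lemma locYsum_measurable (R : realType) (d : measure_display)
    (T : measurableType d) (W L : nat)
    (B : site W L -> site W L -> R -> T -> R[i]) (E s : R) (Q : {set block L})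
    u (sg : 'I_u -> bool) coef b :
  (forall x y w, B y x s w = (B x y s w)^*) -> 0 < eta E s ->
  @cmeasurable R _ (g_sigma_algebraType (cyl (fun p => bm_coord B p s) (coords W Q)))
    (Ysum sg (locB B Q) E s coef b).
Proof.
move=> hB e0; set T1 := g_sigma_algebraType _.
apply: (@Ysum_measurable _ _ T1 W L (locB B Q)) => //; first exact: locB_herm.
move=> x y; rewrite /locB.
case: (boolP ((blockof x \in Q) && (blockof y \in Q))) => [/andP[hx hy]|_]; last first.
  exact: cmeasurable_cst.
apply: (@entry_measurable _ _ T1) => //.
  apply: (@measurable_cyl_coord _ _ _ _ (fun p => bm_coord B p s)).
  by rewrite inE /= hx hy.
apply: (@measurable_cyl_coord _ _ _ _ (fun p => bm_coord B p s)).
by rewrite inE /= hx hy.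
Qed.

(** Telescoping over the factors. *)
Lemma prod_diff_le (R : realType) (u : nat) (a b : 'I_u -> R[i]) (g dl : R) :
  1 <= g -> 0 <= dl -> (forall i, nrm (a i) <= g) -> (forall i, nrm (b i) <= g) ->
  (forall i, nrm (a i - b i) <= dl) ->
  nrm (\prod_i a i - \prod_i b i) <= u%:R * g ^+ u * dl.
Proof.
move=> g1 dl0; have g0 : 0 <= g by exact: le_trans g1.
elim: u a b => [|u IH] a b ha hb hab.
  by rewrite !big_ord0 subrr nrm0 !mul0r.
rewrite !big_ord_recl.
set A := \prod_(i < u) _; set Bp := \prod_(i < u) _.
have hB : nrm Bp <= g ^+ u.
  have <- : \prod_(i < u) g = g ^+ u by rewrite prodr_const card_ord.
  rewrite nrm_prod; apply: ler_prod => i _.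
  by rewrite nrm_ge0 hb.
have hd : nrm (A - Bp) <= u%:R * g ^+ u * dl by apply: IH.
have -> : a ord0 * A - b ord0 * Bp = a ord0 * (A - Bp) + (a ord0 - b ord0) * Bp by ring.
apply: (le_trans (nrmD _ _)); rewrite !nrmM.
apply: (@le_trans _ _ (g * (u%:R * g ^+ u * dl) + dl * g ^+ u)).
  by apply: lerD; apply: ler_pM; rewrite ?nrm_ge0.
have gu : 0 <= g ^+ u by rewrite exprn_ge0.
have -> : u.+1%:R * g ^+ u.+1 * dl = g * (u%:R * g ^+ u * dl) + g * (dl * g ^+ u).
  by rewrite exprS -[u.+1]addn1 natrD; ring.
by rewrite lerD2l ler_peMl// mulr_ge0.
Qed.

Lemma card_site W L : #|{: site W L}| = Nsize W L.
Proof. by rewrite card_prod !card_ord /Nsize; lia. Qed.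

Section LocalError.
Context (R : realType) (T : Type) (W L : nat)
  (B : site W L -> site W L -> R -> T -> R[i]) (E s : R)
  (u : nat) (sg : 'I_u -> bool)
  (coef : block L -> {ffun 'I_u -> site W L} -> {ffun 'I_u -> site W L} -> R[i])
  (r0 g K rho k0 : R).
Hypothesis Bherm : forall x y w, B y x s w = (B x y s w)^*.
Hypothesis eta0 : 0 < eta E s.
Hypotheses (r00 : 0 < r0) (g1 : 1 <= g) (etag : (eta E s)^-1 <= g)
  (K0 : 0 <= K) (rho0 : 0 <= rho).
Hypothesis coefb : forall b x y, nrm (coef b x y) <= k0.
Hypothesis csupp : forall (b : block L) (x y : {ffun 'I_u -> site W L}),
  r0 <= (\max_(i < u) (bdist (blockof (x i)) b + bdist (blockof (y i)) b))%N%:R ->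
  coef b x y = 0.

Let N : R := (Nsize W L)%:R.

(** The radius is twice r0: sites of blocks within r0 of b are then at distance
    more than r0 from the complement of the ball. *)
Definition nbhd (b : block L) : {set block L} :=
  [set c : block L | (bdist c b)%:R < 2 * r0]%SET.

Lemma nbhd_disjoint b c : 4 * r0 <= (bdist b c)%:R ->
  [disjoint nbhd b & nbhd c]%bool.
Proof.
move=> h; rewrite -finset.setI_eq0; apply/eqP/setP => x; rewrite !inE.
apply/negP => /andP[h1 h2].
have := bdist_triangle b x c; rewrite bdistC in h1; rewrite -(ler_nat R) natrD; lra.
Qed.

Lemma green_local sg' b x y w :
  (forall p q, nrm (B p q s w) <= 2 * K) ->
  (forall p q : site W L, r0 <= (bdist (blockof p) (blockof q))%:R ->
     nrm (fentry (green B E s true w) p q) <= rho) ->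
  (bdist (blockof x) b)%:R < r0 -> (bdist (blockof y) b)%:R < r0 ->
  nrm (fentry (green B E s sg' w) x y - fentry (green (locB B (nbhd b)) E s sg' w) x y) <=
    N ^+ 2 * (g * (2 * K) * rho).
Proof.
move=> hK hfar hx hy.
have main p q : (bdist (blockof p) b)%:R < r0 -> (bdist (blockof q) b)%:R < r0 ->
  nrm (invmx (Hmx B s w - (zt E s)%:M) (enum_rank p) (enum_rank q)
     - invmx (Hmx (locB B (nbhd b)) s w - (zt E s)%:M) (enum_rank p) (enum_rank q)) <=
    N ^+ 2 * (g * (2 * K) * rho).
  move=> hp hq; rewrite /N -card_site.
  apply: (@resolvent_local _ _ _ _ _ [pred i | blockof (enum_val i) \in nbhd b]) => //.
  - exact: Hmx_herm.
  - by apply: Hmx_herm; exact: locB_herm.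
  - by move=> k l; rewrite !mxE /locB /=; case: ifP => //; rewrite mulr0.
  - move=> k l; rewrite mxE nrmM nrm_real -[leRHS]mul1r ler_pM ?nrm_ge0//.
    rewrite ger0_norm ?sqrtr_ge0// -[leRHS]sqrtr1 ler_wsqrtr//.
    rewrite /Svar mulr_ile1 ?invr_ge0 ?exprn_ge0 ?SB_ge0 ?SB_le1//.
    have [->|W0] := posnP W; first by rewrite expr0n /= invr0.
    by rewrite invf_le1 ?exprn_gt0 ?ltr0n// exprn_ege1// ler1n.
  - rewrite /= inE enum_rankK; have := r00; lra.
  - move=> k; rewrite /= inE -leNgt => hk.
    have := hfar (enum_val k) q; rewrite /fentry /green enum_valK; apply.
    have := bdist_triangle (blockof (enum_val k)) (blockof q) b.
    rewrite -(ler_nat R) natrD; have := r00; lra.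
rewrite /fentry /green; case: sg'; first exact: main.
rewrite !mxE -rmorphB nrmC; exact: main.
Qed.

Let card2 : (#|{ffun 'I_u -> site W L}|%:R : R) = N ^+ u.
Proof. by rewrite card_ffun card_ord card_site natrX. Qed.

Lemma sum2_le (F : {ffun 'I_u -> site W L} -> {ffun 'I_u -> site W L} -> R[i]) (M : R) :
  (forall x y, nrm (F x y) <= M) ->
  nrm (\sum_x \sum_y F x y) <= N ^+ (2 * u) * M.
Proof.
move=> hF; apply: (le_trans (nrm_sum _ _ _)).
apply: (@le_trans _ _ (\sum_(x : {ffun 'I_u -> site W L})
    \sum_(y : {ffun 'I_u -> site W L}) M)).
  by apply: ler_sum => x _; apply: (le_trans (nrm_sum _ _ _)); apply: ler_sum.
rewrite !sumr_const -mulrnA -[leLHS]mulr_natl natrM.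
by rewrite card2 -exprD addnn mul2n.
Qed.

Lemma Ysum_bound b w : nrm (Ysum sg B E s coef b w) <= N ^+ (2 * u) * (k0 * g ^+ u).
Proof.
apply: sum2_le => x y; rewrite nrmM; apply: ler_pM; rewrite ?nrm_ge0//.
rewrite nrm_prod.
have <- : \prod_(i < u) g = g ^+ u by rewrite prodr_const card_ord.
apply: ler_prod => i _; rewrite nrm_ge0 /=.
exact: le_trans (green_bound _ _ _ _ _ _) etag.
Qed.

(** Coefficients at sites beyond r0 from b vanish, and at the remaining sites
    every factor of the product is close to its localisation. *)
Lemma Ysum_local b w :
  (forall p q, nrm (B p q s w) <= 2 * K) ->
  (forall p q : site W L, r0 <= (bdist (blockof p) (blockof q))%:R ->
     nrm (fentry (green B E s true w) p q) <= rho) ->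
  nrm (Ysum sg B E s coef b w - Ysum sg (locB B (nbhd b)) E s coef b w) <=
    N ^+ (2 * u) * (k0 * (u%:R * g ^+ u * (N ^+ 2 * (g * (2 * K) * rho)))).
Proof.
move=> hK hfar; rewrite /Ysum -sumrB.
under eq_bigr do rewrite -sumrB.
apply: sum2_le => x y; rewrite -mulrBr nrmM.
set dl := N ^+ 2 * _.
have g0 : 0 <= g by exact: le_trans g1.
have dl0 : 0 <= dl by rewrite !mulr_ge0// exprn_ge0.
have [h|h] := lerP r0 (\max_(i < u) (bdist (blockof (x i)) b + bdist (blockof (y i)) b))%N%:R.
  rewrite (csupp h) nrm0 mul0r mulr_ge0//; last by rewrite !mulr_ge0 ?exprn_ge0.
  exact: le_trans (nrm_ge0 _) (coefb b x y).
apply: ler_pM; rewrite ?nrm_ge0//; apply: prod_diff_le => //.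
- by move=> i; apply: le_trans (green_bound _ _ _ _ _ _) etag.
- move=> i; apply: le_trans (green_bound _ _ _ _ _ _) etag => //; exact: locB_herm.
- move=> i; have hi := leq_bigmax (F := fun i => (bdist (blockof (x i)) b + bdist (blockof (y i)) b)%N) i.
  have hi' : (bdist (blockof (x i)) b)%:R + (bdist (blockof (y i)) b)%:R < r0.
    by rewrite -natrD; apply: le_lt_trans h; rewrite ler_nat.
  have p1 : 0 <= (bdist (blockof (x i)) b)%:R :> R by [].
  have p2 : 0 <= (bdist (blockof (y i)) b)%:R :> R by [].
  apply: green_local => //; lra.
Qed.
End LocalError.

(** * Concentration of the localised observables *)

Lemma measurable_gt (R : realType) (d : measure_display) (T : measurableType d)
    (f : T -> R) (a : R) :
  measurable_fun setT f -> measurable [set w | a < f w].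
Proof.
move=> mf; rewrite (_ : [set w | _] = setT `&` f @^-1` `]a, +oo[); last first.
  by rewrite setTI predeqE => w /=; rewrite in_itv /= andbT.
exact: mf.
Qed.

(** Bound the difference by e outside bad and by 2M on bad, and integrate. *)
Lemma expectation_close (R : realType) (d : measure_display) (T : measurableType d)
    (P : probability T R) (f g : T -> R) (bad : set T) (M e p : R) :
  measurable_fun setT f -> measurable_fun setT g -> measurable bad ->
  (forall w, `|f w| <= M) -> (forall w, `|g w| <= M) -> 0 <= e ->
  (forall w, ~ bad w -> `|f w - g w| <= e) -> (P bad <= p%:E)%E ->
  `|fine ('E_P[f])%E - fine ('E_P[g])%E| <= e + 2 * M * p.
Proof.
move=> mf mg mbad fM gM e0 fg Pp.
have [Ef _] := expectation_bounded P mf fM.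
have [Eg _] := expectation_bounded P mg gM.
have if_ := bounded_integrable P mf fM.
have ig := bounded_integrable P mg gM.
have T0 : T by exact: point.
have M0 : 0 <= M by exact: le_trans (normr_ge0 _) (fM T0).
have mh : measurable_fun setT (fun w => f w - g w) by exact: measurable_funB.
have E1 : ((fine 'E_P[f] - fine 'E_P[g])%:E = \int[P]_w (f w - g w)%:E)%E.
  rewrite EFinB -Ef -Eg !unlock -integralB//.
rewrite -lee_fin -[leLHS]/(`|(fine 'E_P[f] - fine 'E_P[g])%:E|)%E E1.
apply: (le_trans (le_abse_integral _ _ _)) => //; first exact/measurable_EFinP.
apply: (@le_trans _ _ (\int[P]_w (e%:E + (2 * M)%:E * (\1_bad w)%:E))%E).
  apply: ge0_le_integral => //=.
  - exact/measurable_EFinP/measurableT_comp.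
  - by apply: emeasurable_funD => //; apply: emeasurable_funM => //; apply/measurable_EFinP.
  - move=> w _; rewrite -EFinM -EFinD lee_fin indicE.
    have [wb|wb] := boolP (w \in bad).
      rewrite mulr1 (le_trans (ler_normB _ _))// -[leLHS]add0r lerD//.
      by rewrite mulr_natl mulr2n lerD.
    by rewrite mulr0 addr0 fg// => h; move/negP: wb; apply; rewrite inE.
rewrite ge0_integralD//; last 2 first.
- by move=> w _; rewrite -EFinM lee_fin !mulr_ge0.
- by apply: emeasurable_funM => //; apply/measurable_EFinP.
rewrite integral_prob_cst ge0_integralZl//; last 2 first.
- exact/measurable_EFinP.
- by rewrite lee_fin mulr_ge0.
rewrite integral_indic// setIT EFinD (EFinM (2 * M) p); apply: leeD => //.
by apply: lee_wpmul2l => //; rewrite lee_fin mulr_ge0.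
Qed.

Section Core.
Context (R : realType) (d : measure_display) (T : measurableType d)
  (P : probability T R) (W L : nat)
  (B : site W L -> site W L -> R -> T -> R[i]) (E s : R)
  (u : nat) (sg : 'I_u -> bool)
  (coef : block L -> {ffun 'I_u -> site W L} -> {ffun 'I_u -> site W L} -> R[i])
  (r0 g K rho k0 beta0 pr : R).
Hypothesis hBM : hermitian_BM P B.
Hypothesis s0 : 0 <= s.
Hypothesis eta0 : 0 < eta E s.
Hypotheses (r00 : 0 < r0) (g1 : 1 <= g) (etag : (eta E s)^-1 <= g)
  (K0 : 0 <= K) (rho0 : 0 <= rho) (beta00 : 0 < beta0) (k00 : 0 <= k0).
Hypothesis coefb : forall b x y, nrm (coef b x y) <= k0.
Hypothesis csupp : forall (b : block L) (x y : {ffun 'I_u -> site W L}),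
  r0 <= (\max_(i < u) (bdist (blockof (x i)) b + bdist (blockof (y i)) b))%N%:R ->
  coef b x y = 0.

Let N : R := (Nsize W L)%:R.
Let Y := Ysum sg B E s coef.
Let xi p := bm_coord B p s.

(** Outside this event the observable has its typical size, the resolvent is small
    at distance r0, and the matrix entries are bounded. *)
Definition bad_event : set T :=
  [set w | exists b, beta0 < nrm (Y b w)] `|`
  [set w | exists pq : site W L * site W L,
     r0 <= (bdist (blockof pq.1) (blockof pq.2))%:R /\
     rho < nrm (fentry (green B E s true w) pq.1 pq.2)] `|`
  [set w | exists p, K < `|xi p w|].

Let Bherm x y w : B y x s w = (B x y s w)^*.
Proof. by case: hBM => h _ _; exact: h. Qed.

Let mxi p : measurable_fun setT (xi p).
Proof. exact: (bm_coord_measurable hBM s0). Qed.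

Let mB x y : cmeasurable (B x y s).
Proof. exact: (entry_measurable Bherm (mxi (x, y)) (mxi (y, x))). Qed.

Lemma Ysum_cmeasurable b : cmeasurable (Y b).
Proof. exact: Ysum_measurable. Qed.

Lemma green_far_measurable (pq : site W L * site W L) :
  measurable [set w | r0 <= (bdist (blockof pq.1) (blockof pq.2))%:R /\
     rho < nrm (fentry (green B E s true w) pq.1 pq.2)].
Proof.
have [h|h] := lerP r0 (bdist (blockof pq.1) (blockof pq.2))%:R; last first.
  by rewrite (_ : [set w | _] = set0)// predeqE => w; split=> //= -[].
rewrite (_ : [set w | _] =
    [set w | rho < nrm (fentry (green B E s true w) pq.1 pq.2)]); last first.
  by rewrite predeqE => w; split=> [[]|].
by apply: measurable_gt; apply: measurable_nrm; exact: green_measurable.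
Qed.

Lemma bad_event_measurable : measurable bad_event.
Proof.
apply: measurableU; first apply: measurableU.
- apply: measurable_exists => b; apply: measurable_gt; apply: measurable_nrm.
  exact: Ysum_cmeasurable.
- by apply: measurable_exists => pq; exact: green_far_measurable.
- by apply: measurable_exists => p; apply: measurable_gt; exact: measurableT_comp.
Qed.

Hypothesis hbad : (P bad_event <= pr%:E)%E.

Let err := N ^+ (2 * u) * (k0 * (u%:R * g ^+ u * (N ^+ 2 * (g * (2 * K) * rho)))).
Let Bd := N ^+ (2 * u) * (k0 * g ^+ u).
Let beta := beta0 + err.

Let err0 : 0 <= err.
Proof.
have g0 : 0 <= g by exact: le_trans g1.
by rewrite /err !mulr_ge0 ?exprn_ge0.
Qed.

Let Y' b := Ysum sg (locB B (nbhd r0 b)) E s coef b.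

(** Real and imaginary parts are indexed by a boolean, so that the four products
    in the sum of Z_b (Y_b - E Y_b) can be treated at once. *)
Definition part (c : bool) (z : R[i]) : R := if c then complex.Re z else complex.Im z.

Lemma part_le c z : `|part c z| <= nrm z.
Proof. by case: c; [exact: normr_Re_le|exact: normr_Im_le]. Qed.

Lemma partB c y z : part c (y - z) = part c y - part c z.
Proof. by case: c; case: y => a1 b1; case: z. Qed.

(** The truncation provides the uniform bound needed for the Chernoff estimate. *)
Definition Xloc (c : bool) (b : block L) (w : T) : R :=
  if nrm (Y' b w) <= beta then part c (Y' b w) else 0.

Lemma Xloc_measurable c b : measurable_fun setT
  (Xloc c b : g_sigma_algebraType (cyl xi (coords W (nbhd r0 b))) -> R).
Proof.
have mY : @cmeasurable R _ (g_sigma_algebraType (cyl xi (coords W (nbhd r0 b)))) (Y' b).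
  exact: locYsum_measurable.
have mp : measurable_fun setT (fun w : g_sigma_algebraType (cyl xi (coords W (nbhd r0 b))) =>
    part c (Y' b w)) by case: mY => m1 m2; case: (c).
apply: measurable_fun_ifT => //.
by apply: measurable_fun_ler => //; exact: measurable_nrm.
Qed.

Lemma good_local w b : ~ bad_event w ->
  nrm (Y b w - Y' b w) <= err /\ nrm (Y' b w) <= beta.
Proof.
move=> hw.
have hloc : nrm (Y b w - Y' b w) <= err.
  apply: Ysum_local => //.
    move=> p q; apply: entry_bound => // j; rewrite leNgt; apply/negP => h.
    by apply: hw; right; exists j.
  move=> p q hpq; rewrite leNgt; apply/negP => h.
  by apply: hw; left; right; exists (p, q).
split=> //; have -> : Y' b w = Y b w + - (Y b w - Y' b w) by rewrite opprB addrC subrK.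
apply: (le_trans (nrmD _ _)); rewrite nrmN; apply: lerD => //.
by rewrite leNgt; apply/negP => h; apply: hw; left; left; exists b.
Qed.

Lemma Xloc_close c b w : ~ bad_event w -> `|Xloc c b w - part c (Y b w)| <= err.
Proof.
move=> hw; have [h1 h2] := good_local b hw.
by rewrite /Xloc h2 -partB (le_trans (part_le _ _))// -nrmN opprB.
Qed.

(** Outside the bad event the two variables are close; on it, the bound Bd of both
    is multiplied by the small probability pr. *)
Lemma Xloc_expectation c b :
  `|fine ('E_P[Xloc c b])%E - fine ('E_P[fun w => part c (Y b w)])%E| <= err + 2 * Bd * pr.
Proof.
have mY := Ysum_cmeasurable b.
have mp : measurable_fun setT (fun w => part c (Y b w)).
  by case: mY => m1 m2; case: (c).
apply: (expectation_close _ mp bad_event_measurable) => //.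
- exact: (cyl_fun_measurable mxi (@Xloc_measurable c b)).
- move=> w; rewrite /Xloc; case: ifP => _.
    apply: (le_trans (part_le _ _)); apply: Ysum_bound => //; exact: locB_herm.
  by rewrite normr0 mulr_ge0 ?exprn_ge0// mulr_ge0 ?exprn_ge0// (le_trans _ g1).
- by move=> w; apply: (le_trans (part_le _ _)); exact: Ysum_bound.
- by move=> w hw; exact: Xloc_close.
Qed.
Let D c b w := part c (Y b w) - fine ('E_P[fun w' => part c (Y b w')])%E.

Section Tail.
Variables (q : nat) (x : R).
Hypotheses (q0 : (0 < q)%N) (q4 : 4 * r0 <= q%:R) (x0 : 0 <= x).

(** Apply the concentration bound to the truncated localisations.  The colouring
    with period q >= 4 r0 makes the balls of equally coloured blocks disjoint. *)
Lemma part_tail (c : bool) (z : block L -> R) (v : R) :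
  0 < v -> \sum_b z b ^+ 2 <= v ^+ 2 ->
  exists Ev : set T, [/\ measurable Ev,
    (P Ev <= ((2 * q%:R) ^+ 2 * (2 * expR (2^-1 - x / 2)))%:E)%E &
    forall w, ~ bad_event w -> ~ Ev w ->
      `|\sum_b z b * D c b w| <=
        4 * x * q%:R * beta * v + (\sum_b `|z b|) * (2 * err + 2 * Bd * pr)].
Proof.
move=> v0 zv.
have beta0' : 0 < beta by rewrite ltr_pwDl.
pose Ev := [set w | 2 * x * beta * (2 * q%:R) * v <
  `|\sum_b z b * (Xloc c b w - fine ('E_P[Xloc c b])%E)|].
exists Ev; split.
- apply: measurable_gt; apply: measurableT_comp => //; apply: measurable_sum => b.
  apply: measurable_funM => //; apply: measurable_funB => //.
  exact: (cyl_fun_measurable mxi (@Xloc_measurable c b)).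
- apply: (coloured_concentration mxi (bm_coord_indep hBM s0) (col := colour q0)
    (G := fun b => coords W (nbhd r0 b))) => //.
  + by move=> b; exact: Xloc_measurable.
  + move=> b b' hb bb'; apply: coords_disjoint; apply: nbhd_disjoint.
    by rewrite (le_trans q4)// ler_nat; exact: colour_sep hb bb'.
  + move=> b w; rewrite /Xloc; case: ifP => [h|_]; last by rewrite normr0 ltW.
    exact: le_trans (part_le _ _) h.
  + by rewrite mulr_gt0 ?ltr0n.
  + by rewrite card_prod !card_ord natrM natrM expr2.
- move=> w hw hE.
  have hE' : `|\sum_b z b * (Xloc c b w - fine ('E_P[Xloc c b])%E)| <=
     2 * x * beta * (2 * q%:R) * v by rewrite leNgt; apply/negP.
  have -> : \sum_b z b * D c b w = \sum_b z b * (Xloc c b w - fine ('E_P[Xloc c b])%E)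
      - \sum_b z b * ((Xloc c b w - part c (Y b w)) -
         (fine ('E_P[Xloc c b])%E - fine ('E_P[fun w' => part c (Y b w')])%E)).
    by rewrite -sumrB; apply: eq_bigr => b _; rewrite /D; ring.
  apply: (le_trans (ler_normB _ _)); apply: lerD.
    by apply: (le_trans hE'); rewrite le_eqVlt; apply/orP; left; apply/eqP; ring.
  apply: (le_trans (ler_norm_sum _ _ _)); rewrite mulr_suml; apply: ler_sum => b _.
  rewrite normrM ler_wpM2l// (le_trans (ler_normB _ _))//.
  have h1 := Xloc_close c b hw; have h2 := Xloc_expectation c b.
  lra.
Qed.

Lemma complex_sum_le (Z : block L -> R[i]) w (M : R) :
  (forall c c', `|\sum_b part c' (Z b) * D c b w| <= M) ->
  nrm (\sum_b Z b * (Y b w - cexpect P (Y b))) <= 4 * M.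
Proof.
move=> hM; apply: (le_trans (nrm_le_ReIm _)); rewrite cRe_sum cIm_sum.
have -> : \sum_b complex.Re (Z b * (Y b w - cexpect P (Y b))) =
    \sum_b part true (Z b) * D true b w - \sum_b part false (Z b) * D false b w.
  rewrite -sumrB; apply: eq_bigr => b _; rewrite cReM /D /cexpect /part.
  by case: (Y b w) => ? ? /=; case: (Z b).
have -> : \sum_b complex.Im (Z b * (Y b w - cexpect P (Y b))) =
    \sum_b part true (Z b) * D false b w + \sum_b part false (Z b) * D true b w.
  rewrite -big_split; apply: eq_bigr => b _; rewrite cImM /D /cexpect /part.
  by case: (Y b w) => ? ? /=; case: (Z b).
have h1 := hM true true; have h2 := hM false false.
have h3 := hM true false; have h4 := hM false true.
apply: (@le_trans _ _ (M + M + (M + M))); last by lra.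
apply: lerD; first by apply: (le_trans (ler_normB _ _)); apply: lerD.
by apply: (le_trans (ler_normD _ _)); apply: lerD.
Qed.

Lemma sum_deviation_measurable (Z : block L -> R[i]) (M : R) :
  measurable [set w | M < nrm (\sum_b Z b * (Y b w - cexpect P (Y b)))].
Proof.
apply: measurable_gt; apply: measurable_nrm; apply: cmeasurable_sum => b _.
apply: cmeasurableM; first exact: cmeasurable_cst.
by apply: cmeasurableB; [exact: Ysum_cmeasurable|exact: cmeasurable_cst].
Qed.

(** A union bound over the rows of Z and the four combinations of real and
    imaginary parts. *)
Lemma local_concentration (Z : block L -> block L -> R[i]) (v : block L -> R) :
  (forall a, 0 <= v a) -> (forall a, \sum_b nrm (Z a b) ^+ 2 <= v a ^+ 2) ->
  (P [set w | exists a, (4 * (4 * x * q%:R * beta * v a +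
        (\sum_b nrm (Z a b)) * (2 * err + 2 * Bd * pr)) <
        nrm (\sum_b Z a b * (Y b w - cexpect P (Y b))))%R] <=
   (pr + #|{: block L * (bool * bool)}|%:R *
      ((2 * q%:R) ^+ 2 * (2 * expR (2^-1 - x / 2))))%:E)%E.
Proof.
move=> v0 Zv.
have beta0' : 0 < beta by rewrite ltr_pwDl.
have Bd0 : 0 <= Bd.
  by rewrite mulr_ge0 ?exprn_ge0// mulr_ge0 ?exprn_ge0// (le_trans _ g1).
have pr0 : 0 <= pr by rewrite -lee_fin; apply: le_trans hbad.
(* a row with v = 0 vanishes; it gets the dummy value 1 to keep v' positive *)
pose v' a := if v a == 0 then 1 else v a.
have v'0 a : 0 < v' a by rewrite /v'; case: eqP => // /eqP h; rewrite lt_def h v0.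
have Zc (a : block L) (c : bool) : \sum_b part c (Z a b) ^+ 2 <= v a ^+ 2.
  apply: le_trans (Zv a); apply: ler_sum => b _.
  by rewrite -(real_normK (num_real _)) lerXn2r ?nnegrE ?nrm_ge0 ?part_le.
have Zc' (a : block L) c : \sum_b part c (Z a b) ^+ 2 <= v' a ^+ 2.
  apply: le_trans (Zc a c) _; rewrite lerXn2r ?nnegrE ?v0 ?(ltW (v'0 a))//.
  by rewrite /v'; case: eqP => // ->.
pose Ev i := sval (cid (part_tail i.2.1 (v'0 i.1) (Zc' i.1 i.2.2))).
have hEv i : [/\ measurable (Ev i),
    (P (Ev i) <= ((2 * q%:R) ^+ 2 * (2 * expR (2^-1 - x / 2)))%:E)%E &
    forall w, ~ bad_event w -> ~ Ev i w ->
      `|\sum_b part i.2.2 (Z i.1 b) * D i.2.1 b w| <=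
        4 * x * q%:R * beta * v' i.1 +
        (\sum_b `|part i.2.2 (Z i.1 b)|) * (2 * err + 2 * Bd * pr)].
  exact: (svalP (cid (part_tail i.2.1 (v'0 i.1) (Zc' i.1 i.2.2)))).
apply: (@le_trans _ _ (P (bad_event `|` [set w | exists i, Ev i w]))); last first.
  apply: (le_trans (measureU2 _ _ _)).
  - exact: bad_event_measurable.
  - by apply: measurable_exists => i; case: (hEv i).
  rewrite EFinD; apply: leeD => //.
  by apply: prob_exists_le => i; case: (hEv i).
apply: le_measure; rewrite ?inE.
- by apply: measurable_exists => a; exact: sum_deviation_measurable.
- apply: measurableU; first exact: bad_event_measurable.
  by apply: measurable_exists => i; case: (hEv i).
move=> w [a ha]; apply: contrapT => hn.
have hb : ~ bad_event w by move=> h; apply: hn; left.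
move: ha; apply/negP; rewrite -leNgt.
set S := \sum_b nrm (Z a b).
have S0 : 0 <= S by rewrite sumr_ge0// => b _; rewrite nrm_ge0.
have e20 : 0 <= 2 * err + 2 * Bd * pr by apply: addr_ge0; [exact: mulr_ge0|apply: mulr_ge0 => //; exact: mulr_ge0].
have rhs0 : 0 <= S * (2 * err + 2 * Bd * pr) by rewrite mulr_ge0.
have [va|va] := eqVneq (v a) 0.
  have Z0 b : Z a b = 0.
    apply: Normc.eq0_normc; apply/eqP; rewrite -sqrf_eq0; apply/eqP/le_anti.
    rewrite sqr_ge0 andbT -[leRHS](expr0n _ 2) -va; apply: le_trans (Zv a).
    by rewrite (bigD1 b)//= lerDl sumr_ge0// => i _; rewrite sqr_ge0.
  rewrite big1 ?nrm0; last by move=> b _; rewrite Z0 mul0r.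
  by rewrite va mulr0 add0r mulr_ge0.
apply: complex_sum_le => c c'.
have [_ _ /(_ w hb) h] := hEv (a, (c, c')).
have nE : ~ Ev (a, (c, c')) w by move=> hE; apply: hn; right; exists (a, (c, c')).
apply: (le_trans (h nE)).
rewrite /v' /= (negPf va) lerD2l ler_wpM2r//.
by apply: ler_sum => b _; exact: part_le.
Qed.
End Tail.
End Core.

(** * Comparison of powers, exponentials and logarithms *)

Section Asymptotics.
Context (R : realType).
Implicit Types (a b c D k M : R).

Lemma powR_addl (x a b : R) : 0 < x -> x `^ a * x `^ b = x `^ (a + b).
Proof. by move=> x0; rewrite powRD ?(gt_eqF x0) ?implybT. Qed.

Lemma near_powR_ge M a : 0 < a -> \forall m \near \oo, M <= m%:R `^ a.
Proof.
move=> a0; pose y := Num.max M 1; have y1 : 1 <= y by rewrite le_max lexx orbT.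
near=> m.
apply: (@le_trans _ _ y); first by rewrite le_max lexx.
have -> : y = (y `^ a^-1) `^ a by rewrite -powRrM mulVf ?gt_eqF// powRr1// (le_trans _ y1).
apply: ge0_ler_powR; rewrite ?nnegrE ?powR_ge0//; first exact: ltW.
near: m; exact: nbhs_infty_ger.
Unshelve. all: by end_near. Qed.

Lemma ln_le_powR a (x : R) : 0 < a -> 0 < x -> ln x <= a^-1 * x `^ a.
Proof.
move=> a0 x0; rewrite ler_pdivlMl//.
have -> : a * ln x = ln (x `^ a) by rewrite ln_powR.
have xa : 0 < x `^ a by exact: powR_gt0.
have := le_ln1Dx (x := x `^ a - 1); rewrite ltrBrDr addrC subrr => /(_ xa).
rewrite addrC subrK; lra.
Qed.

(** Taking logarithms, D ln m is dominated by k m^a because ln m is at most a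
    constant times m^(a/2). *)
Lemma near_expR_le k a D : 0 < k -> 0 < a ->
  \forall m \near \oo, expR (- (k * m%:R `^ a)) <= m%:R `^ (- D).
Proof.
move=> k0 a0; have a2 : 0 < a / 2 by rewrite divr_gt0.
near=> m.
have m0 : 0 < m%:R :> R by near: m; exact: nbhs_infty_gtr.
rewrite /powR gt_eqF// ler_expR mulNr lerN2.
have [D0|D0] := lerP D 0.
  apply: (@le_trans _ _ 0); last by rewrite mulr_ge0 ?expR_ge0// ltW.
  by rewrite mulr_le0_ge0// ln_ge0// ler1n -(ltr0n R).
apply: (@le_trans _ _ (D * ((a / 2)^-1 * m%:R `^ (a / 2)))).
  by rewrite ler_wpM2l ?(ltW D0)// ln_le_powR.
have -> : expR (a * ln m%:R) = m%:R `^ (a / 2) * m%:R `^ (a / 2).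
  by rewrite powR_addl// -splitr /powR gt_eqF.
rewrite !mulrA ler_wpM2r ?powR_ge0// -ler_pdivrMl//.
near: m; exact: (near_powR_ge _ a2).
Unshelve. all: by end_near. Qed.

Lemma near_ln_sqr_le a : 0 < a ->
  \forall m \near \oo, (4 * (1 + ln m%:R)) ^+ 2 <= m%:R `^ a.
Proof.
move=> a0; have a4 : 0 < a / 4 by rewrite divr_gt0.
near=> m.
have m1 : 1 <= m%:R :> R by near: m; exact: nbhs_infty_ger.
have m0 : 0 < m%:R :> R by exact: lt_le_trans m1.
have y1 : 1 <= m%:R `^ (a / 4) by near: m; exact: (near_powR_ge _ a4).
have yb : 4 + 4 * (a / 4)^-1 <= m%:R `^ (a / 4) by near: m; exact: (near_powR_ge _ a4).
set y := m%:R `^ (a / 4) in y1 yb *.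
have -> : m%:R `^ a = (y * y) ^+ 2.
  by rewrite expr2 /y !powR_addl//; congr (_ `^ _); field.
have l0 : 0 <= ln m%:R :> R by rewrite ln_ge0// ler1n -(ltr0n R).
have ll : ln m%:R <= (a / 4)^-1 * y by exact: ln_le_powR.
rewrite lerXn2r ?nnegrE ?mulr_ge0 ?addr_ge0 ?(le_trans _ y1)//.
apply: (@le_trans _ _ ((4 + 4 * (a / 4)^-1) * y)); last by rewrite ler_wpM2r// (le_trans _ y1).
rewrite mulrDr mulr1 [leRHS]mulrDl -[X in _ <= _ + X]mulrA; apply: lerD; first by rewrite ler_peMr.
by rewrite ler_wpM2l.
Unshelve. all: by end_near. Qed.

(** The sizes N_n need not be monotone in n; the asymptotic statements
    below are therefore eventual in the value m of N_n, uniformly in n. *)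
Lemma near_nat_exists (N : nat -> nat) (Q : nat -> Prop) :
  (\forall m \near \oo, forall n, N n = m -> Q n) ->
  exists N0 : nat, forall n, (N0 <= N n)%N -> Q n.
Proof. by move=> [N0 _ h]; exists N0 => n hn; exact: (h (N n)). Qed.
End Asymptotics.

(** * The loop bound and the sizes of the scales *)

(** With the sign - being the adjoint, the loop is a sum of the nonnegative terms
    W^-4 |G_ij|^2 over the two blocks; keep one of them. *)
Lemma green_sqr_le_Lloop (R : realType) (T : Type) (W L : nat)
    (B : site W L -> site W L -> R -> T -> R[i]) (E t : R) w (x y : site W L) :
  (0 < W)%N ->
  nrm (fentry (green B E t true w) x y) ^+ 2 <=
    W%:R ^+ 4 * nrm (Lloop B E t (blockof y) (blockof x) w).
Proof.
move=> W0; set a := blockof y; set b := blockof x.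
pose G := green B E t true w.
pose e (c : block L) (i : 'I_#|{: site W L}|) : R :=
  if blockof (enum_val i) == c then W%:R ^- 2 else 0.
have e0 c i : 0 <= e c i by rewrite /e; case: ifP => // _; rewrite invr_ge0 exprn_ge0.
have EE c : Eblk R W c = diag_mx (\row_i (e c i)%:C).
  apply/matrixP => i j; rewrite !mxE (inj_eq enum_val_inj) /e.
  case: eqP => [->|] /=; last by rewrite mulr0n.
  rewrite mulr1n; case: ifP => // _.
  by rewrite fmorphV rmorphXn /= rmorph_nat.
have LE : Lloop B E t a b w =
    (\sum_i \sum_j e b i * e a j * nrm (G i j) ^+ 2)%:C.
  rewrite /Lloop /mxtrace rmorph_sum; apply: eq_bigr => i _.
  rewrite !EE mul_mx_diag mxE [(\row_ _ _) _ _]mxE mxE rmorph_sum mulr_suml.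
  apply: eq_bigr => j _.
  rewrite -/G mul_mx_diag mxE [(\row_ _ _) _ _]mxE /green mxE.
  rewrite -[invmx _]/G [G i j * _ * _]mulrAC mulCC -!rmorphM /=; congr (_%:C); ring.
rewrite LE nrm_real ger0_norm; last first.
  by apply: sumr_ge0 => i _; apply: sumr_ge0 => j _; rewrite !mulr_ge0 ?exprn_ge0 ?nrm_ge0.
rewrite (bigD1 (enum_rank x))//= (bigD1 (enum_rank y))//=.
have Wp : 0 < W%:R :> R by rewrite ltr0n.
have -> : e b (enum_rank x) = W%:R ^- 2 by rewrite /e enum_rankK eqxx.
have -> : e a (enum_rank y) = W%:R ^- 2 by rewrite /e enum_rankK eqxx.
rewrite -/G /fentry -addrA mulrDr.
have -> : W%:R ^+ 4 * (W%:R ^- 2 * W%:R ^- 2 * nrm (G (enum_rank x) (enum_rank y)) ^+ 2) =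
  nrm (G (enum_rank x) (enum_rank y)) ^+ 2 by field; rewrite gt_eqF.
rewrite lerDl mulr_ge0 ?exprn_ge0// addr_ge0//.
  by apply: sumr_ge0 => j _; rewrite !mulr_ge0 ?exprn_ge0 ?nrm_ge0// invr_ge0 exprn_ge0.
apply: sumr_ge0 => i _; apply: sumr_ge0 => j _.
by rewrite !mulr_ge0 ?exprn_ge0 ?nrm_ge0.
Qed.

Section Scales.
Context (R : realType) (W L : nat).
Hypotheses (W1 : (1 <= W)%N) (L3 : (3 <= L)%N).
Let x : R := (Nsize W L)%:R.

Lemma Nsize_ge9 : (9 <= Nsize W L)%N.
Proof.
have hL : (9 <= L ^ 2)%N by rewrite (leq_sqr 3).
have hW : (1 <= W ^ 2)%N by rewrite expn_gt0 W1.
by rewrite /Nsize; apply: leq_trans hL _; rewrite leq_pmull.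
Qed.

Lemma Nsize_gtL : (L.+1 <= Nsize W L)%N.
Proof.
have hW : (1 <= W ^ 2)%N by rewrite expn_gt0 W1.
apply: (@leq_trans (L ^ 2)); last by rewrite leq_pmull.
nia.
Qed.

Lemma Nsize_geW : (W <= Nsize W L)%N.
Proof.
have hL : (1 <= L ^ 2)%N by rewrite expn_gt0 (ltn_trans _ L3).
apply: (@leq_trans (W ^ 2)); last by rewrite leq_pmulr.
nia.
Qed.

Lemma card_block_le : (#|{: block L}| <= Nsize W L)%N.
Proof.
rewrite card_prod !card_ord /Nsize mulnn leq_pmull// expn_gt0 W1//.
Qed.

Lemma etaE (E t : R) : eta E t = (1 - t) * (Num.sqrt (4 - E ^+ 2) / 2).
Proof. by rewrite /eta /zt /msc /=; ring. Qed.

Variables (kappa delta E s : R).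
Hypotheses (kappa0 : 0 < kappa) (delta0 : 0 < delta).
Hypothesis Eb : `|E| <= 2 - kappa.
Hypothesis sb : 0 <= s <= 1 - x `^ (-1 + delta).

Let x1 : 1 <= x. Proof. by rewrite /x ler1n (leq_trans _ Nsize_ge9). Qed.
Let x0 : 0 < x. Proof. exact: lt_le_trans x1. Qed.

Lemma time_gap : x^-1 <= 1 - s.
Proof.
have /andP[_ h] := sb.
have : x `^ (-1) <= x `^ (-1 + delta) by rewrite ler_powR// lerDl ltW.
rewrite powR_inv1 ?(ltW x0)// => /le_trans; apply.
by rewrite lerBrDr addrC -lerBrDr.
Qed.

Lemma time_lt1 : s < 1.
Proof. by rewrite -subr_gt0; apply: lt_le_trans time_gap; rewrite invr_gt0. Qed.

Lemma inv_time_gap : (1 - s)^-1 <= x.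
Proof.
rewrite -[leRHS]invrK lef_pV2 ?posrE ?invr_gt0 ?subr_gt0 ?time_lt1//; exact: time_gap.
Qed.

Lemma eta_gt0 : 0 < eta E s.
Proof.
rewrite etaE mulr_gt0 ?subr_gt0 ?time_lt1// divr_gt0// sqrtr_gt0.
move: Eb; rewrite ler_norml => /andP[h1 h2]; have := kappa0; nra.
Qed.

Lemma inv_eta_le : (eta E s)^-1 <= x * (2 / Num.sqrt (2 * kappa)).
Proof.
have k2 : 0 < Num.sqrt (2 * kappa) by rewrite sqrtr_gt0 mulr_gt0.
have hk : Num.sqrt (2 * kappa) <= Num.sqrt (4 - E ^+ 2).
  apply: ler_wsqrtr; move: Eb; rewrite ler_norml => /andP[h1 h2]; have := kappa0; nra.
rewrite etaE invfM; apply: ler_pM; rewrite ?invr_ge0.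
- by rewrite subr_ge0 ltW// time_lt1.
- by rewrite divr_ge0.
- exact: inv_time_gap.
- by rewrite invf_div ler_pM2l// lef_pV2// ?posrE// (lt_le_trans k2).
Qed.

Lemma eta_ratio_le (s' : R) : 0 <= s' <= s -> eta E s' / eta E s <= x.
Proof.
move=> /andP[h1 h2]; have := eta_gt0; rewrite !etaE => e0.
have m0 : Num.sqrt (4 - E ^+ 2) / 2 != 0.
  by apply: contraTneq e0 => ->; rewrite mulr0 ltxx.
rewrite invfM mulrACA divff// mulr1.
apply: (@le_trans _ _ (1 * (1 - s)^-1)); last by rewrite mul1r inv_time_gap.
rewrite ler_wpM2r ?invr_ge0 ?subr_ge0 ?(ltW time_lt1)//; lra.
Qed.

Lemma ell_ge1 (t : R) : 0 <= t -> t < 1 -> 1 <= ell L t.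
Proof.
move=> t0 t1; rewrite /ell le_min ler1n (leq_trans _ L3)// andbT.
rewrite -[leLHS]invr1 lef_pV2 ?posrE ?sqrtr_gt0 ?subr_gt0//.
by rewrite -[leRHS]sqrtr1 ler_wsqrtr//; lra.
Qed.

Lemma ell_leL (t : R) : ell L t <= L%:R.
Proof. by rewrite /ell ge_min lexx orbT. Qed.

Lemma Mt_inv_sqr_le : (Mt W L E s) ^- 2 <= (eta E s)^-1 ^+ 2.
Proof.
have e0 := eta_gt0; have /andP[s0 _] := sb.
have l1 : 1 <= ell L s by apply: ell_ge1 => //; exact: time_lt1.
have M1 : eta E s <= Mt W L E s.
  rewrite /Mt ler_peMl ?(ltW e0)// -[leLHS]mulr1.
  by apply: ler_pM => //; rewrite exprn_ege1// ler1n.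
rewrite -exprVn lerXn2r ?nnegrE ?invr_ge0 ?(ltW e0)//.
  by rewrite (le_trans _ M1)// ltW.
by rewrite lef_pV2 ?posrE// (lt_le_trans e0).
Qed.
End Scales.

(** * Smallness of the loop at distances beyond the scale *)

(** If the distance exceeds W^tau ell_s, then ell_s cannot be the cut-off L, because
    all distances are at most L; hence ell_s = (1 - s)^(-1/2), and the exponents in
    the two bounds are at least a power of N. *)
Section FarDecay.
Context (R : realType) (W L : nat) (T : Type)
  (B : site W L -> site W L -> R -> T -> R[i]) (E s s' kappa delta tau c M : R).
Hypotheses (W1 : (1 <= W)%N) (L3 : (3 <= L)%N).
Let x : R := (Nsize W L)%:R.
Hypotheses (kappa0 : 0 < kappa) (delta0 : 0 < delta) (tau0 : 0 < tau) (c0 : 0 < c).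
Hypothesis Eb : `|E| <= 2 - kappa.
Hypothesis sb : 0 <= s <= 1 - x `^ (-1 + delta).
Hypothesis s'b : 0 <= s' <= s.
Hypothesis Wc : x `^ c <= W%:R.
Hypotheses (big1 : 2 <= x `^ (c * tau)) (big2 : 2 / Num.sqrt (2 * kappa) <= x)
  (big3 : expR (- (4^-1 * x `^ (c * tau))) <= x `^ (- M))
  (big4 : expR (- (1 * x `^ (c * tau / 2))) <= x `^ (- M)).
Variables (p q : site W L).
Hypothesis far : W%:R `^ tau * ell L s <= (bdist (blockof p) (blockof q))%:R.

Let x1 : 1 <= x. Proof. by rewrite /x ler1n (leq_trans _ (Nsize_ge9 W1 L3)). Qed.
Let x0 : 0 < x. Proof. exact: lt_le_trans x1. Qed.
Let a := blockof q.
Let b := blockof p.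
Let dd : R := (bdist a b)%:R.

Let Wtau : x `^ (c * tau) <= W%:R `^ tau.
Proof.
rewrite powRrM; apply: ge0_ler_powR; rewrite ?nnegrE ?powR_ge0 ?ler0n//.
exact: ltW.
Qed.

Let ell_local : ell L s = (Num.sqrt (1 - s))^-1.
Proof.
rewrite /ell; case: lerP => // h.
have := far; rewrite /ell (min_idPr (ltW h)) => far'.
have dL : (bdist (blockof p) (blockof q))%:R <= L%:R :> R by rewrite ler_nat bdist_le.
have L0 : 0 < L%:R :> R by rewrite ltr0n (leq_trans _ L3).
have := le_trans far' dL; rewrite ger_pMl// => h1.
by have := le_trans big1 (le_trans Wtau h1); lra.
Qed.

Let sq0 : 0 < Num.sqrt (1 - s).
Proof. by rewrite sqrtr_gt0 subr_gt0; exact: (time_lt1 W1 L3 delta0 sb). Qed.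

Let far_rescaled : x `^ (c * tau) <= Num.sqrt (1 - s) * dd.
Proof.
apply: (le_trans Wtau); rewrite mulrC -ler_pdivrMr// -ell_local /dd bdistC; exact: far.
Qed.

Lemma Kloop_far : `|Kloop W s a b| <= 2 * x * x `^ (- M).
Proof.
have /andP[s0 _] := sb.
have s1 := time_lt1 W1 L3 delta0 sb.
apply: (le_trans (Kloop_decay _ _ _ _)); first by rewrite s0.
apply: (@le_trans _ _ (1 * (2 * x * x `^ (- M)))); last by rewrite mul1r.
apply: ler_pM.
- by rewrite invr_ge0 exprn_ge0.
- by rewrite mulr_ge0 ?expR_ge0// divr_ge0// subr_ge0 ltW.
- by rewrite invf_le1 ?exprn_gt0 ?ltr0n// exprn_ege1// ler1n.
apply: ler_pM; rewrite ?expR_ge0//.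
- by rewrite divr_ge0// subr_ge0 ltW.
- by rewrite ler_pM2l//; exact: (inv_time_gap W1 L3 delta0 sb).
- apply: le_trans big3; rewrite ler_expR lerN2 mulrAC [leRHS]mulrC ler_pM2l//.
Qed.

Lemma loop_error_far :
  (eta E s' / eta E s) ^+ 4 * Mt W L E s ^- 2 *
    expR (- (Num.sqrt (bdist a b)%:R / Num.sqrt (ell L s))) <= x ^+ 8 * x `^ (- M).
Proof.
have e0 := eta_gt0 W1 L3 kappa0 delta0 Eb sb.
have h1 : (eta E s' / eta E s) ^+ 4 <= x ^+ 4.
  have h := eta_ratio_le W1 L3 kappa0 delta0 Eb sb s'b.
  have es' : 0 <= eta E s'.
    rewrite etaE; apply: mulr_ge0; last by rewrite divr_ge0 ?sqrtr_ge0.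
    have /andP[_ h'] := s'b; have := time_lt1 W1 L3 delta0 sb => h2.
    by rewrite subr_ge0 (le_trans h')// ltW.
  by rewrite lerXn2r ?nnegrE ?(ltW x0)// divr_ge0 ?(ltW e0).
have h2 : Mt W L E s ^- 2 <= x ^+ 4.
  apply: (le_trans (Mt_inv_sqr_le W1 L3 kappa0 delta0 Eb sb)).
  rewrite (_ : x ^+ 4 = (x * x) ^+ 2); last by ring.
  rewrite lerXn2r ?nnegrE ?invr_ge0 ?(ltW e0) ?mulr_ge0 ?(ltW x0)//.
  apply: (le_trans (inv_eta_le W1 L3 kappa0 delta0 Eb sb)).
  by rewrite ler_pM2l.
have h3 : expR (- (Num.sqrt (bdist a b)%:R / Num.sqrt (ell L s))) <= x `^ (- M).
  apply: le_trans big4; rewrite ler_expR lerN2 mul1r.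
  rewrite ell_local sqrtrV ?sqrtr_ge0// invrK mulrC -sqrtrM ?sqrtr_ge0//.
  by rewrite [2^-1 * _]mulrC powRrM powR12_sqrt ?powR_ge0// ler_wsqrtr// [leRHS]mulrC; exact: far_rescaled.
have -> : x ^+ 8 = x ^+ 4 * x ^+ 4 by ring.
apply: ler_pM; rewrite ?expR_ge0//.
  by rewrite mulr_ge0 ?invr_ge0 ?sqr_ge0// exprn_even_ge0.
apply: ler_pM => //; first by rewrite exprn_even_ge0.
by rewrite invr_ge0 sqr_ge0.
Qed.
End FarDecay.

(** * The deviation bound with overwhelming probability *)

Lemma bigmax_gtP (R : realType) (I : finType) (F : I -> R) (M : R) : 0 <= M ->
  (M < \big[Num.max/0]_i F i) <-> exists i, M < F i.
Proof.
move=> M0; split=> [h|[i hi]]; last by apply: (lt_le_trans hi); exact: le_bigmax.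
apply: contrapT => hn; move: h; apply/negP; rewrite -leNgt.
by apply: bigmax_le => // i _; rewrite leNgt; apply/negP => h; apply: hn; exists i.
Qed.

(** Here y is N^(e/3), xe is N^e, and t bounds both the localisation error err
    and the contribution bp of the bad event; terms with t are absorbed into z mx. *)
Lemma deviation_arith (R : realType) (x xe y r q v S mx lam err bp t z : R) :
  0 <= x -> 0 <= y -> 0 <= r -> 0 <= v -> 0 <= S -> 0 <= mx -> 0 <= lam ->
  0 <= t -> q <= 5 * r -> 80 * y ^+ 2 <= xe -> 0 <= err <= t -> bp <= t ->
  v <= x * mx -> S <= x * mx -> 160 * (y * r * t * x) <= z -> 32 * (t * x) <= z ->
  4 * (4 * y * q * (y * lam + err) * v + S * (2 * err + 2 * bp)) <=
  xe * (r * lam * v) + z * mx.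
Proof.
move=> x0 y0 r0 v0 S0 mx0 l0 t0 q5 hy /andP[err0 errt] bpt vx Sx hz1 hz2.
have h1 : 4 * y * q * (y * lam + err) * v <= 4 * y * (5 * r) * (y * lam + t) * v.
  apply: ler_wpM2r => //; apply: (@le_trans _ _ (4 * y * (5 * r) * (y * lam + err))).
    by apply: ler_wpM2r; [rewrite addr_ge0// mulr_ge0|apply: ler_wpM2l => //; rewrite mulr_ge0].
  by apply: ler_wpM2l; [rewrite !mulr_ge0|rewrite lerD2l].
have h2 : S * (2 * err + 2 * bp) <= S * (4 * t) by apply: ler_wpM2l => //; lra.
have h3 : S * (4 * t) <= x * mx * (4 * t) by apply: ler_wpM2r => //; rewrite mulr_ge0.
have rl : 0 <= r * lam * v by rewrite !mulr_ge0.
have h4 : 80 * y ^+ 2 * (r * lam * v) <= xe * (r * lam * v) by exact: ler_wpM2r.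
have h5 : 80 * (y * r * t) * v <= 80 * (y * r * t) * (x * mx).
  by apply: ler_wpM2l => //; rewrite !mulr_ge0.
have h6 : 160 * (y * r * t * x) * mx <= z * mx by exact: ler_wpM2r.
have h7 : 32 * (t * x) * mx <= z * mx by exact: ler_wpM2r.
have e1 : 4 * (4 * y * (5 * r) * (y * lam + t) * v) =
  80 * y ^+ 2 * (r * lam * v) + 80 * (y * r * t) * v by ring.
have e2 : 2 * (80 * (y * r * t) * (x * mx)) = 160 * (y * r * t * x) * mx by ring.
have e3 : 8 * (x * mx * (4 * t)) = 32 * (t * x) * mx by ring.
lra.
Qed.

Lemma expR_half_le2 (R : realType) : expR (2^-1) <= 2 :> R.
Proof. by apply: (le_trans (expR_le_quadratic _)) => //; lra. Qed.

Lemma ceil_multiple (R : realType) (r : R) : 1 <= r ->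
  exists q, [/\ (0 < q)%N, 4 * r <= q%:R & q%:R <= 5 * r].
Proof.
move=> r1; exists (Num.trunc (4 * r)).+1; split => //.
  by apply: ltW; exact: Num.Theory.truncnS_gt.
have /Num.Theory.truncn_itv/andP[h _] : 0 <= 4 * r by lra.
by rewrite -[_.+1]addn1 natrD; lra.
Qed.

Section PowerBounds.
Context (R : realType) (x : R).
Hypothesis x1 : 1 <= x.

Let x0 : 0 < x. Proof. exact: lt_le_trans x1. Qed.

Lemma powR_mull (k : R) : x * x `^ k = x `^ (k + 1).
Proof. by rewrite -{1}[x]powRr1 ?(ltW x0)// powR_addl// addrC. Qed.

Lemma ler_mul_powR (a k k' : R) : a <= x -> k + 1 <= k' -> a * x `^ k <= x `^ k'.
Proof.
move=> ax kk; apply: (@le_trans _ _ (x * x `^ k)).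
  by rewrite ler_wpM2r ?powR_ge0.
by rewrite powR_mull ler_powR.
Qed.

Lemma size_bound (u : nat) (C' : R) :
  x ^+ (2 * u) * (x `^ C' * (x ^+ 2) ^+ u) <= x `^ (`|C'| + 4 * u%:R).
Proof.
rewrite -exprM mulrCA -exprD -powR_mulrn ?(ltW x0)// powR_addl//.
by apply: ler_powR => //; rewrite natrD natrM; have := ler_norm C'; lra.
Qed.

Lemma error_bound (u : nat) (C' D1 D4 : R) : 2 <= x -> u%:R <= x ->
  `|C'| + 4 * u%:R + 7 + D4 <= D1 ->
  0 <= x ^+ (2 * u) * (x `^ C' * (u%:R * (x ^+ 2) ^+ u *
    (x ^+ 2 * (x ^+ 2 * (2 * x) * x `^ (- D1))))) <= x `^ (- D4).
Proof.
move=> x2 ux hD; have -> : x ^+ (2 * u) * (x `^ C' * (u%:R * (x ^+ 2) ^+ u *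
    (x ^+ 2 * (x ^+ 2 * (2 * x) * x `^ (- D1))))) = x ^+ (2 * u) * (x `^ C' * (x ^+ 2) ^+ u) *
  (u%:R * 2 * x ^+ 5 * x `^ (- D1)) by ring.
have xn k : 0 <= x ^+ k by rewrite exprn_ge0// ltW.
have b0 : 0 <= x ^+ (2 * u) * (x `^ C' * (x ^+ 2) ^+ u).
  by rewrite !mulr_ge0 ?powR_ge0// exprn_ge0.
have b1 : 0 <= u%:R * 2 * x ^+ 5 * x `^ (- D1).
  by rewrite !mulr_ge0 ?powR_ge0 ?(ltW x0).
apply/andP; split; first by exact: mulr_ge0.
apply: (@le_trans _ _
    (x `^ (`|C'| + 4 * u%:R) * (x * x * x ^+ 5 * x `^ (- D1)))).
  apply: ler_pM => //; first exact: size_bound.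
  by rewrite ler_wpM2r ?powR_ge0// ler_wpM2r// ler_pM.
have -> : x * x * x ^+ 5 = x `^ 7 by rewrite powR_mulrn ?(ltW x0)//; ring.
rewrite !powR_addl//; apply: ler_powR => //; lra.
Qed.

Lemma bad_contribution_bound (u : nat) (C' D2 D4 : R) : 3 <= x ->
  `|C'| + 4 * u%:R + 1 + D4 <= D2 ->
  x ^+ (2 * u) * (x `^ C' * (x ^+ 2) ^+ u) * (3 * x `^ (- D2)) <= x `^ (- D4).
Proof.
move=> x3 hD.
apply: (@le_trans _ _ (x `^ (`|C'| + 4 * u%:R) * (3 * x `^ (- D2)))).
  by rewrite ler_wpM2r ?size_bound// mulr_ge0// powR_ge0.
by rewrite mulrCA powR_addl//; apply: ler_mul_powR => //; lra.
Qed.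

Lemma radius_error_bound (e tau r D0 D4 : R) : 160 <= x -> r <= x `^ (tau + 1) ->
  e + tau + 4 + D0 <= D4 ->
  160 * (x `^ e * r * x `^ (- D4) * x) <= x `^ (- D0).
Proof.
move=> x160 rx hD; apply: (@le_trans _ _ (160 * (x `^ e * x `^ (tau + 1) * x `^ (- D4) * x))).
  rewrite ler_pM2l// ler_wpM2r ?(ltW x0)// ler_wpM2r ?powR_ge0//.
  by rewrite ler_wpM2l ?powR_ge0.
rewrite -[_ * x]mulrC powR_addl// powR_addl// powR_mull; apply: ler_mul_powR => //; lra.
Qed.

Lemma flat_error_bound (D0 D4 : R) : 32 <= x -> D0 + 2 <= D4 ->
  32 * (x `^ (- D4) * x) <= x `^ (- D0).
Proof. by move=> x32 hD; rewrite -[_ * x]mulrC powR_mull; apply: ler_mul_powR => //; lra. Qed.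

Lemma probability_bound (D D2 D5 tau r q card f : R) : 3200 <= x ->
  0 <= r -> r <= x `^ (tau + 1) -> 0 <= q -> q <= 5 * r -> 0 <= card ->
  card <= 4 * x -> 0 <= f -> f <= 2 * x `^ (- D5) ->
  D + 1 <= D2 -> 2 * tau + 4 + D <= D5 ->
  3 * x `^ (- D2) + card * ((2 * q) ^+ 2 * (2 * f)) <= x `^ (- D).
Proof.
move=> x3200 r0 rx q0 q5 c0 cx f0 fx hD2 hD5.
have -> : x `^ (- D) = x `^ (- D) / 2 + x `^ (- D) / 2 by field.
apply: lerD.
  by rewrite ler_pdivlMr// mulrAC; apply: ler_mul_powR; lra.
apply: (@le_trans _ _ (4 * x *
  (100 * (x `^ (tau + 1) * x `^ (tau + 1)) * (2 * (2 * x `^ (- D5)))))).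
  apply: ler_pM => //; first by rewrite !mulr_ge0 ?exprn_ge0 ?mulr_ge0.
  apply: ler_pM => //; rewrite ?exprn_ge0 ?mulr_ge0 ?ler_pM2l//.
  have qx : q <= 5 * x `^ (tau + 1) by apply: (le_trans q5); rewrite ler_pM2l.
  have -> : (2 * q) ^+ 2 = 4 * (q * q) by ring.
  have -> : 100 * (x `^ (tau + 1) * x `^ (tau + 1)) =
    4 * ((5 * x `^ (tau + 1)) * (5 * x `^ (tau + 1))) by ring.
  by rewrite ler_pM2l// ler_pM.
have -> : 4 * x * (100 * (x `^ (tau + 1) * x `^ (tau + 1)) * (2 * (2 * x `^ (- D5)))) =
  1600 * (x * (x `^ (tau + 1) * x `^ (tau + 1)) * x `^ (- D5)) by ring.
rewrite powR_addl// powR_mull powR_addl// ler_pdivlMr// mulrAC.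
have -> : 1600 * 2 = 3200 :> R by ring.
apply: ler_mul_powR => //; lra.
Qed.
End PowerBounds.

Section Sequences.
Context (R : realType) (c kappa delta C' : R) (u : nat) (sg : 'I_u -> bool).
Hypotheses (c0 : 0 < c) (kappa0 : 0 < kappa) (delta0 : 0 < delta).
Context (tau : R) (W L : nat -> nat)
    (d : nat -> measure_display) (T : forall n, measurableType (d n))
    (P : forall n, probability (T n) R)
    (B : forall n, site (W n) (L n) -> site (W n) (L n) -> R -> T n -> R[i])
    (E s s0 Lam : nat -> R)
    (coef : forall n, block (L n) -> {ffun 'I_u -> site (W n) (L n)} ->
              {ffun 'I_u -> site (W n) (L n)} -> R[i]).
Arguments B : clear implicits.
Arguments coef : clear implicits.
Let N n := Nsize (W n) (L n).
Let Y n := Ysum sg (B n) (E n) (s n) (coef n).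
Arguments Y : clear implicits.
Hypothesis tau0 : 0 < tau.
Hypothesis WL : forall n, (1 <= W n)%N /\ (3 <= L n)%N.
Hypothesis Wc : forall n, (N n)%:R `^ c <= (W n)%:R.
Hypothesis hBM : forall n, hermitian_BM (P n) (B n).
Hypothesis Eb : forall n, `|E n| <= 2 - kappa.
Hypothesis sb : forall n, 0 <= s n <= 1 - (N n)%:R `^ (-1 + delta).
Hypothesis s0b : forall n, 0 <= s0 n <= s n.
Hypothesis loop : forall D : R, 0 < D ->
     stoch_dom N P
       (fun n (a : block (L n) * block (L n)) w =>
          Normc.normc (Lloop (B n) (E n) (s n) a.1 a.2 w
                - (Kloop (W n) (s n) a.1 a.2)%:C))
       (fun n a =>
          (eta (E n) (s0 n) / eta (E n) (s n)) ^+ 4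
          * Mt (W n) (L n) (E n) (s n) ^- 2
          * expR (- (Num.sqrt (bdist a.1 a.2)%:R
                     / Num.sqrt (ell (L n) (s n))))
          + (W n)%:R `^ (- D)).

Let W1 n : (1 <= W n)%N. Proof. by case: (WL n). Qed.
Let L3 n : (3 <= L n)%N. Proof. by case: (WL n). Qed.
Let s_ge0 n : 0 <= s n. Proof. by case/andP: (sb n). Qed.
Let e0 n : 0 < eta (E n) (s n). Proof. exact: (eta_gt0 (W1 n) (L3 n) kappa0 delta0 (Eb n) (sb n)). Qed.
Let Bherm n x y w : B n y x (s n) w = (B n x y (s n) w)^*.
Proof. by case: (hBM n) => h _ _; exact: h. Qed.
Let mB n x y : cmeasurable (B n x y (s n)).
Proof.
exact: (entry_measurable (@Bherm n) (bm_coord_measurable (hBM n) (s_ge0 n) (x, y))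
  (bm_coord_measurable (hBM n) (s_ge0 n) (y, x))).
Qed.

(** On the complement of the loop event, |L| <= |L - K| + |K|, and both terms are
    smaller than any power of N; W^4 |L| then bounds |G|^2. *)
Lemma green_far_prob (D1 D : R) : 0 <= D1 -> 0 < D ->
  \forall m \near \oo, forall n, N n = m ->
   (P n [set w | exists pq : site (W n) (L n) * site (W n) (L n),
     ((W n)%:R `^ tau * ell (L n) (s n) <= (bdist (blockof pq.1) (blockof pq.2))%:R /\
     (N n)%:R `^ (- D1) < nrm (fentry (green (B n) (E n) (s n) true w) pq.1 pq.2))%R] <=
    ((N n)%:R `^ (- D))%:E)%E.
Proof.
(* twice D1 for the square of G, and 20 for the powers of N in the other factors;
   division by c turns powers of W into powers of N *)
move=> D10 D0; pose M := 2 * D1 + 20; pose D3 := M / c.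
have M0 : 0 < M by rewrite ltr_wpDl ?mulr_ge0.
have D30 : 0 < D3 by rewrite divr_gt0.
have ct0 : 0 < c * tau by rewrite mulr_gt0.
have ct20 : 0 < c * tau / 2 by rewrite divr_gt0.
have q0 : (0 : R) < 4^-1 by rewrite invr_gt0.
have [N1 hN1] := loop D30 (@ltr01 R) D0.
near=> m.
have b0 : (N1 <= m)%N by near: m; exact: nbhs_infty_ge.
have b1 : 2 <= m%:R `^ (c * tau) by near: m; exact: (near_powR_ge _ ct0).
have b2 : 2 / Num.sqrt (2 * kappa) <= m%:R by near: m; exact: nbhs_infty_ger.
have b3 : expR (- (4^-1 * m%:R `^ (c * tau))) <= m%:R `^ (- M).
  by near: m; have := near_expR_le M q0 ct0.
have b4 : expR (- (1 * m%:R `^ (c * tau / 2))) <= m%:R `^ (- M).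
  by near: m; have := near_expR_le M ltr01 ct20.
have b5 : 4 <= m%:R :> R by near: m; exact: nbhs_infty_ger.
move=> n Nm; rewrite Nm; move: (hN1 n); rewrite Nm => /(_ b0).
have Ksb := sb n; have KWc := Wc n.
rewrite -/(N n) Nm in Ksb KWc.
set ev := (X in (P n X <= _)%E -> _); move=> hev.
have mev : measurable ev.
  apply: measurable_exists => v; apply: measurable_gt; apply: measurableT_comp => //.
  apply: measurable_nrm; apply: cmeasurableB; last exact: cmeasurable_cst.
  exact: (Lloop_measurable (@Bherm n) (e0 n) (@mB n)).
apply: le_trans hev; apply: le_measure; rewrite ?inE//.
  by apply: measurable_exists => pq; exact: (green_far_measurable _ _ (hBM n) (s_ge0 n) (e0 n)).
move=> w [[p q]] /= [hfar hG]; exists (blockof q, blockof p) => /=.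
rewrite ltNge; apply/negP => hle; move: hG; apply/negP; rewrite -leNgt.
set G := fentry _ p q.
pose x : R := m%:R.
have x4 : 4 <= x by [].
have x0 : 0 < x by exact: lt_le_trans x4.
have x1 : 1 <= x by rewrite (le_trans _ x4)// ler1n.
have xM := powR_ge0 x (- M).
have NE : (Nsize (W n) (L n))%:R = x by rewrite -/(N n) Nm.
have h1 : nrm G ^+ 2 <= _ := green_sqr_le_Lloop (B n) (E n) (s n) w p q (W1 n).
have h2 := @Kloop_far _ _ _ (s n) delta tau c M (W1 n) (L3 n) delta0 tau0 (sb n) (Wc n).
rewrite NE in h2; have {}h2 := h2 b1 b3 p q hfar.
have h3 := @loop_error_far _ _ _ (E n) (s n) (s0 n) kappa delta tau c M (W1 n) (L3 n)
  kappa0 delta0 tau0 (Eb n) (sb n) (s0b n) (Wc n).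
rewrite NE in h3; have {}h3 := h3 b1 b2 b4 p q hfar.
have h4 : (W n)%:R `^ (- D3) <= x `^ (- M).
  rewrite !powRN lef_pV2 ?posrE ?powR_gt0 ?ltr0n ?W1//.
  have -> : M = c * D3 by rewrite /D3 mulrC divfK// gt_eqF.
  rewrite powRrM; apply: ge0_ler_powR; rewrite ?nnegrE ?powR_ge0 ?ler0n//.
    exact: ltW.
  by rewrite -(ltr0n R).
rewrite powRr1 ?(ltW x0)// in hle.
rewrite (ger0_norm (nrm_ge0 _)) in hle.
set Lp := Lloop _ _ _ _ _ w in hle h1.
set Kp := Kloop _ _ _ _ in hle h2.
have h5 : nrm Lp <= nrm (Lp - Kp%:C) + `|Kp|.
  by rewrite -nrm_real; apply: le_trans (nrmD _ _); rewrite subrK.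
have h6 : nrm Lp <= x ^+ 10 * x `^ (- M).
  apply: (le_trans h5).
  apply: (@le_trans _ _ (x * (x ^+ 8 * x `^ (- M) + x `^ (- M)) + 2 * x * x `^ (- M))).
    apply: lerD => //; apply: (le_trans hle); rewrite ler_pM2l//.
    exact: (lerD h3 h4).
  have -> : x * (x ^+ 8 * x `^ (- M) + x `^ (- M)) + 2 * x * x `^ (- M) =
     (x ^+ 9 + 3 * x) * x `^ (- M) by ring.
  rewrite ler_wpM2r//.
  have h : x <= x ^+ 9 by rewrite -[leLHS]expr1; exact: ler_weXn2l.
  apply: (@le_trans _ _ (4 * x ^+ 9)); last by rewrite [leRHS]exprS ler_wpM2r// exprn_ge0// ltW.
  have -> : 4 * x ^+ 9 = x ^+ 9 + 3 * x ^+ 9 by ring.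
  by rewrite lerD2l ler_pM2l.
have hW : (W n)%:R ^+ 4 <= x ^+ 4.
  by rewrite lerXn2r ?nnegrE ?ler0n ?(ltW x0)// -NE ler_nat Nsize_geW.
have h7 : nrm G ^+ 2 <= (x `^ (- D1)) ^+ 2.
  apply: (le_trans h1); apply: (@le_trans _ _ (x ^+ 4 * (x ^+ 10 * x `^ (- M)))).
    by apply: ler_pM; rewrite ?nrm_ge0 ?exprn_ge0.
  rewrite mulrA -exprD -powR_mulrn ?(ltW x0)// powR_addl//.
  rewrite -[leRHS]powR_mulrn ?powR_ge0// -powRrM; apply: ler_powR => //.
  by rewrite /M; lra.
by rewrite -(@ler_pXn2r _ 2) ?nnegrE ?nrm_ge0 ?powR_ge0.
Unshelve. all: by end_near. Qed.
Hypothesis coefb : forall n b x y, nrm (coef n b x y) <= (N n)%:R `^ C'.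
Hypothesis csupp : forall n (b : block (L n)) (x y : {ffun 'I_u -> site (W n) (L n)}),
  (W n)%:R `^ tau * ell (L n) (s n) <=
    (\max_(i < u) (bdist (blockof (x i)) b + bdist (blockof (y i)) b))%N%:R ->
  coef n b x y = 0.
Hypothesis Lam0 : forall n, 0 < Lam n.
Hypothesis hY : stoch_dom N P
  (fun n (_ : unit) w => \big[Num.max/0]_(b : block (L n)) nrm (Y n b w))
  (fun n _ => Lam n).

Let rad n := (W n)%:R `^ tau * ell (L n) (s n).

(** The truncation level of the matrix entries is N itself, far beyond their
    Gaussian tails, so that a union bound over all entries is harmless. *)
Lemma bad_event_prob (e D1 D2 : R) : 0 < e -> 0 <= D1 -> 0 < D2 ->
  \forall m \near \oo, forall n, N n = m ->
   (P n (bad_event (B n) (E n) (s n) sg (coef n) (rad n) (N n)%:R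
      ((N n)%:R `^ (- D1)) ((N n)%:R `^ e * Lam n)) <=
    (3 * (N n)%:R `^ (- D2))%:E)%E.
Proof.
move=> e_gt0 D10 D20.
have q0 : (0 : R) < 4^-1 by rewrite invr_gt0.
have [N1 hN1] := hY e_gt0 D20.
near=> m.
have b0 : (N1 <= m)%N by near: m; exact: nbhs_infty_ge.
have b1 : expR (- (4^-1 * m%:R `^ 2)) <= m%:R `^ (- (D2 + 3)).
  by near: m; exact: (near_expR_le (a := 2) _ q0).
have b2 : 2 <= m%:R :> R by near: m; exact: nbhs_infty_ger.
have b3 : forall n, N n = m ->
   (P n [set w | exists pq : site (W n) (L n) * site (W n) (L n),
     (rad n <= (bdist (blockof pq.1) (blockof pq.2))%:R /\
     (N n)%:R `^ (- D1) < nrm (fentry (green (B n) (E n) (s n) true w) pq.1 pq.2))%R] <=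
    ((N n)%:R `^ (- D2))%:E)%E.
  by near: m; exact: green_far_prob.
move=> n Nm; have := b3 n Nm; have := hN1 n; rewrite !Nm => /(_ b0) h1 h2.
have x0 : 0 < m%:R :> R by exact: lt_le_trans b2.
have xe : 0 <= m%:R `^ e * Lam n by rewrite mulr_ge0 ?powR_ge0// ltW.
have mxi p : measurable_fun setT (bm_coord (B n) p (s n)).
  exact: (bm_coord_measurable (hBM n) (s_ge0 n)).
have mY b : measurable_fun setT (fun w => nrm (Y n b w)).
  apply: measurable_nrm; exact: (Ysum_cmeasurable _ _ (hBM n) (s_ge0 n) (e0 n)).
rewrite /bad_event.
set b1_ := [set w | exists b, _]; set b2_ := [set w | exists pq : _ * _, _].
set b3_ := [set w | exists p, _].
have m1 : measurable b1_ by apply: measurable_exists => b; exact: (measurable_gt _ (mY b)).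
have m2 : measurable b2_.
  by apply: measurable_exists => pq; exact: (green_far_measurable _ _ (hBM n) (s_ge0 n) (e0 n)).
have m3 : measurable b3_.
  by apply: measurable_exists => p; apply: measurable_gt; exact: measurableT_comp.
have m12 : measurable (b1_ `|` b2_) by exact: measurableU.
apply: (le_trans (measureU2 _ _ _)) => //.
have -> : 3 * m%:R `^ (- D2) = m%:R `^ (- D2) + m%:R `^ (- D2) + m%:R `^ (- D2) by ring.
rewrite !EFinD; apply: leeD.
  apply: (le_trans (measureU2 _ _ _)) => //; apply: leeD => //.
  rewrite (_ : b1_ = [set w | exists v : unit, (m%:R `^ e * Lam n <
     `|\big[Num.max/0]_(b : block (L n)) nrm (Y n b w)|)])//.
  rewrite predeqE => w; split=> [hb|[_]] /=.
    exists tt; rewrite ger0_norm; first exact/bigmax_gtP.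
    by apply: bigmax_ge_id.
  rewrite ger0_norm; last by apply: bigmax_ge_id.
  by move/bigmax_gtP => /(_ xe).
apply: (le_trans (prob_exists_le (M := 2 * expR (- (m%:R ^+ 2 / 4))) _ _)).
- by move=> p; apply: measurable_gt; exact: measurableT_comp.
- move=> p; apply: (bm_coord_tail (hBM n) (s_ge0 n)) => //.
  by apply: ltW; exact: (time_lt1 (W1 n) (L3 n) delta0 (sb n)).
rewrite lee_fin card_prod card_site -/(N n) Nm natrM.
have -> : m%:R ^+ 2 / 4 = 4^-1 * m%:R `^ 2 :> R by rewrite powR_mulrn ?(ltW x0)// mulrC.
apply: (@le_trans _ _ (m%:R * m%:R * (m%:R * m%:R `^ (- (D2 + 3))))).
  by apply: ler_pM => //; apply: ler_pM; rewrite ?expR_ge0.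
rewrite -{1 2 3}[m%:R]powRr1 ?(ltW x0)// !powR_addl//.
by apply: ler_powR; [rewrite (le_trans _ b2)// ler1n|lra].
Unshelve. all: by end_near. Qed.

(** The exponents are fixed in the order D4, D1, D2: the total error N^-D4 must
    survive multiplication by the radius and by N, the far resolvent bound N^-D1
    must beat the number of terms of Y, and the probability N^-D2 of the bad event
    must beat the deterministic bound on Y. *)
Lemma uniform_concentration (e D0 D : R) : 0 < e -> 0 < D0 -> 0 < D ->
  \forall m \near \oo, forall n, N n = m ->
   forall Z : block (L n) -> block (L n) -> R[i],
   (P n [set w | exists a, ((N n)%:R `^ e * (rad n * Lam n *
          Num.sqrt (\sum_b nrm (Z a b) ^+ 2)) +
        (N n)%:R `^ (- D0) * \big[Num.max/0]_b nrm (Z a b) <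
       nrm (\sum_b Z a b * (Y n b w - cexpect (P n) (Y n b))))%R] <=
    ((N n)%:R `^ (- D))%:E)%E.
Proof.
move=> e_gt0 D00 D_gt0.
pose e3 := e / 3; have e30 : 0 < e3 by rewrite divr_gt0.
pose A := `|C'| + 4 * u%:R.
have A0 : 0 <= A by rewrite addr_ge0// mulr_ge0.
pose D4 := e3 + tau + 4 + D0.
pose D1 := A + 7 + D4.
pose D2 := A + 1 + D4 + D.
pose D5 := 2 * tau + 4 + D.
have D40 : 0 < D4 by rewrite /D4; have := tau0; lra.
have D04 : D0 + 2 <= D4 by rewrite /D4; have := tau0; lra.
have D10 : 0 <= D1 by rewrite /D1; lra.
have D20 : 0 < D2 by rewrite /D2; lra.
have D24 : A + 1 + D4 <= D2 by rewrite /D2; lra.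
have DD2 : D + 1 <= D2 by rewrite /D2; lra.
have h2 : (0 : R) < 2^-1 by rewrite invr_gt0.
near=> m.
have b0 : 3200 <= m%:R :> R by near: m; exact: nbhs_infty_ger.
have ux : u%:R <= m%:R :> R by near: m; exact: nbhs_infty_ger.
have b1 : expR (- (2^-1 * m%:R `^ e3)) <= m%:R `^ (- D5).
  by near: m; exact: (near_expR_le _ h2).
have b2 : 2 / Num.sqrt (2 * kappa) <= m%:R by near: m; exact: nbhs_infty_ger.
have y80 : 80 <= m%:R `^ e3 by near: m; exact: (near_powR_ge _ e30).
have b4 : forall n, N n = m ->
   (P n (bad_event (B n) (E n) (s n) sg (coef n) (rad n) (N n)%:R
      ((N n)%:R `^ (- D1)) ((N n)%:R `^ e3 * Lam n)) <=
    (3 * (N n)%:R `^ (- D2))%:E)%E.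
  by near: m; exact: bad_event_prob.
move=> n Nm Z; have hbad := b4 n Nm; clear b4; rewrite !Nm in hbad *.
set x : R := m%:R in b0 ux b1 b2 y80 hbad *.
have xge k : k <= 3200 -> k <= x by move/le_trans; exact.
have x1 : 1 <= x by apply: xge; rewrite ler1n.
have x0 : 0 < x by exact: lt_le_trans x1.
have NE : (Nsize (W n) (L n))%:R = x by rewrite -/(N n) Nm.
have WN : (W n)%:R <= x by rewrite -NE ler_nat Nsize_geW.
have LN : (L n)%:R <= x by rewrite -NE ler_nat ltnW// Nsize_gtL.
have s1 : s n < 1 by exact: (time_lt1 (W1 n) (L3 n) delta0 (sb n)).
have l1 : 1 <= ell (L n) (s n) by exact: ell_ge1.
have lx : ell (L n) (s n) <= x by exact: le_trans (ell_leL _ _) LN.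
have Wr1 : 1 <= (W n)%:R :> R by rewrite ler1n.
have Wt1 : 1 <= (W n)%:R `^ tau by rewrite -[leLHS](powRr0 (W n)%:R) ler_powR// ltW.
have Wtx : (W n)%:R `^ tau <= x `^ tau.
  by apply: ge0_ler_powR; rewrite ?nnegrE ?ler0n ?(ltW x0)//; exact: ltW.
set r := rad n in hbad *.
have r1 : 1 <= r by rewrite -[leLHS]mulr1; apply: ler_pM.
have rx : r <= x `^ (tau + 1).
  rewrite -powR_addl// powRr1 ?(ltW x0)//; apply: ler_pM => //.
  exact: (le_trans ler01 l1).
have r0 : 0 < r by exact: lt_le_trans r1.
have [q [q0 q4 q5]] := ceil_multiple r1.
have etag : (eta (E n) (s n))^-1 <= x ^+ 2.
  have := inv_eta_le (W1 n) (L3 n) kappa0 delta0 (Eb n) (sb n); rewrite NE.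
  by move/le_trans; apply; rewrite expr2 ler_pM2l.
pose y := x `^ e3; have y0 : 0 <= y by exact: powR_ge0.
pose mx a := \big[Num.max/0]_b nrm (Z a b).
have mx0 a : 0 <= mx a by exact: bigmax_ge_id.
have Zmx a b : nrm (Z a b) <= mx a by exact: le_bigmax.
have cardx : #|{: block (L n)}|%:R <= x :> R by rewrite -NE ler_nat card_block_le.
pose v a := Num.sqrt (\sum_b nrm (Z a b) ^+ 2).
have v0 a : 0 <= v a by exact: sqrtr_ge0.
have sq0 a : 0 <= \sum_b nrm (Z a b) ^+ 2 by rewrite sumr_ge0// => b _; rewrite sqr_ge0.
have v2 a : \sum_b nrm (Z a b) ^+ 2 <= v a ^+ 2 by rewrite sqr_sqrtr.
have vx a : v a <= x * mx a.
  have xm : 0 <= x * mx a by rewrite mulr_ge0// ltW.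
  rewrite -(@ler_pXn2r _ 2) ?nnegrE// sqr_sqrtr//.
  apply: (@le_trans _ _ (\sum_(b : block (L n)) mx a ^+ 2)).
    by apply: ler_sum => b _; rewrite lerXn2r ?nnegrE ?nrm_ge0.
  rewrite sumr_const -[_ *+ _]mulr_natl exprMn ler_wpM2r ?sqr_ge0//.
  by rewrite (le_trans cardx)// expr2 ler_peMl// ltW.
have Sx a : \sum_b nrm (Z a b) <= x * mx a.
  apply: (@le_trans _ _ (\sum_(b : block (L n)) mx a)); first exact: ler_sum.
  by rewrite sumr_const -[_ *+ _]mulr_natl ler_wpM2r.
have S0 a : 0 <= \sum_b nrm (Z a b) by rewrite sumr_ge0// => b _; rewrite nrm_ge0.
have x2 : 2 <= x by apply: xge; rewrite ler_nat.
have x3 : 3 <= x by apply: xge; rewrite ler_nat.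
have errt := error_bound x1 (C' := C') x2 ux (lexx D1).
have Bdt := bad_contribution_bound x1 (C' := C') x3 D24.
have conc := @local_concentration R _ _ (P n) (W n) (L n) (B n) (E n) (s n) u sg (coef n)
  r (x ^+ 2) x (x `^ (- D1)) (x `^ C') (x `^ e3 * Lam n) (3 * x `^ (- D2)) (hBM n)
  (s_ge0 n) (e0 n) r0 (exprn_ege1 _ x1) etag (ltW x0) (powR_ge0 _ _)
  (mulr_gt0 (powR_gt0 _ x0) (Lam0 n)) (powR_ge0 _ _) _ (@csupp n) hbad q y q0 q4 y0 Z v v0 v2.
rewrite NE in conc.
have {}conc := conc (fun b x' y' => eq_ind _ (fun k : nat => nrm _ <= k%:R `^ C') (coefb b x' y') _ Nm).
have measZ a M : measurable [set w | M <
    nrm (\sum_b Z a b * (Y n b w - cexpect (P n) (Y n b)))].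
  exact: (sum_deviation_measurable _ _ (hBM n) (s_ge0 n) (e0 n)).
apply: le_trans (le_trans conc _).
  apply: le_measure; rewrite ?inE.
  - by apply: measurable_exists => a; exact: measZ.
  - by apply: measurable_exists => a; exact: measZ.
  move=> w [a ha]; exists a; apply: le_lt_trans ha.
  rewrite -[2 * (x ^+ (2 * u) * _) * _]mulrA.
  apply: (@deviation_arith _ x _ y r q%:R (v a) _ (mx a) (Lam n) _ _ (x `^ (- D4))).
  - exact: ltW.
  - exact: y0.
  - exact: ltW.
  - exact: v0.
  - exact: S0.
  - exact: mx0.
  - exact: ltW.
  - exact: powR_ge0.
  - exact: q5.
  - have -> : x `^ e = y * y ^+ 2.
      by rewrite /y expr2 !powR_addl//; congr (_ `^ _); rewrite /e3; field.
    by rewrite ler_wpM2r// exprn_ge0.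
  - exact: errt.
  - exact: Bdt.
  - exact: vx.
  - exact: Sx.
  - by apply: (radius_error_bound x1 _ rx (lexx _)); apply: xge; rewrite ler_nat.
  - by apply: (flat_error_bound x1 _ D04); apply: xge; rewrite ler_nat.
rewrite lee_fin; apply: (probability_bound x1 b0 (ltW r0) rx _ q5) => //.
- by rewrite !card_prod card_bool natrM mulrC ler_pM2l// -card_prod.
- rewrite expRD; apply: ler_pM; rewrite ?expR_ge0//; last by rewrite mulrC; exact: b1.
  exact: expR_half_le2.
Unshelve. all: by end_near. Qed.

(** The comparison hypothesis is deterministic, so that the two cases of the
    theorem are left with estimates on the rows of Z alone. *)
Lemma deviation_stoch_dom (Z : forall n, block (L n) -> block (L n) -> R[i])
    (zeta : forall n, block (L n) -> R) (D0 : R) : 0 < D0 ->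
  (forall eps, 0 < eps -> exists2 e, 0 < e &
     \forall m \near \oo, forall n, N n = m -> forall a,
       m%:R `^ e * (rad n * Lam n * Num.sqrt (\sum_b nrm (Z n a b) ^+ 2)) +
       m%:R `^ (- D0) * (\big[Num.max/0]_b nrm (Z n a b)) <=
       m%:R `^ eps * zeta n a) ->
  stoch_dom N P
    (fun n (a : block (L n)) w =>
       nrm (\sum_b Z n a b * (Y n b w - cexpect (P n) (Y n b)))) zeta.
Proof.
move=> D00 hZ eps D eps0 D_gt0; have [e e_gt0 he] := hZ eps eps0.
apply: near_nat_exists; near=> m => n Nm.
have h1 : forall n, N n = m -> forall a,
    m%:R `^ e * (rad n * Lam n * Num.sqrt (\sum_b nrm (Z n a b) ^+ 2)) +
    m%:R `^ (- D0) * (\big[Num.max/0]_b nrm (Z n a b)) <=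
    m%:R `^ eps * zeta n a by near: m.
have h2 : forall n, N n = m ->
   forall Z : block (L n) -> block (L n) -> R[i],
   (P n [set w | exists a, ((N n)%:R `^ e * (rad n * Lam n *
          Num.sqrt (\sum_b nrm (Z a b) ^+ 2)) +
        (N n)%:R `^ (- D0) * \big[Num.max/0]_b nrm (Z a b) <
       nrm (\sum_b Z a b * (Y n b w - cexpect (P n) (Y n b))))%R] <=
    ((N n)%:R `^ (- D))%:E)%E.
  by near: m; exact: uniform_concentration.
have := h2 n Nm (Z n); apply: le_trans.
have measZ a M : measurable [set w | M <
    nrm (\sum_b Z n a b * (Y n b w - cexpect (P n) (Y n b)))].
  exact: (sum_deviation_measurable _ _ (hBM n) (s_ge0 n) (e0 n)).
rewrite (_ : [set w | exists v, _] = [set w | exists a : block (L n),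
  (N n)%:R `^ eps * zeta n a <
    nrm (\sum_b Z n a b * (Y n b w - cexpect (P n) (Y n b)))]); last first.
  by rewrite predeqE => w; split=> -[a ha]; exists a; move: ha; rewrite (ger0_norm (nrm_ge0 _)).
apply: le_measure; rewrite ?inE.
- by apply: measurable_exists => a; exact: measZ.
- by apply: measurable_exists => a; exact: measZ.
move=> w [a ha]; exists a; apply: le_lt_trans ha.
by have := h1 n Nm a; rewrite -Nm.
Unshelve. all: by end_near. Qed.
End Sequences.

(** * Row sums and the two cases *)

Section RowSums.
Context (R : realType) (L : nat) (z : block L -> R[i]) (a : block L).

Lemma row_norm_decay (h : R) : 0 <= h ->
  (forall b, nrm (z b) <= h * (1 + (bdist a b)%:R)^-1) ->
  Num.sqrt (\sum_b nrm (z b) ^+ 2) <= h * (4 * (1 + ln L.+1%:R)).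
Proof.
move=> h0 hz; have l0 : 0 <= 4 * (1 + ln L.+1%:R) :> R.
  by rewrite mulr_ge0// addr_ge0// ln_ge0// ler1n.
set K := 4 * _ in l0 *; have -> : h * K = Num.sqrt ((h * K) ^+ 2).
  by rewrite sqrtr_sqr ger0_norm// mulr_ge0.
rewrite ler_wsqrtr// exprMn; apply: (@le_trans _ _ (h ^+ 2 * \sum_b (1 + (bdist a b)%:R) ^- 2)).
  rewrite mulr_sumr; apply: ler_sum => b _; rewrite -exprVn -exprMn.
  by rewrite lerXn2r ?nnegrE ?nrm_ge0// mulr_ge0// invr_ge0 addr_ge0.
by rewrite ler_wpM2l ?sqr_ge0// sum_inv_sqr_bdist.
Qed.

(** Inside the support, 1 + |a - b| < 2 r, so that the bound mx is at most
    2 r mx / (1 + |a - b|). *)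
Lemma row_norm_support (r mx : R) : 1 <= r -> (forall b, nrm (z b) <= mx) ->
  (forall b, r <= (bdist a b)%:R -> z b = 0) ->
  Num.sqrt (\sum_b nrm (z b) ^+ 2) <= 2 * r * mx * (4 * (1 + ln L.+1%:R)).
Proof.
move=> r1 zm hz; have mx0 : 0 <= mx by exact: le_trans (nrm_ge0 _) (zm a).
apply: row_norm_decay => [|b]; first by rewrite !mulr_ge0//; lra.
have d0 : 0 <= (bdist a b)%:R :> R by [].
have p : 0 < 1 + (bdist a b)%:R :> R by lra.
rewrite ler_pdivlMr//.
have [/hz ->|h] := lerP r (bdist a b)%:R; first by rewrite nrm0 mul0r !mulr_ge0//; lra.
rewrite mulrC; apply: ler_pM; rewrite ?nrm_ge0//; lra.
Qed.
End RowSums.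

(** Here e stands for N^(eps/4), one factor of which also bounds the logarithm of
    the row sum. *)
Lemma support_arith (R : realFieldType) (e w lt ls mx lam v q qW : R) :
  2 <= e ^+ 2 -> 0 <= e -> 0 <= w -> 0 <= lt -> 0 <= ls -> 0 <= mx ->
  0 <= lam -> 0 <= qW -> q <= qW -> v <= 2 * (w * lt) * mx * e ->
  e * (w * ls * lam * v) + q * mx <=
  e ^+ 4 * (w * w * lt * ls * mx * lam + qW * mx).
Proof.
move=> e2 e0 w0 lt0 ls0 mx0 lam0 qW0 qq hv; rewrite mulrDr lerD//.
  have -> : e ^+ 4 * (w * w * lt * ls * mx * lam) =
    e * (w * ls * lam * (e ^+ 2 * (w * lt) * mx * e)) by ring.
  rewrite ler_wpM2l// ler_wpM2l ?mulr_ge0//; apply: le_trans hv _.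
  by do 3 (rewrite ler_wpM2r ?mulr_ge0//).
have e1 : 1 <= e ^+ 4.
  have -> : e ^+ 4 = e ^+ 2 ^+ 2 by ring.
  by rewrite exprn_ege1// (le_trans _ e2)// ler1n.
apply: (@le_trans _ _ (qW * mx)); first by rewrite ler_wpM2r.
by rewrite ler_peMl// mulr_ge0.
Qed.

Lemma decay_arith (R : realFieldType) (e w ls mx lam v q qW : R) :
  1 <= e -> 1 <= w -> 0 <= ls -> mx <= e ->
  0 <= lam -> 0 <= q -> q <= qW -> v <= e * e ->
  e * (w * ls * lam * v) + q * mx <= e ^+ 4 * (w * w * ls * lam + qW).
Proof.
move=> e1 w1 ls0 mxe lam0 q0 qq hv; rewrite mulrDr.
have e0 : 0 <= e by lra.
have w0 : 0 <= w by lra.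
have e31 : 1 <= e ^+ 3 by rewrite exprn_ege1.
apply: lerD.
  apply: (@le_trans _ _ (e ^+ 3 * (w * ls * lam))).
    have -> : e ^+ 3 * (w * ls * lam) = e * (w * ls * lam * (e * e)) by ring.
    by rewrite ler_wpM2l// ler_wpM2l ?mulr_ge0.
  have -> : e ^+ 4 * (w * w * ls * lam) = (e * w) * (e ^+ 3 * (w * ls * lam)) by ring.
  rewrite ler_peMl ?mulr_ge0 ?exprn_ge0//.
  by rewrite -[leLHS]mulr1 ler_pM//.
apply: (@le_trans _ _ (e * q)); first by rewrite mulrC ler_wpM2r.
by rewrite ler_pM// exprS ler_peMr.
Qed.

Theorem lemma7p4 (R : realType) (c kappa delta C' : R)
    (u : nat) (sg : 'I_u -> bool) :
  0 < c -> 0 < kappa -> 0 < delta ->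
  exists C : R,
  forall (tau : R) (W L : nat -> nat)
    (d : nat -> measure_display) (T : forall n, measurableType (d n))
    (P : forall n, probability (T n) R)
    (B : forall n, site (W n) (L n) -> site (W n) (L n) -> R -> T n -> R[i])
    (E s s0 Lam : nat -> R)
    (coef : forall n, block (L n) -> {ffun 'I_u -> site (W n) (L n)} ->
              {ffun 'I_u -> site (W n) (L n)} -> R[i]),
  let N := fun n => Nsize (W n) (L n) in
  let Y := fun n => Ysum sg (B n) (E n) (s n) (coef n) in
  0 < tau ->
  (forall n, (1 <= W n)%N /\ (3 <= L n)%N) ->
  (N n @[n --> \oo] --> \oo) ->
  (forall n, (N n)%:R `^ c <= (W n)%:R) ->
  (forall n, hermitian_BM (P n) (B n)) ->
  (forall n, `|E n| <= 2 - kappa) ->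
  (forall n, 0 <= s n <= 1 - (N n)%:R `^ (-1 + delta)) ->
  (forall n b x y, Normc.normc (coef n b x y) <= (N n)%:R `^ C') ->
  (forall n (b : block (L n)) (x y : {ffun 'I_u -> site (W n) (L n)}),
     (W n)%:R `^ tau * ell (L n) (s n) <=
       (\max_(i < u) (bdist (blockof (x i)) b + bdist (blockof (y i)) b))%N%:R ->
     coef n b x y = 0) ->
  (forall n, 0 < Lam n) ->
  stoch_dom N P
    (fun n (_ : unit) w => \big[Num.max/0]_(b : block (L n)) Normc.normc (Y n b w))
    (fun n _ => Lam n) ->
  stoch_dom N P
    (fun n (_ : unit) w =>
       maxnorm (green (B n) (E n) (s n) true w - (msc (E n))%:M))
    (fun n _ => Mt (W n) (L n) (E n) (s n) `^ (- 2^-1)) ->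
  (forall n, 0 <= s0 n <= s n) ->
  (forall D : R, 0 < D ->
     stoch_dom N P
       (fun n (a : block (L n) * block (L n)) w =>
          Normc.normc (Lloop (B n) (E n) (s n) a.1 a.2 w
                - (Kloop (W n) (s n) a.1 a.2)%:C))
       (fun n a =>
          (eta (E n) (s0 n) / eta (E n) (s n)) ^+ 4
          * Mt (W n) (L n) (E n) (s n) ^- 2
          * expR (- (Num.sqrt (bdist a.1 a.2)%:R
                     / Num.sqrt (ell (L n) (s n))))
          + (W n)%:R `^ (- D))) ->
  (forall (t : nat -> R) (Z : forall n, block (L n) -> block (L n) -> R[i]),
     (forall n, s n <= t n < 1) ->
     (forall n a b, (W n)%:R `^ tau * ell (L n) (t n) <= (bdist a b)%:R ->
        Z n a b = 0) ->
     forall D : R, 0 < D ->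
     stoch_dom N P
       (fun n (a : block (L n)) w =>
          Normc.normc (\sum_(b : block (L n))
                  Z n a b * (Y n b w - cexpect (P n) (Y n b))))
       (fun n a =>
          (W n)%:R `^ (C * tau) * ell (L n) (t n) * ell (L n) (s n)
            * (\big[Num.max/0]_(b : block (L n)) Normc.normc (Z n a b)) * Lam n
          + (W n)%:R `^ (- D)
            * (\big[Num.max/0]_(b : block (L n)) Normc.normc (Z n a b))))
  /\
  (forall Z : forall n, block (L n) -> block (L n) -> R[i],
     det_dom N
       (fun n (a : block (L n) * block (L n)) => Normc.normc (Z n a.1 a.2))
       (fun n a => (1 + (bdist a.1 a.2)%:R)^-1) ->
     forall D : R, 0 < D ->
     stoch_dom N P
       (fun n (a : block (L n)) w =>
          Normc.normc (\sum_(b : block (L n))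
                  Z n a b * (Y n b w - cexpect (P n) (Y n b))))
       (fun n _ =>
          (W n)%:R `^ (C * tau) * ell (L n) (s n) * Lam n
          + (W n)%:R `^ (- D))).
Proof.
move=> c0 kappa0 delta0; exists 2.
move=> tau W L d T P B E s s0 Lam coef N Y tau0 WL Ncv Wc hBM Eb sb coefb csupp Lam0 hY _ s0b loop.
have W1 n : (1 <= W n)%N by case: (WL n).
have L3 n : (3 <= L n)%N by case: (WL n).
have s_ge0 n : 0 <= s n by case/andP: (sb n).
have Wr1 n : 1 <= (W n)%:R :> R by rewrite ler1n.
have Wx n : (W n)%:R <= (N n)%:R :> R by rewrite ler_nat Nsize_geW.
have Wt1 n : 1 <= (W n)%:R `^ tau by rewrite -[leLHS](powRr0 (W n)%:R) ler_powR// ltW.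
have W2 n : (W n)%:R `^ (2 * tau) = (W n)%:R `^ tau * (W n)%:R `^ tau.
  by rewrite powR_addl ?ltr0n//; congr (_ `^ _); ring.
have s1 n : s n < 1 by exact: (time_lt1 (W1 n) (L3 n) delta0 (sb n)).
have ls1 n : 1 <= ell (L n) (s n) by exact: ell_ge1.
have WD n D : 0 < D -> (N n)%:R `^ (- D) <= (W n)%:R `^ (- D).
  move=> D0; have x0 : 0 < (N n)%:R :> R by rewrite (lt_le_trans _ (Wx n))// ltr0n.
  rewrite !powRN lef_pV2 ?posrE ?powR_gt0 ?ltr0n//.
    by apply: (ge0_ler_powR (ltW D0)); [rewrite nnegrE|rewrite nnegrE|rewrite ler_nat Nsize_geW].
  by rewrite -(ltr0n R).
have logx n e : (4 * (1 + ln (N n)%:R)) ^+ 2 <= (N n)%:R `^ (2 * e) ->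
    4 * (1 + ln (L n).+1%:R) <= (N n)%:R `^ e :> R.
  move=> h; have hL : (L n).+1%:R <= (N n)%:R :> R by rewrite ler_nat Nsize_gtL.
  have l0 : 0 <= 4 * (1 + ln (L n).+1%:R) :> R.
    by rewrite mulr_ge0// addr_ge0// ln_ge0// ler1n.
  rewrite -(@ler_pXn2r _ 2) ?nnegrE ?powR_ge0//.
  rewrite -[leRHS]powR_mulrn ?powR_ge0// -powRrM [e * _]mulrC.
  apply: le_trans h; rewrite lerXn2r ?nnegrE//.
    by rewrite (le_trans l0)// ler_pM2l// lerD2l ler_ln ?posrE// (lt_le_trans _ hL).
  by rewrite ler_pM2l// lerD2l ler_ln ?posrE// (lt_le_trans _ hL).
split=> [t Z tb Zsupp D D_gt0|Z Zdec D D_gt0].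
  apply: (deviation_stoch_dom c0 kappa0 delta0 tau0 WL Wc hBM Eb sb s0b loop coefb csupp Lam0 hY D_gt0).
  move=> eps eps0; have e40 : 0 < eps / 4 by rewrite divr_gt0.
  have e20 : 0 < eps / 2 by rewrite divr_gt0.
  exists (eps / 4) => //; near=> m => n Nm a.
  have b1 : (4 * (1 + ln m%:R)) ^+ 2 <= m%:R `^ (2 * (eps / 4)).
    by near: m; apply: near_ln_sqr_le; rewrite mulr_gt0.
  have b2 : 2 <= m%:R `^ (eps / 2) by near: m; exact: (near_powR_ge _ e20).
  rewrite -Nm in b1 b2 *.
  have hlog := logx n (eps / 4) b1; set x := (N n)%:R in b2 hlog *.
  have xe k : x `^ (eps / 4) ^+ k = x `^ (k%:R * (eps / 4)).
    by rewrite -powR_mulrn ?powR_ge0// -powRrM mulrC.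
  have /andP[st t1] := tb n.
  have lt1 : 1 <= ell (L n) (t n) by apply: ell_ge1 => //; exact: le_trans (s_ge0 n) st.
  have mx0 : 0 <= \big[Num.max/0]_b nrm (Z n a b) by exact: bigmax_ge_id.
  have -> : x `^ eps = x `^ (eps / 4) ^+ 4 by rewrite xe; congr (_ `^ _); field.
  rewrite W2; apply: support_arith; rewrite ?powR_ge0//.
  - by rewrite xe (_ : 2 * _ = eps / 2)//; field.
  - exact: le_trans ler01 lt1.
  - exact: le_trans ler01 (ls1 n).
  - exact: ltW (Lam0 n).
  - exact: WD.
  apply: le_trans (row_norm_support (a := a) (z := Z n a) (mx := \big[Num.max/0]_b nrm (Z n a b)) (r := (W n)%:R `^ tau * ell (L n) (t n)) _ _ _) _.
  - by rewrite -[leLHS]mulr1 ler_pM.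
  - by move=> b; exact: (le_bigmax _ _ b).
  - by move=> b; exact: Zsupp.
  by rewrite ler_wpM2l// !mulr_ge0 ?powR_ge0// (le_trans ler01 lt1).
apply: (deviation_stoch_dom c0 kappa0 delta0 tau0 WL Wc hBM Eb sb s0b loop coefb csupp Lam0 hY D_gt0).
move=> eps eps0; have e40 : 0 < eps / 4 by rewrite divr_gt0.
exists (eps / 4) => //; have [N1 hN1] := Zdec _ e40; near=> m => n Nm a.
have b1 : (4 * (1 + ln m%:R)) ^+ 2 <= m%:R `^ (2 * (eps / 4)).
  by near: m; apply: near_ln_sqr_le; rewrite mulr_gt0.
have b2 : 1 <= m%:R `^ (eps / 4) by near: m; exact: (near_powR_ge _ e40).
have b3 : (N1 <= m)%N by near: m; exact: nbhs_infty_ge.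
rewrite -Nm in b1 b2 b3 *.
have hlog := logx n (eps / 4) b1; set x := (N n)%:R in b2 hlog *.
have xe k : x `^ (eps / 4) ^+ k = x `^ (k%:R * (eps / 4)).
  by rewrite -powR_mulrn ?powR_ge0// -powRrM mulrC.
have Zb b : nrm (Z n a b) <= x `^ (eps / 4) * (1 + (bdist a b)%:R)^-1.
  by have := hN1 n b3 (a, b); rewrite ger0_norm ?nrm_ge0.
have -> : x `^ eps = x `^ (eps / 4) ^+ 4 by rewrite xe; congr (_ `^ _); field.
rewrite W2; apply: decay_arith; rewrite ?powR_ge0//.
- exact: le_trans ler01 (ls1 n).
- apply: bigmax_le => [|b _]; first exact: powR_ge0.
  by apply: le_trans (Zb b) _; rewrite ler_piMr ?powR_ge0// invf_le1 ?ltr_pwDl// lerDl.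
- exact: ltW (Lam0 n).
- exact: WD.
apply: le_trans (row_norm_decay (powR_ge0 _ _) Zb) _.
by rewrite ler_wpM2l ?powR_ge0.
Unshelve. all: by end_near. Qed.
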